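(* Let $\lambda\in\mathbb{R}$ and let the real valued function $q(x,y)$ satisfy $q_{xx}+q_{yy}-4\lambda q=0$ in the interior $D$ of the equilateral triangle of side $l$, with the Neumann boundary conditions $q_N^{(j)}(s)=f_j(s)$, $s\in[-\frac l2,\frac l2]$, $j=1,2,3$, where the functions $f_j(s)$ have sufficient smoothness and are continuous at the vertices of the triangle. Then the Dirichlet data $q^{(j)}(s)$, $j=1,2,3$, can be expressed in terms of the given Neumann data by the Fourier series $$q^{(j)}(s)=\frac{1}{3l}\sum_{n=-\infty}^{\infty}\left[N(k_{3n})+c_1^{(j)}e^{\frac{2i\pi s}{3l}}N(k_{3n-1})+c_2^{(j)}e^{\frac{4i\pi s}{3l}}N(k_{3n-2})\right]e^{-\frac{2i\pi ns}{l}},$$ where $k_m$ is defined by $$k_m+\frac{\lambda}{k_m}=\frac{2im\pi}{3l},\qquad m\in\mathbb{Z},$$ $$c_1^{(1)}=c_2^{(1)}=1,\qquad c_1^{(2)}=c_2^{(3)}=\bar\alpha,\qquad c_1^{(3)}=c_2^{(2)}=\alpha,$$ $$N(k_m)=\frac{2T_N(k_m)}{\bar\alpha^{m}e(\bar\alpha k_m)-e(-\bar\alpha k_m)},$$ and the known function $T_N$ is defined by $$-\left(ik+\frac{\lambda}{ik}\right)T_N(k)=e(-k)\left[E^3(-i\alpha k)+E^3(i\alpha k)\right]F_1(k)+\left[E^3(-i\bar\alpha k)+E^3(i\bar\alpha k)\right]F_2(k)$$ $$+e(k)\left[E^3(-i\alpha k)+E^3(i\alpha k)\right]F_3(k)+2e^2(k)F_1(\alpha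 k)+2F_2(\alpha k)+2e^2(-k)F_3(\alpha k)$$ $$+2e(-k)F_1(\bar\alpha k)+\left(e^3(k)+e^3(-k)\right)F_2(\bar\alpha k)+2e(k)F_3(\bar\alpha k),$$ with $$F_j(k)=\frac12\int_{-l/2}^{l/2}\exp\left\{\left(k+\frac{\lambda}{k}\right)s\right\}f_j(s)\,ds,\qquad j=1,2,3,\quad k\in\mathbb{C}\setminus\{0\}.$$
   Context: Notation: $z=x+iy$, $\alpha=e^{2i\pi/3}$, $\bar\alpha=e^{-2i\pi/3}$, $l>0$, and for $k\in\mathbb{C}\setminus\{0\}$ $$E(k)=\exp\left\{\left(k+\frac{\lambda}{k}\right)\frac{l}{2\sqrt3}\right\},\qquad e(k)=\exp\left\{\left(k+\frac{\lambda}{k}\right)\frac l2\right\};$$ $e^p(k)$ and $E^p(k)$ denote the $p$-th powers $(e(k))^p$, $(E(k))^p$. $D\subset\mathbb{C}$ is the interior of the equilateral triangle with side length $l$ and vertices $z_1=\frac{l}{\sqrt3}e^{i\pi/3}$, $z_2=\bar z_1$, $z_3=-\frac{l}{\sqrt3}$. The sides $(z_2,z_1)$, $(z_3,z_2)$, $(z_1,z_3)$ are called sides (1), (2), (3) and are parametrized by arclength $s\in[-\frac l2,\frac l2]$ as follows: side (1): $z(s)=\frac{l}{2\sqrt3}+is$; side (2): $z(s)=\left(\frac{l}{2\sqrt3}+is\right)e^{-2i\pi/3}$; side (3): $z(s)=\left(\frac{l}{2\sqrt3}+is\right)e^{2i\pi/3}$. For $j=1,2,3$, $q^{(j)}(s)$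 denotes the value of $q$ on side $(j)$ and $q^{(j)}_N(s)$ denotes the derivative of $q$ along the outward normal on side $(j)$, both at the point with parameter $s$. The function $q$ is assumed continuous up to the vertices. Continuity of the data $f_j$ at the vertices means $f_1(-\frac l2)=f_2(\frac l2)$, $f_2(-\frac l2)=f_3(\frac l2)$, $f_3(-\frac l2)=f_1(\frac l2)$.
   Formalization: Assumes the formula is defined: every k_m is nonzero and neither ik_m+λ/(ik_m) nor the denominator of N(k_m) vanishes. This excludes λ=0 and a discrete set of negative λ. Data are C¹; the Neumann values are limits of the normal derivative from inside D. *)

(* Defs.v *)
From Stdlib Require Import Reals ZArith.
From Coquelicot Require Import Coquelicot.

Open Scope R_scope.

Definition Cexp (z : C) : C :=
  (exp (Re z) * cos (Im z), exp (Re z) * sin (Im z)).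

Definition CpowZ (z : C) (m : Z) : C :=
  match m with
  | Z0 => RtoC 1
  | Zpos p => (z ^ Pos.to_nat p)%C
  | Zneg p => (/ (z ^ Pos.to_nat p))%C
  end.

(* Convergence of a two-sided series with independent upper and lower
   summation limits; it implies convergence of the symmetric partial sums. *)
Definition is_bilateral_series (a : Z -> C) (v : C) : Prop :=
  exists u w : C,
    is_series (V := C_R_NormedModule) (fun n : nat => a (Z.of_nat n)) u /\
    is_series (V := C_R_NormedModule) (fun n : nat => a (- Z.of_nat (S n))%Z) w /\
    v = (u + w)%C.

Definition alpha : C := Cexp (0, 2 * PI / 3).
Definition alphabar : C := Cexp (0, - (2 * PI / 3)).

(** * The triangle *)

Definition vertex1 (l : R) : C := (RtoC (l / sqrt 3) * Cexp (0, PI / 3)%R)%C.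
Definition vertex2 (l : R) : C := Cconj (vertex1 l).
Definition vertex3 (l : R) : C := RtoC (- (l / sqrt 3)).

(* Points by barycentric coordinates. *)
Definition open_triangle (l : R) (z : C) : Prop :=
  exists t1 t2 t3 : R, 0 < t1 /\ 0 < t2 /\ 0 < t3 /\ t1 + t2 + t3 = 1 /\
    z = (RtoC t1 * vertex1 l + RtoC t2 * vertex2 l + RtoC t3 * vertex3 l)%C.

Definition closed_triangle (l : R) (z : C) : Prop :=
  exists t1 t2 t3 : R, 0 <= t1 /\ 0 <= t2 /\ 0 <= t3 /\ t1 + t2 + t3 = 1 /\
    z = (RtoC t1 * vertex1 l + RtoC t2 * vertex2 l + RtoC t3 * vertex3 l)%C.

Inductive side : Set := side1 | side2 | side3.

(* Side (j) is side (1) rotated by this factor; as the outward normal of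
   side (1) is 1, it is also the outward unit normal of side (j). *)
Definition side_normal (j : side) : C :=
  match j with
  | side1 => RtoC 1
  | side2 => alphabar
  | side3 => alpha
  end.

Definition side_point (l : R) (j : side) (s : R) : C :=
  ((l / (2 * sqrt 3), s)%R * side_normal j)%C.

(** * Regularity and boundary values *)

Definition dx (q : R -> R -> R) (x y : R) : R := Derive (fun t => q t y) x.
Definition dy (q : R -> R -> R) (x y : R) : R := Derive (fun t => q x t) y.

Definition C1_in (U : C -> Prop) (q : R -> R -> R) : Prop :=
  forall x y : R, U (x, y) ->
    ex_derive (fun t => q t y) x /\ ex_derive (fun t => q x t) y /\
    continuity_2d_pt (dx q) x y /\ continuity_2d_pt (dy q) x y.

Definition C2_in (U : C -> Prop) (q : R -> R -> R) : Prop :=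
  C1_in U q /\ C1_in U (dx q) /\ C1_in U (dy q).

Definition continuous_on_closed_triangle (l : R) (q : R -> R -> R) : Prop :=
  forall z : C, closed_triangle l z ->
    filterlim (fun w : C => q (Re w) (Im w))
      (within (closed_triangle l) (locally z)) (locally (q (Re z) (Im z))).

Definition side_value (l : R) (q : R -> R -> R) (j : side) (s : R) : R :=
  q (Re (side_point l j s)) (Im (side_point l j s)).

(* The outward normal derivative on side (j) is the boundary value, from inside
   the triangle, of the derivative in the direction of the normal.  At a vertex
   the normal line to a side does not meet the triangle, so that a one-sided
   difference quotient would make no sense there. *)
Definition has_normal_derivative
    (l : R) (q : R -> R -> R) (j : side) (s v : R) : Prop :=
  filterlim
    (fun w : C => Re (side_normal j) * dx q (Re w) (Im w)
                  + Im (side_normal j) * dy q (Re w) (Im w))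
    (within (open_triangle l) (locally (side_point l j s))) (locally v).

Definition continuous_on_segment (a b : R) (f : R -> R) : Prop :=
  forall s : R, a <= s <= b ->
    filterlim f (within (fun t => a <= t <= b) (locally s)) (locally (f s)).

Definition C1_on_segment (a b : R) (f : R -> R) : Prop :=
  continuous_on_segment a b f /\
  exists g : R -> R, continuous_on_segment a b g /\
    forall s : R, a < s < b -> is_derive f s (g s).

(** * The functions of the spectral variable *)

Definition W (lam : R) (k : C) : C := (k + RtoC lam / k)%C.

Definition Efun (l lam : R) (k : C) : C :=
  Cexp (W lam k * RtoC (l / (2 * sqrt 3)))%C.

Definition efun (l lam : R) (k : C) : C :=
  Cexp (W lam k * RtoC (l / 2))%C.

Definition Ffun (l lam : R) (f : side -> R -> R) (j : side) (k : C) : C :=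
  (RtoC (1 / 2) *
   RInt (V := C_R_CompleteNormedModule)
     (fun s : R => Cexp (W lam k * RtoC s) * RtoC (f j s)) (- (l / 2)) (l / 2))%C.

Definition T_N_coef (lam : R) (k : C) : C := (Ci * k + RtoC lam / (Ci * k))%C.

Definition T_N (l lam : R) (f : side -> R -> R) (k : C) : C :=
  let e := efun l lam in
  let E := Efun l lam in
  let F1 := Ffun l lam f side1 in
  let F2 := Ffun l lam f side2 in
  let F3 := Ffun l lam f side3 in
  let a := alpha in
  let b := alphabar in
  let i := Ci in
  let two := RtoC 2 in
  ((  e (- k) * (E (- (i * a * k)) ^ 3 + E (i * a * k) ^ 3) * F1 k
    + (E (- (i * b * k)) ^ 3 + E (i * b * k) ^ 3) * F2 k
    + e k * (E (- (i * a * k)) ^ 3 + E (i * a * k) ^ 3) * F3 k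
    + two * e k ^ 2 * F1 (a * k)
    + two * F2 (a * k)
    + two * e (- k) ^ 2 * F3 (a * k)
    + two * e (- k) * F1 (b * k)
    + (e k ^ 3 + e (- k) ^ 3) * F2 (b * k)
    + two * e k * F3 (b * k))
   / - T_N_coef lam k)%C.

Definition N_den (l lam : R) (m : Z) (k : C) : C :=
  (CpowZ alphabar m * efun l lam (alphabar * k)
   - efun l lam (- (alphabar * k)))%C.

(* [N_fun] depends on [m] as well as on the number [k = k_m]. *)
Definition N_fun (l lam : R) (f : side -> R -> R) (m : Z) (k : C) : C :=
  (RtoC 2 * T_N l lam f k / N_den l lam m k)%C.

Definition coef_c1 (j : side) : C :=
  match j with
  | side1 => RtoC 1
  | side2 => alphabar
  | side3 => alpha
  end.

Definition coef_c2 (j : side) : C :=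
  match j with
  | side1 => RtoC 1
  | side2 => alpha
  | side3 => alphabar
  end.

(* Main.v *)
Require Import Defs.
From Stdlib Require Import Reals ZArith Lra Lia Psatz.
From Coquelicot Require Import Coquelicot.
Open Scope R_scope.

(** Read the boundary values of [q] as one function of arclength on the perimeter,
    of length [3 l].  The claimed series is its Fourier series, so two facts are needed.

    First, [N (k_m)] is its [m]-th Fourier coefficient.  Green's identity for [q] and
    [exp (P x + Q y)], [P^2 + Q^2 = 4 lam], gives the global relation; it holds on the
    triangles [r D], [r < 1], because the flux of a divergence-free field through the
    boundary of [r D] has zero [r]-derivative, and passes to [r = 1] by uniform
    convergence.  A combination of the relations for [k], [alpha k], [alphabar k] and
    their images under [k |-> lam / k] is a test function whose normal derivative on the
    perimeter is [exp (i mu_m t)] up to a factor, which yields the coefficient.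

    Second, the explicit formula and an integration by parts give [N (k_m) = O(m^-2)], so
    the series converges absolutely, and by Fejer's theorem its sum is the continuous
    boundary function. *)

(** * Geometry of the triangle *)

(** The dilations [r D] answer the weak boundary hypotheses: near a side only [q] and the derivative
    along the normal of that side are controlled, not the full gradient. A homothety keeps every
    normal direction, so Green's identity on [r D] involves exactly the quantities that have limits
    as r tends to 1.

    The elimination has nine unknown transforms (three sides, at k, [alpha k], [alphabar k]) against
    six relations. The involution k -> lam / k preserves [W] and reverses [T_N_coef], so it adds
    relations without adding unknowns. The defining equation of k_m makes exp (W l / 4) a twelfth
    root of unity; this lets the six unknowns at [alpha k] and [alphabar k] cancel and leaves the
    three at k weighted as in a Fourier coefficient of a function of period 3 l.

    The decay is read off the data f_j alone: [q] is merely continuous on the boundary, so its own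
    smoothness could not make the series converge. *)

Definition apothem (l : R) : R := l / (2 * sqrt 3).
Definition nx (j : side) : R := Re (side_normal j).
Definition ny (j : side) : R := Im (side_normal j).
Definition side_x (l : R) (j : side) (s : R) : R := apothem l * nx j - s * ny j.
Definition side_y (l : R) (j : side) (s : R) : R := apothem l * ny j + s * nx j.

Lemma sqrt3_sq : sqrt 3 * sqrt 3 = 3.
Proof. apply sqrt_sqrt; lra. Qed.

Lemma sqrt3_pos : 0 < sqrt 3.
Proof. apply sqrt_lt_R0; lra. Qed.

Lemma alphaE : alpha = (- (1 / 2), sqrt 3 / 2).
Proof.
unfold alpha, Cexp; cbn [Re Im fst snd].
replace (2 * PI / 3) with (2 * (PI / 3)) by field.
rewrite exp_0, cos_2PI3, sin_2PI3; f_equal; field.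
Qed.

Lemma alphabarE : alphabar = (- (1 / 2), - (sqrt 3 / 2)).
Proof.
unfold alphabar, Cexp; cbn [Re Im fst snd].
replace (2 * PI / 3) with (2 * (PI / 3)) by field.
rewrite exp_0, cos_neg, sin_neg, cos_2PI3, sin_2PI3; f_equal; field.
Qed.

Lemma nxE (j : side) : nx j = match j with side1 => 1 | _ => - (1 / 2) end.
Proof.
unfold nx; destruct j; cbn [side_normal]; rewrite ?alphaE, ?alphabarE; reflexivity.
Qed.

Lemma nyE (j : side) :
  ny j = match j with side1 => 0 | side2 => - (sqrt 3 / 2) | side3 => sqrt 3 / 2 end.
Proof.
unfold ny; destruct j; cbn [side_normal]; rewrite ?alphaE, ?alphabarE; reflexivity.
Qed.

Lemma normal_unit (j : side) : nx j * nx j + ny j * ny j = 1.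
Proof. rewrite nxE, nyE; pose proof sqrt3_sq; destruct j; nra. Qed.

Lemma apothem_side (l : R) : l = 2 * sqrt 3 * apothem l.
Proof. unfold apothem; pose proof sqrt3_pos; field; lra. Qed.

Lemma apothem_pos (l : R) : 0 < l -> 0 < apothem l.
Proof.
intros Hl; unfold apothem; apply Rdiv_lt_0_compat; [lra|].
pose proof sqrt3_pos; lra.
Qed.

Lemma side_pointE (l : R) (j : side) (s : R) : side_point l j s = (side_x l j s, side_y l j s).
Proof.
unfold side_point, side_x, side_y, nx, ny, apothem, Cmult; destruct (side_normal j) as [a b].
cbn [fst snd Re Im]; f_equal; ring.
Qed.

Lemma vertex1E (l : R) : vertex1 l = (apothem l, l / 2).
Proof.
unfold vertex1, Cexp, RtoC, Cmult, apothem; cbn [Re Im fst snd].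
rewrite exp_0, cos_PI3, sin_PI3.
pose proof sqrt3_pos; f_equal; field; lra.
Qed.

Lemma vertex2E (l : R) : vertex2 l = (apothem l, - (l / 2)).
Proof. unfold vertex2; rewrite vertex1E; reflexivity. Qed.

Lemma vertex3E (l : R) : vertex3 l = (- (2 * apothem l), 0).
Proof.
unfold vertex3, RtoC, apothem; pose proof sqrt3_pos; f_equal; field; lra.
Qed.

Lemma barycentreE (l t1 t2 t3 : R) :
  (RtoC t1 * vertex1 l + RtoC t2 * vertex2 l + RtoC t3 * vertex3 l)%C
  = (apothem l * (t1 + t2 - 2 * t3), l / 2 * (t1 - t2)).
Proof.
rewrite vertex1E, vertex2E, vertex3E; unfold RtoC, Cmult, Cplus; cbn [fst snd].
f_equal; ring.
Qed.

(* The barycentric coordinate attached to side [j] is that of the opposite vertex. *)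
Definition height (l x y : R) (j : side) : R :=
  (apothem l - (nx j * x + ny j * y)) / (3 * apothem l).

Lemma barycentric_height (l x y : R) : 0 < l ->
  height l x y side2 + height l x y side3 + height l x y side1 = 1 /\
  (x, y) = (RtoC (height l x y side2) * vertex1 l + RtoC (height l x y side3) * vertex2 l
            + RtoC (height l x y side1) * vertex3 l)%C.
Proof.
intros Hl; pose proof (apothem_pos l Hl) as Hc; pose proof sqrt3_sq as H33.
rewrite barycentreE; unfold height; rewrite !nxE, !nyE.
split; [field; lra|f_equal; [field; lra|]].
rewrite (apothem_side l) at 1; set (c := apothem l) in *; clearbody c.
transitivity (sqrt 3 * sqrt 3 * y / 3); [rewrite H33; field | field; lra].
Qed.

Lemma height_barycentric (l t1 t2 t3 : R) (j : side) : 0 < l -> t1 + t2 + t3 = 1 ->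
  height l (apothem l * (t1 + t2 - 2 * t3)) (l / 2 * (t1 - t2)) j
  = match j with side1 => t3 | side2 => t1 | side3 => t2 end.
Proof.
intros Hl Ht; pose proof (apothem_pos l Hl) as Hc; pose proof sqrt3_sq as H33.
unfold height; rewrite (apothem_side l) at 3; set (c := apothem l) in *; clearbody c.
apply (Rmult_eq_reg_r (3 * c)); [|lra]; unfold Rdiv at 1.
rewrite Rmult_assoc, Rinv_l, Rmult_1_r by lra.
replace t3 with (1 - t1 - t2) by lra.
rewrite nxE, nyE; destruct j; field [H33].
Qed.

Lemma height_pos (l x y : R) (j : side) : 0 < l ->
  0 < height l x y j <-> nx j * x + ny j * y < apothem l.
Proof.
intros Hl; pose proof (apothem_pos l Hl) as Hc; unfold height; split; intros H.
- apply (Rmult_lt_compat_r (3 * apothem l)) in H; [|lra].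
  unfold Rdiv in H; rewrite Rmult_assoc, Rinv_l in H; lra.
- apply Rdiv_lt_0_compat; lra.
Qed.

Lemma height_nonneg (l x y : R) (j : side) : 0 < l ->
  0 <= height l x y j <-> nx j * x + ny j * y <= apothem l.
Proof.
intros Hl; pose proof (apothem_pos l Hl) as Hc; unfold height; split; intros H.
- apply (Rmult_le_compat_r (3 * apothem l)) in H; [|lra].
  unfold Rdiv in H; rewrite Rmult_assoc, Rinv_l in H; lra.
- apply Rdiv_le_0_compat; lra.
Qed.

Lemma open_triangleP (l x y : R) : 0 < l ->
  open_triangle l (x, y) <-> forall j, nx j * x + ny j * y < apothem l.
Proof.
intros Hl; split.
- intros (t1 & t2 & t3 & H1 & H2 & H3 & Hsum & E) j.
  rewrite barycentreE in E; injection E as -> ->.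
  apply height_pos; [exact Hl|]; rewrite height_barycentric by assumption.
  destruct j; assumption.
- intros H; destruct (barycentric_height l x y Hl) as [H1 H2].
  exists (height l x y side2), (height l x y side3), (height l x y side1).
  repeat split; try exact H1; try exact H2; apply height_pos; auto.
Qed.

Lemma closed_triangleP (l x y : R) : 0 < l ->
  closed_triangle l (x, y) <-> forall j, nx j * x + ny j * y <= apothem l.
Proof.
intros Hl; split.
- intros (t1 & t2 & t3 & H1 & H2 & H3 & Hsum & E) j.
  rewrite barycentreE in E; injection E as -> ->.
  apply height_nonneg; [exact Hl|]; rewrite height_barycentric by assumption.
  destruct j; assumption.
- intros H; destruct (barycentric_height l x y Hl) as [H1 H2].
  exists (height l x y side2), (height l x y side3), (height l x y side1).
  repeat split; try exact H1; try exact H2; apply height_nonneg; auto.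
Qed.

Lemma side_in_closed (l : R) (j : side) (s : R) : 0 < l -> - (l / 2) <= s <= l / 2 ->
  closed_triangle l (side_x l j s, side_y l j s).
Proof.
intros Hl Hs; apply closed_triangleP; [exact Hl|]; intros i.
pose proof (apothem_pos l Hl) as Hc; pose proof sqrt3_pos as H3.
pose proof sqrt3_sq as H33; pose proof (apothem_side l) as Hs'.
unfold side_x, side_y; set (c := apothem l) in *; rewrite Hs' in Hs; clearbody c; clear Hs'.
assert (Hk : - (3 * c) <= sqrt 3 * s <= 3 * c) by (split; nra).
replace (nx i * (c * nx j - s * ny j) + ny i * (c * ny j + s * nx j)) with
  (c * (nx i * nx j + ny i * ny j) + s * (ny i * nx j - nx i * ny j)) by ring.
rewrite !nxE, !nyE; destruct i, j; nra.
Qed.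

(** The circumradius is twice the apothem, so the triangle reflected in its centre and halved still
    fits inside: hence the bound -1/2. Negative ratios make r = 0 an interior point of the range,
    where the flux must be differentiable too. *)
Lemma homothety_open (l r x y : R) : 0 < l -> - (1 / 2) < r < 1 ->
  closed_triangle l (x, y) -> open_triangle l (r * x, r * y).
Proof.
intros Hl Hr Hz; apply open_triangleP; [exact Hl|]; intros i.
pose proof (proj1 (closed_triangleP l x y Hl) Hz) as Hz'; clear Hz; rename Hz' into Hz.
pose proof (apothem_pos l Hl) as Hc.
pose proof (Hz side1) as h1; pose proof (Hz side2) as h2; pose proof (Hz side3) as h3.
rewrite nxE, nyE in h1, h2, h3; rewrite nxE, nyE.
set (u := sqrt 3 / 2 * y) in *.
replace (- (sqrt 3 / 2) * y) with (- u) in * by (unfold u; ring).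
destruct i.
- destruct (Rle_dec 0 r); nra.
- replace (- (1 / 2) * (r * x) + - (sqrt 3 / 2) * (r * y)) with
    (r * (- (1 / 2) * x + - u)) by (unfold u; field).
  destruct (Rle_dec 0 r); nra.
- replace (- (1 / 2) * (r * x) + (sqrt 3 / 2) * (r * y)) with
    (r * (- (1 / 2) * x + u)) by (unfold u; field).
  destruct (Rle_dec 0 r); nra.
Qed.

Lemma open_triangle_open (l x y : R) : 0 < l -> open_triangle l (x, y) ->
  locally (x, y) (fun z : R * R => open_triangle l z).
Proof.
intros Hl H; pose proof (proj1 (open_triangleP l x y Hl) H) as H'.
assert (K : forall j, locally (x, y)
  (fun z : R * R => nx j * fst z + ny j * snd z < apothem l)).
{ intros j.
  assert (Hc : continuous (fun z : R * R => nx j * fst z + ny j * snd z) (x, y)).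
  { apply (continuous_plus (V := R_NormedModule)).
    - apply (continuous_scal_r (V := R_NormedModule)), continuous_fst.
    - apply (continuous_scal_r (V := R_NormedModule)), continuous_snd. }
  apply (Hc (fun u => u < apothem l)); apply (open_lt (apothem l)), H'. }
generalize (filter_and _ _ (K side1) (filter_and _ _ (K side2) (K side3))).
apply filter_imp; intros [u v] (h1 & h2 & h3); apply open_triangleP; [exact Hl|].
intros [| |]; assumption.
Qed.

(** The counterclockwise order of the sides: side j ends, at s = l / 2, where [next j] starts. *)
Definition next (j : side) : side :=
  match j with side1 => side3 | side3 => side2 | side2 => side1 end.

Lemma corner (l : R) (j : side) :
  side_x l (next j) (- (l / 2)) = side_x l j (l / 2) /\ side_y l (next j) (- (l / 2)) = side_y l j (l / 2).
Proof.
pose proof sqrt3_sq as H33; pose proof (apothem_side l) as Hs.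
unfold side_x, side_y; set (c := apothem l) in *; clearbody c; rewrite Hs; clear Hs l.
rewrite !nxE, !nyE; destruct j; cbn [next]; split; field [H33].
Qed.

(** * Flux of a divergence-free field *)

Lemma continuity_2d_pt_comp (f u v : R -> R -> R) (x y : R) :
  continuity_2d_pt f (u x y) (v x y) ->
  continuity_2d_pt u x y -> continuity_2d_pt v x y ->
  continuity_2d_pt (fun r s => f (u r s) (v r s)) x y.
Proof.
intros Hf Hu Hv eps.
destruct (Hf eps) as [d Hd].
destruct (Hu d) as [d1 H1]; destruct (Hv d) as [d2 H2].
assert (Hm : 0 < Rmin d1 d2) by (apply Rmin_pos; apply cond_pos).
exists (mkposreal _ Hm); cbn; intros r s Hr Hs.
apply Hd; [apply H1|apply H2]; eapply Rlt_le_trans; try eassumption;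
  first [apply Rmin_l | apply Rmin_r].
Qed.

Lemma C1_in_differentiable (U : C -> Prop) (f : R -> R -> R) (x y : R) :
  locally (x, y) (fun z : R * R => U z) -> C1_in U f ->
  differentiable_pt_lim f x y (dx f x y) (dy f x y).
Proof.
intros HU Hf; apply filterdiff_differentiable_pt_lim.
pose proof (locally_singleton _ _ HU) as Hxy.
destruct (Hf x y Hxy) as (_ & Hy & Hcx & _).
apply (is_derive_filterdiff f x y (dx f) (dy f x y)).
- revert HU; apply filter_imp; intros [u v] Huv.
  apply Derive_correct, (proj1 (Hf u v Huv)).
- apply Derive_correct, Hy.
- apply continuity_2d_pt_filterlim, Hcx.
Qed.

Lemma C1_in_continuity (U : C -> Prop) (f : R -> R -> R) (x y : R) :
  locally (x, y) (fun z : R * R => U z) -> C1_in U f -> continuity_2d_pt f x y.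
Proof.
intros HU Hf; apply differentiable_continuity_pt.
exists (dx f x y), (dy f x y); apply (C1_in_differentiable U); assumption.
Qed.

Lemma C1_in_derive_curve (U : C -> Prop) (f : R -> R -> R) (u v : R -> R) (t du dv : R) :
  locally (u t, v t) (fun z : R * R => U z) -> C1_in U f ->
  is_derive u t du -> is_derive v t dv ->
  is_derive (fun t => f (u t) (v t)) t (dx f (u t) (v t) * du + dy f (u t) (v t) * dv).
Proof.
intros HU Hf Hu Hv; apply is_derive_Reals, derivable_pt_lim_comp_2d.
- apply (C1_in_differentiable U); assumption.
- apply is_derive_Reals; exact Hu.
- apply is_derive_Reals; exact Hv.
Qed.

Section Flux.

Variables (U : C -> Prop) (A B : R -> R -> R) (a b c h : R).
Hypothesis h_pos : 0 <= h.
Hypothesis U_open : forall x y, U (x, y) -> locally (x, y) (fun z : R * R => U z).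
Hypothesis A_C1 : C1_in U A.
Hypothesis B_C1 : C1_in U B.
Hypothesis div0 : forall x y, U (x, y) -> dx A x y + dy B x y = 0.

(** For a side with normal (a, b) at distance c from the centre, (px, py) is the point of parameter
    s after the homothety of ratio r. The flux density per unit of s is then r * G, the factor r
    being the ratio of arclengths. *)
Let px (r s : R) := r * (c * a - s * b).
Let py (r s : R) := r * (c * b + s * a).
Let G (r s : R) := a * A (px r s) (py r s) + b * B (px r s) (py r s).
Let cross (r s : R) :=
  (c * b + s * a) * A (px r s) (py r s) - (c * a - s * b) * B (px r s) (py r s).
(** The r-derivative of r * G, expanded by the product and chain rules so that it can be compared
    with an s-derivative. *)
Let D (r s : R) :=
  G r s + r * ((c * a - s * b) * (a * dx A (px r s) (py r s) + b * dx B (px r s) (py r s))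
             + (c * b + s * a) * (a * dy A (px r s) (py r s) + b * dy B (px r s) (py r s))).

Local Lemma px_cont r s : continuity_2d_pt px r s.
Proof.
unfold px; apply continuity_2d_pt_mult; [apply continuity_2d_pt_id1|].
apply continuity_2d_pt_minus; [apply continuity_2d_pt_const|].
apply continuity_2d_pt_mult; [apply continuity_2d_pt_id2|apply continuity_2d_pt_const].
Qed.

Local Lemma py_cont r s : continuity_2d_pt py r s.
Proof.
unfold py; apply continuity_2d_pt_mult; [apply continuity_2d_pt_id1|].
apply continuity_2d_pt_plus; [apply continuity_2d_pt_const|].
apply continuity_2d_pt_mult; [apply continuity_2d_pt_id2|apply continuity_2d_pt_const].
Qed.

Local Lemma at_point_cont f r s : continuity_2d_pt f (px r s) (py r s) ->
  continuity_2d_pt (fun r s => f (px r s) (py r s)) r s.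
Proof.
intros Hf; apply continuity_2d_pt_comp; [exact Hf|apply px_cont|apply py_cont].
Qed.

Local Lemma near_U r s : U (px r s, py r s) ->
  locally_2d (fun r s => U (px r s, py r s)) r s.
Proof.
intros H; pose proof (U_open _ _ H) as [e He].
destruct (px_cont r s e) as [d1 H1]; destruct (py_cont r s e) as [d2 H2].
assert (Hm : 0 < Rmin d1 d2) by (apply Rmin_pos; apply cond_pos).
exists (mkposreal _ Hm); cbn; intros u v Hu Hv.
apply (He (px u v, py u v)); split; [apply H1|apply H2];
  eapply Rlt_le_trans; try eassumption; first [apply Rmin_l | apply Rmin_r].
Qed.

Local Lemma rG_derive r s : U (px r s, py r s) ->
  is_derive (fun r => r * G r s) r (D r s).
Proof.
intros H; pose proof (U_open _ _ H) as HU.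
assert (Hx : is_derive (fun r => px r s) r (c * a - s * b)).
{ unfold px; auto_derive; [exact I|ring]. }
assert (Hy : is_derive (fun r => py r s) r (c * b + s * a)).
{ unfold py; auto_derive; [exact I|ring]. }
pose proof (C1_in_derive_curve U A (fun r => px r s) (fun r => py r s) r _ _ HU A_C1 Hx Hy) as HA.
pose proof (C1_in_derive_curve U B (fun r => px r s) (fun r => py r s) r _ _ HU B_C1 Hx Hy) as HB.
cbn in HA, HB; unfold D, G.
set (fA := fun t : R => A (px t s) (py t s)) in HA.
set (fB := fun t : R => B (px t s) (py t s)) in HB.
change (is_derive (fun r => r * (a * fA r + b * fB r)) r
  (a * fA r + b * fB r + r * ((c * a - s * b) * (a * dx A (px r s) (py r s) + b * dx B (px r s) (py r s))
             + (c * b + s * a) * (a * dy A (px r s) (py r s) + b * dy B (px r s) (py r s))))).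
auto_derive.
- repeat split; eexists; eassumption.
- change (fun x => fA x) with fA; change (fun x => fB x) with fB;
  rewrite (is_derive_unique _ _ _ HA), (is_derive_unique _ _ _ HB); ring.
Qed.

(* [D] is also the [s]-derivative of minus the cross product of the position with the
   field: this is where the divergence enters. *)
Local Lemma cross_derive r s : U (px r s, py r s) -> is_derive (cross r) s (D r s).
Proof.
intros H; pose proof (U_open _ _ H) as HU.
assert (Hx : is_derive (fun s => px r s) s (- (r * b))).
{ unfold px; auto_derive; [exact I|ring]. }
assert (Hy : is_derive (fun s => py r s) s (r * a)).
{ unfold py; auto_derive; [exact I|ring]. }
pose proof (C1_in_derive_curve U A (fun s => px r s) (fun s => py r s) s _ _ HU A_C1 Hx Hy) as HA.
pose proof (C1_in_derive_curve U B (fun s => px r s) (fun s => py r s) s _ _ HU B_C1 Hx Hy) as HB.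
pose proof (div0 _ _ H) as Hd.
cbn in HA, HB; unfold D, G, cross.
set (fA := fun t : R => A (px r t) (py r t)) in HA.
set (fB := fun t : R => B (px r t) (py r t)) in HB.
change (is_derive (fun s => (c * b + s * a) * fA s - (c * a - s * b) * fB s) s
  (a * fA s + b * fB s + r * ((c * a - s * b) * (a * dx A (px r s) (py r s) + b * dx B (px r s) (py r s))
             + (c * b + s * a) * (a * dy A (px r s) (py r s) + b * dy B (px r s) (py r s))))).
auto_derive.
- repeat split; eexists; eassumption.
- change (fun x => fA x) with fA; change (fun x => fB x) with fB;
  rewrite (is_derive_unique _ _ _ HA), (is_derive_unique _ _ _ HB).
  replace (dy B (px r s) (py r s)) with (- dx A (px r s) (py r s)) by lra.
  ring.
Qed.

Local Lemma D_cont r s : U (px r s, py r s) -> continuity_2d_pt D r s.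
Proof.
intros H; pose proof (U_open _ _ H) as HU.
pose proof (C1_in_continuity U A _ _ HU A_C1) as cA.
pose proof (C1_in_continuity U B _ _ HU B_C1) as cB.
destruct (A_C1 _ _ H) as (_ & _ & cAx & cAy); destruct (B_C1 _ _ H) as (_ & _ & cBx & cBy).
unfold D, G.
repeat first [ apply at_point_cont; assumption | apply continuity_2d_pt_minus
  | apply continuity_2d_pt_plus | apply continuity_2d_pt_mult
  | apply continuity_2d_pt_const | apply continuity_2d_pt_id1 | apply continuity_2d_pt_id2 ].
Qed.

Lemma continuity_2d_snd (f : R -> R -> R) r s :
  continuity_2d_pt f r s -> continuous (f r) s.
Proof.
intros Hf; apply continuity_pt_filterlim; intros eps Heps.
destruct (Hf (mkposreal eps Heps)) as [d Hd].
exists d; split; [apply cond_pos|]; intros t [_ Ht]; apply Hd; [|exact Ht].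
rewrite Rminus_diag, Rabs_R0; apply cond_pos.
Qed.

(** Under the integral sign the r-derivative is [D], an exact s-derivative, so only the values of
    [cross] at the two corners of the side survive. *)
Lemma flux_derive (r : R) :
  locally r (fun r => forall s, - h <= s <= h -> U (px r s, py r s)) ->
  is_derive (fun r => RInt (fun s => r * G r s) (- h) h) r (cross r h - cross r (- h)).
Proof.
intros Hloc; pose proof (locally_singleton _ _ Hloc) as Hr.
assert (Emin : Rmin (- h) h = - h) by (apply Rmin_left; lra).
assert (Emax : Rmax (- h) h = h) by (apply Rmax_right; lra).
assert (HI : is_RInt (D r) (- h) h (cross r h - cross r (- h))).
{ apply (is_RInt_derive (cross r)); rewrite Emin, Emax; intros s Hs.
  - apply cross_derive, Hr, Hs.
  - apply continuity_2d_snd, D_cont, Hr, Hs. }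
evar_last.
- apply (is_derive_RInt_param (fun r s => r * G r s)); rewrite ?Emin, ?Emax.
  + revert Hloc; apply filter_imp; intros x Hx s Hs; exists (D x s).
    apply rG_derive, Hx, Hs.
  + intros s Hs; apply continuity_2d_pt_ext_loc with D; [|apply D_cont, Hr, Hs].
    generalize (near_U r s (Hr s Hs)); apply locally_2d_impl, locally_2d_forall.
    intros u v Huv; symmetry; apply is_derive_unique, rG_derive, Huv.
  + revert Hloc; apply filter_imp; intros x Hx.
    apply (ex_RInt_continuous (V := R_CompleteNormedModule)).
    rewrite Emin, Emax; intros s Hs.
    apply (continuity_2d_snd (fun r s => r * G r s)).
    pose proof (Hx s Hs) as H; pose proof (U_open _ _ H) as HU.
    apply continuity_2d_pt_mult; [apply continuity_2d_pt_id1|].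
    apply continuity_2d_pt_plus; apply continuity_2d_pt_mult;
      try apply continuity_2d_pt_const; apply at_point_cont.
    * apply (C1_in_continuity U); assumption.
    * apply (C1_in_continuity U); assumption.
- rewrite <- (is_RInt_unique _ _ _ _ HI); apply RInt_ext; rewrite Emin, Emax.
  intros s Hs; apply is_derive_unique, rG_derive, Hr; lra.
Qed.

End Flux.

(** The corner terms of neighbouring sides cancel, so the total of the [I j] is constant in r. Since
    [I] carries the factor r, the constant is its value 0 at r = 0, and no estimate near the centre
    is needed. *)
Lemma flux_zero (l : R) (A B : R -> R -> R) (r : R) : 0 < l ->
  C1_in (open_triangle l) A -> C1_in (open_triangle l) B ->
  (forall x y, open_triangle l (x, y) -> dx A x y + dy B x y = 0) ->
  0 < r < 1 ->
  let flux j := RInt (fun s => nx j * A (r * side_x l j s) (r * side_y l j s)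
                             + ny j * B (r * side_x l j s) (r * side_y l j s)) (- (l / 2)) (l / 2) in
  flux side1 + flux side2 + flux side3 = 0.
Proof.
intros Hl HA HB Hdiv Hr flux.
set (I := fun j r => RInt (fun s => r * (nx j * A (r * side_x l j s) (r * side_y l j s)
                             + ny j * B (r * side_x l j s) (r * side_y l j s))) (- (l / 2)) (l / 2)).
set (V := fun r x y => y * A (r * x) (r * y) - x * B (r * x) (r * y)).
assert (HD : forall j t, - (1 / 2) < t < 1 ->
  is_derive (I j) t (V t (side_x l j (l / 2)) (side_y l j (l / 2))
                   - V t (side_x l j (- (l / 2))) (side_y l j (- (l / 2))))).
{ intros j t Ht.
  apply (flux_derive (open_triangle l) A B (nx j) (ny j) (apothem l) (l / 2)); try assumption.
  - lra.
  - intros x y; apply open_triangle_open, Hl.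
  - assert (Hloc : locally t (fun t => - (1 / 2) < t < 1)).
    { apply filter_and; [apply (open_gt (- (1 / 2)))|apply (open_lt 1)]; apply Ht. }
    revert Hloc; apply filter_imp; intros u Hu s Hs.
    apply homothety_open; [exact Hl|exact Hu|]; apply side_in_closed; assumption. }
set (J := fun r => I side1 r + I side2 r + I side3 r).
assert (HJ : forall t, - (1 / 2) < t < 1 -> is_derive J t 0).
{ intros t Ht; unfold J; evar_last.
  - apply (is_derive_plus (V := R_NormedModule));
      [apply (is_derive_plus (V := R_NormedModule))|]; apply HD, Ht.
  - destruct (corner l side1) as [e1 e2], (corner l side2) as [e3 e4],
      (corner l side3) as [e5 e6]; cbn [next] in *.
    rewrite e1, e2, e3, e4, e5, e6; unfold plus; cbn; ring. }
assert (J0 : J 0 = 0).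
{ assert (I0 : forall j, I j 0 = 0).
  { intros j; unfold I.
    rewrite (RInt_ext (V := R_CompleteNormedModule) _ (fun _ => 0))
      by (intros; apply Rmult_0_l).
    rewrite RInt_const; apply Rmult_0_r. }
  unfold J; rewrite !I0; ring. }
assert (Jr : J r = 0).
{ destruct (MVT_gen J 0 r (fun _ => 0)) as [x [_ Hx]].
  - rewrite Rmin_left, Rmax_right by lra; intros x Hx; apply HJ; lra.
  - rewrite Rmin_left, Rmax_right by lra; intros x Hx.
    apply derivable_continuous_pt; exists 0; apply is_derive_Reals, HJ; lra.
  - lra. }
assert (Hsc : forall j, I j r = r * flux j).
{ intros j; unfold I, flux.
  apply (RInt_scal (V := R_CompleteNormedModule)).
  apply (ex_RInt_continuous (V := R_CompleteNormedModule)).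
  rewrite Rmin_left, Rmax_right by lra; intros s Hs.
  assert (Ho : open_triangle l (r * side_x l j s, r * side_y l j s)).
  { apply homothety_open; [exact Hl|lra|]; apply side_in_closed; assumption. }
  pose proof (open_triangle_open _ _ _ Hl Ho) as HU.
  assert (Hx : continuous (fun s => r * side_x l j s) s)
    by (apply continuity_pt_filterlim; unfold side_x; reg).
  assert (Hy : continuous (fun s => r * side_y l j s) s)
    by (apply continuity_pt_filterlim; unfold side_y; reg).
  assert (K : forall f, C1_in (open_triangle l) f ->
    continuous (fun s => f (r * side_x l j s) (r * side_y l j s)) s).
  { intros f Hf.
    apply (continuous_comp_2 _ _ f); [exact Hx|exact Hy|].
    apply continuity_2d_pt_filterlim.
    apply (C1_in_continuity (open_triangle l)); assumption. }
  apply (continuous_plus (V := R_NormedModule));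
    apply (continuous_scal_r (V := R_NormedModule)); auto. }
unfold J in Jr; rewrite !Hsc in Jr; nra.
Qed.

(** * Green's identity *)

Lemma RInt_ext_real (f g : R -> R) (a b : R) : a <= b ->
  (forall x, a <= x <= b -> f x = g x) -> RInt f a b = RInt g a b.
Proof.
intros Hab H; apply RInt_ext; rewrite Rmin_left, Rmax_right by exact Hab.
intros x Hx; apply H; lra.
Qed.

Section C1Algebra.

Variable U : C -> Prop.
Hypothesis U_open : forall x y, U (x, y) -> locally (x, y) (fun z : R * R => U z).

Lemma C1_in_of_derive (f fx fy : R -> R -> R) :
  (forall x y, U (x, y) -> is_derive (fun t => f t y) x (fx x y)) ->
  (forall x y, U (x, y) -> is_derive (fun t => f x t) y (fy x y)) ->
  (forall x y, U (x, y) -> continuity_2d_pt fx x y) ->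
  (forall x y, U (x, y) -> continuity_2d_pt fy x y) -> C1_in U f.
Proof.
intros Hx Hy cx cy x y H; pose proof (U_open x y H) as HU.
assert (HU2 : locally_2d (fun u v => U (u, v)) x y).
{ apply locally_2d_locally; revert HU; apply filter_imp; intros [u v]; exact (fun h => h). }
repeat split.
- eexists; apply Hx, H.
- eexists; apply Hy, H.
- apply continuity_2d_pt_ext_loc with fx; [|apply cx, H].
  revert HU2; apply locally_2d_impl, locally_2d_forall; intros u v Huv.
  symmetry; apply is_derive_unique, Hx, Huv.
- apply continuity_2d_pt_ext_loc with fy; [|apply cy, H].
  revert HU2; apply locally_2d_impl, locally_2d_forall; intros u v Huv.
  symmetry; apply is_derive_unique, Hy, Huv.
Qed.

Variables f g f' g' : R -> R -> R.
Hypothesis f_C1 : C1_in U f.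
Hypothesis g_C1 : C1_in U g.
Hypothesis f'_C1 : C1_in U f'.
Hypothesis g'_C1 : C1_in U g'.

Local Lemma det_dx x y : U (x, y) ->
  is_derive (fun t => f t y * g' t y - g t y * f' t y) x
    (dx f x y * g' x y + f x y * dx g' x y - dx g x y * f' x y - g x y * dx f' x y).
Proof.
intros H; destruct (f_C1 x y H) as (? & ? & _), (g_C1 x y H) as (? & ? & _),
  (f'_C1 x y H) as (? & ? & _), (g'_C1 x y H) as (? & ? & _).
unfold dx; auto_derive.
- repeat split; assumption.
- ring.
Qed.

Local Lemma det_dy x y : U (x, y) ->
  is_derive (fun t => f x t * g' x t - g x t * f' x t) y
    (dy f x y * g' x y + f x y * dy g' x y - dy g x y * f' x y - g x y * dy f' x y).
Proof.
intros H; destruct (f_C1 x y H) as (? & ? & _), (g_C1 x y H) as (? & ? & _),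
  (f'_C1 x y H) as (? & ? & _), (g'_C1 x y H) as (? & ? & _).
unfold dy; auto_derive.
- repeat split; assumption.
- ring.
Qed.

(** With f = q, g = phi and f', g' their derivatives in one variable, this is a component of q grad
    phi - phi grad q. The primed functions are kept independent, so second derivatives of q enter
    only through the C1 regularity of [dx q] and [dy q]. *)
Lemma C1_in_det : C1_in U (fun x y => f x y * g' x y - g x y * f' x y).
Proof.
apply (C1_in_of_derive _ _ _ det_dx det_dy); intros x y H;
  pose proof (C1_in_continuity U f _ _ (U_open _ _ H) f_C1);
  pose proof (C1_in_continuity U g _ _ (U_open _ _ H) g_C1);
  pose proof (C1_in_continuity U f' _ _ (U_open _ _ H) f'_C1);
  pose proof (C1_in_continuity U g' _ _ (U_open _ _ H) g'_C1);
  destruct (f_C1 x y H) as (_ & _ & ? & ?), (g_C1 x y H) as (_ & _ & ? & ?),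
    (f'_C1 x y H) as (_ & _ & ? & ?), (g'_C1 x y H) as (_ & _ & ? & ?);
  repeat first [ assumption | apply continuity_2d_pt_minus | apply continuity_2d_pt_plus
    | apply continuity_2d_pt_mult ].
Qed.

Lemma det_dxE x y : U (x, y) ->
  dx (fun x y => f x y * g' x y - g x y * f' x y) x y =
  dx f x y * g' x y + f x y * dx g' x y - dx g x y * f' x y - g x y * dx f' x y.
Proof. intros H; apply is_derive_unique, det_dx, H. Qed.

Lemma det_dyE x y : U (x, y) ->
  dy (fun x y => f x y * g' x y - g x y * f' x y) x y =
  dy f x y * g' x y + f x y * dy g' x y - dy g x y * f' x y - g x y * dy f' x y.
Proof. intros H; apply is_derive_unique, det_dy, H. Qed.

End C1Algebra.

(* The real part of [(a - i b) exp (P x + Q y)] for complex [P = p1 + i p2], [Q = w1 + i w2]. *)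
Definition wave (p1 p2 w1 w2 a b x y : R) : R :=
  exp (p1 * x + w1 * y) * (a * cos (p2 * x + w2 * y) + b * sin (p2 * x + w2 * y)).

(** Differentiation multiplies a - i b by P: (a - i b)(p1 + i p2) = (a p1 + b p2) - i (b p1 - a p2).
    Waves are thus closed under both partial derivatives. *)
Lemma wave_dx p1 p2 w1 w2 a b x y :
  is_derive (fun t => wave p1 p2 w1 w2 a b t y) x
    (wave p1 p2 w1 w2 (a * p1 + b * p2) (b * p1 - a * p2) x y).
Proof. unfold wave; auto_derive; [exact I|ring]. Qed.

Lemma wave_dy p1 p2 w1 w2 a b x y :
  is_derive (fun t => wave p1 p2 w1 w2 a b x t) y
    (wave p1 p2 w1 w2 (a * w1 + b * w2) (b * w1 - a * w2) x y).
Proof. unfold wave; auto_derive; [exact I|ring]. Qed.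

Lemma linear_continuity_2d p w x y : continuity_2d_pt (fun x y => p * x + w * y) x y.
Proof.
apply continuity_2d_pt_plus; apply continuity_2d_pt_mult;
  first [apply continuity_2d_pt_const|apply continuity_2d_pt_id1|apply continuity_2d_pt_id2].
Qed.

Lemma wave_continuity_2d p1 p2 w1 w2 a b x y :
  continuity_2d_pt (wave p1 p2 w1 w2 a b) x y.
Proof.
unfold wave; apply continuity_2d_pt_mult.
- apply (continuity_1d_2d_pt_comp exp); [|apply linear_continuity_2d].
  apply derivable_continuous_pt, derivable_pt_exp.
- apply continuity_2d_pt_plus; apply continuity_2d_pt_mult;
    try apply continuity_2d_pt_const.
  + apply (continuity_1d_2d_pt_comp cos); [apply continuity_cos|apply linear_continuity_2d].
  + apply (continuity_1d_2d_pt_comp sin); [apply continuity_sin|apply linear_continuity_2d].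
Qed.

Lemma wave_C1 (U : C -> Prop) p1 p2 w1 w2 a b :
  (forall x y, U (x, y) -> locally (x, y) (fun z : R * R => U z)) ->
  C1_in U (wave p1 p2 w1 w2 a b).
Proof.
intros HU.
apply (C1_in_of_derive U HU _ (wave p1 p2 w1 w2 (a * p1 + b * p2) (b * p1 - a * p2))
  (wave p1 p2 w1 w2 (a * w1 + b * w2) (b * w1 - a * w2))); intros x y _.
- apply wave_dx.
- apply wave_dy.
- apply wave_continuity_2d.
- apply wave_continuity_2d.
Qed.

(** Precomposition with this retraction turns a function continuous on a segment into one continuous
    everywhere, so that one-sided limits never have to be handled. *)
Definition clamp (lo hi x : R) : R := Rmax lo (Rmin hi x).

Lemma clamp_in (lo hi x : R) : lo <= hi -> lo <= clamp lo hi x <= hi.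
Proof.
intros H; unfold clamp; split; [apply Rmax_l|]; apply Rmax_lub; [exact H|apply Rmin_l].
Qed.

Lemma clamp_id (lo hi x : R) : lo <= x <= hi -> clamp lo hi x = x.
Proof. intros H; unfold clamp; rewrite Rmin_right, Rmax_right; lra. Qed.

Lemma clamp_cont (lo hi x : R) : lo <= hi -> continuity_pt (clamp lo hi) x.
Proof.
intros Hlh eps Heps; exists eps; split; [exact Heps|]; intros y [_ Hy].
eapply Rle_lt_trans; [|exact Hy]; cbn; unfold Rdist, clamp, Rmax, Rmin.
repeat destruct Rle_dec; unfold Rabs; repeat destruct Rcase_abs; lra.
Qed.

Lemma within_eps (D : C -> Prop) (f : C -> R) (z : C) (y : R) :
  filterlim f (within D (locally z)) (locally y) ->
  forall eps : posreal, exists d : posreal, forall u v,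
    Rabs (u - fst z) < d -> Rabs (v - snd z) < d -> D (u, v) -> Rabs (f (u, v) - y) < eps.
Proof.
intros H eps.
destruct (H (fun t => Rabs (t - y) < eps)) as [d Hd].
{ exists eps; intros t Ht; exact Ht. }
exists d; intros u v Hu Hv; apply Hd; split; [exact Hu|exact Hv].
Qed.

Section Green.

Variables (l lam : R) (q : R -> R -> R) (f : side -> R -> R).
Hypothesis hl : 0 < l.
Hypothesis hq_C2 : C2_in (open_triangle l) q.
Hypothesis hq_pde : forall x y : R, open_triangle l (x, y) ->
     dx (dx q) x y + dy (dy q) x y - 4 * lam * q x y = 0.
Hypothesis hq_cont : continuous_on_closed_triangle l q.
Hypothesis hf_cont : forall j s, continuous (f j) s.
Hypothesis h_neumann : forall (j : side) (s : R), - (l / 2) <= s <= l / 2 ->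
     has_normal_derivative l q j s (f j s).
Variables p1 p2 w1 w2 a b : R.
Hypothesis helm_re : p1 * p1 - p2 * p2 + (w1 * w1 - w2 * w2) = 4 * lam.
Hypothesis helm_im : p1 * p2 + w1 * w2 = 0.

Let phi := wave p1 p2 w1 w2 a b.
Let phix := wave p1 p2 w1 w2 (a * p1 + b * p2) (b * p1 - a * p2).
Let phiy := wave p1 p2 w1 w2 (a * w1 + b * w2) (b * w1 - a * w2).

Local Lemma inner_green r : 0 < r < 1 ->
  let flux j := RInt (fun s =>
      q (r * side_x l j s) (r * side_y l j s) *
        (nx j * phix (r * side_x l j s) (r * side_y l j s) + ny j * phiy (r * side_x l j s) (r * side_y l j s))
      - (nx j * dx q (r * side_x l j s) (r * side_y l j s) + ny j * dy q (r * side_x l j s) (r * side_y l j s))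
        * phi (r * side_x l j s) (r * side_y l j s)) (- (l / 2)) (l / 2) in
  flux side1 + flux side2 + flux side3 = 0.
Proof.
intros Hr flux.
assert (HU : forall x y, open_triangle l (x, y) ->
  locally (x, y) (fun z : R * R => open_triangle l z))
  by (intros x y; apply open_triangle_open, hl).
destruct hq_C2 as (Hq & Hqx & Hqy).
pose proof (wave_C1 _ p1 p2 w1 w2 a b HU) as Hp.
pose proof (wave_C1 _ p1 p2 w1 w2 (a * p1 + b * p2) (b * p1 - a * p2) HU) as Hpx.
pose proof (wave_C1 _ p1 p2 w1 w2 (a * w1 + b * w2) (b * w1 - a * w2) HU) as Hpy.
assert (E : forall j, flux j = RInt (fun s =>
  nx j * (fun x y => q x y * phix x y - phi x y * dx q x y) (r * side_x l j s) (r * side_y l j s)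
  + ny j * (fun x y => q x y * phiy x y - phi x y * dy q x y) (r * side_x l j s) (r * side_y l j s))
  (- (l / 2)) (l / 2)).
{ intros j; apply RInt_ext_real; [lra|]; intros s _; cbv beta; ring. }
clearbody flux; rewrite (E side1), (E side2), (E side3).
apply (flux_zero l (fun x y => q x y * phix x y - phi x y * dx q x y)
  (fun x y => q x y * phiy x y - phi x y * dy q x y) r); try assumption.
- apply (C1_in_det (open_triangle l) HU); assumption.
- apply (C1_in_det (open_triangle l) HU); assumption.
- intros x y H.
  rewrite (det_dxE (open_triangle l) q phi (dx q) phix),
    (det_dyE (open_triangle l) q phi (dy q) phiy) by assumption.
  assert (Ex : dx phi x y = phix x y) by (apply is_derive_unique, wave_dx).
  assert (Ey : dy phi x y = phiy x y) by (apply is_derive_unique, wave_dy).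
  assert (E2 : dx phix x y + dy phiy x y = 4 * lam * phi x y).
  { unfold dx, dy, phix, phiy.
    rewrite (is_derive_unique _ _ _ (wave_dx _ _ _ _ _ _ x y)),
      (is_derive_unique _ _ _ (wave_dy _ _ _ _ _ _ x y)).
    rewrite <- helm_re; unfold phi, wave.
    set (e := exp _); set (cc := cos _); set (ss := sin _).
    (* The Laplacian multiplies the wave by P^2 + Q^2. Its imaginary part 2 (p1 p2 + w1 w2) is
       isolated so that [helm_im] removes it. *)
    transitivity (e * (a * (p1 * p1 - p2 * p2 + (w1 * w1 - w2 * w2)) * cc
      + b * (p1 * p1 - p2 * p2 + (w1 * w1 - w2 * w2)) * ss
      + 2 * (p1 * p2 + w1 * w2) * (b * cc - a * ss))); [ring|].
    rewrite helm_im; ring. }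
  pose proof (hq_pde x y H) as E3; rewrite Ex, Ey.
  replace (dx (dx q) x y) with (4 * lam * q x y - dy (dy q) x y) by lra.
  replace (dx phix x y) with (4 * lam * phi x y - dy phiy x y) by lra.
  ring.
Qed.

(** Clamping both parameters makes the integrand [H] continuous on the whole plane, up to and
    including r = 1. The floor 1/2 is an arbitrary ratio strictly between 0 and 1. *)
Let P (r s : R) j := (clamp (1 / 2) 1 r * side_x l j (clamp (- (l / 2)) (l / 2) s),
  clamp (1 / 2) 1 r * side_y l j (clamp (- (l / 2)) (l / 2) s)).

(* The normal derivative extended by its boundary value to [r = 1]. *)
Let V (j : side) (r s : R) : R :=
  if Rlt_dec (clamp (1 / 2) 1 r) 1
  then nx j * dx q (fst (P r s j)) (snd (P r s j)) + ny j * dy q (fst (P r s j)) (snd (P r s j))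
  else f j (clamp (- (l / 2)) (l / 2) s).

Let H (j : side) (r s : R) : R :=
  q (fst (P r s j)) (snd (P r s j)) *
    (nx j * phix (fst (P r s j)) (snd (P r s j)) + ny j * phiy (fst (P r s j)) (snd (P r s j)))
  - V j r s * phi (fst (P r s j)) (snd (P r s j)).

Local Lemma hl2 : - (l / 2) <= l / 2.
Proof. lra. Qed.

Local Lemma P1_cont j r s : continuity_2d_pt (fun r s => fst (P r s j)) r s.
Proof.
unfold P, side_x; cbn [fst].
apply continuity_2d_pt_mult.
- apply (continuity_1d_2d_pt_comp (clamp (1 / 2) 1)); [|apply continuity_2d_pt_id1].
  apply clamp_cont; lra.
- apply continuity_2d_pt_minus; [apply continuity_2d_pt_const|].
  apply continuity_2d_pt_mult; [|apply continuity_2d_pt_const].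
  apply (continuity_1d_2d_pt_comp (clamp (- (l / 2)) (l / 2))); [|apply continuity_2d_pt_id2].
  apply clamp_cont, hl2.
Qed.

Local Lemma P2_cont j r s : continuity_2d_pt (fun r s => snd (P r s j)) r s.
Proof.
unfold P, side_y; cbn [snd].
apply continuity_2d_pt_mult.
- apply (continuity_1d_2d_pt_comp (clamp (1 / 2) 1)); [|apply continuity_2d_pt_id1].
  apply clamp_cont; lra.
- apply continuity_2d_pt_plus; [apply continuity_2d_pt_const|].
  apply continuity_2d_pt_mult; [|apply continuity_2d_pt_const].
  apply (continuity_1d_2d_pt_comp (clamp (- (l / 2)) (l / 2))); [|apply continuity_2d_pt_id2].
  apply clamp_cont, hl2.
Qed.

Local Lemma P_closed j r s : closed_triangle l (fst (P r s j), snd (P r s j)).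
Proof.
pose proof (clamp_in (1 / 2) 1 r ltac:(lra)) as Hr.
pose proof (side_in_closed l j _ hl (clamp_in _ _ s hl2)) as Hs.
unfold P; cbn [fst snd].
destruct (Rlt_dec (clamp (1 / 2) 1 r) 1) as [Hlt|Hge].
- pose proof (homothety_open l (clamp (1 / 2) 1 r) _ _ hl ltac:(lra) Hs) as Ho.
  apply closed_triangleP; [exact hl|]; intros i; apply Rlt_le.
  exact (proj1 (open_triangleP _ _ _ hl) Ho i).
- replace (clamp (1 / 2) 1 r) with 1 by lra; rewrite !Rmult_1_l; exact Hs.
Qed.

Local Lemma P_open j r s : clamp (1 / 2) 1 r < 1 ->
  open_triangle l (fst (P r s j), snd (P r s j)).
Proof.
intros Hlt; pose proof (clamp_in (1 / 2) 1 r ltac:(lra)) as Hr.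
unfold P; cbn [fst snd].
apply homothety_open; [exact hl|lra|].
apply side_in_closed; [exact hl|apply clamp_in, hl2].
Qed.

Local Lemma q_cont_P j r s : continuity_2d_pt (fun r s => q (fst (P r s j)) (snd (P r s j))) r s.
Proof.
intros eps.
destruct (within_eps _ _ _ _ (hq_cont _ (P_closed j r s)) eps) as [d Hd]; cbn in Hd.
destruct (P1_cont j r s d) as [d1 H1]; destruct (P2_cont j r s d) as [d2 H2].
assert (Hm : 0 < Rmin d1 d2) by (apply Rmin_pos; apply cond_pos).
exists (mkposreal _ Hm); cbn; intros u v Hu Hv.
apply Hd; [apply H1|apply H2|apply P_closed]; eapply Rlt_le_trans; try eassumption;
  first [apply Rmin_l | apply Rmin_r].
Qed.

(** At r = 1 the nearby points are of two kinds: inside the triangle the limit defining the normal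
    derivative applies, on the side itself the continuity of [f j] does. *)
Local Lemma V_cont j r s : continuity_2d_pt (V j) r s.
Proof.
set (cl := clamp (- (l / 2)) (l / 2)).
destruct (Rlt_dec (clamp (1 / 2) 1 r) 1) as [Hlt|Hge].
- apply continuity_2d_pt_ext_loc with (fun r s => nx j * dx q (fst (P r s j)) (snd (P r s j))
    + ny j * dy q (fst (P r s j)) (snd (P r s j))).
  + assert (Hc : continuity_2d_pt (fun r _ => clamp (1 / 2) 1 r) r s).
    { apply (continuity_1d_2d_pt_comp (clamp (1 / 2) 1)); [|apply continuity_2d_pt_id1].
      apply clamp_cont; lra. }
    assert (Hpos : 0 < 1 - clamp (1 / 2) 1 r) by lra.
    destruct (Hc (mkposreal _ Hpos)) as [d Hd]; cbn in Hd.
    exists d; intros u v Hu Hv; unfold V.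
    destruct (Rlt_dec (clamp (1 / 2) 1 u) 1) as [h|h]; [reflexivity|exfalso].
    specialize (Hd u v Hu Hv); apply Rabs_lt_between in Hd; lra.
  + destruct (proj1 hq_C2 _ _ (P_open j r s Hlt)) as (_ & _ & cx & cy).
    apply continuity_2d_pt_plus; apply continuity_2d_pt_mult;
      try apply continuity_2d_pt_const.
    * apply (continuity_2d_pt_comp (dx q)); [exact cx|apply P1_cont|apply P2_cont].
    * apply (continuity_2d_pt_comp (dy q)); [exact cy|apply P1_cont|apply P2_cont].
- intros eps.
  assert (Er : clamp (1 / 2) 1 r = 1)
    by (pose proof (clamp_in (1 / 2) 1 r ltac:(lra)); lra).
  assert (EV : V j r s = f j (cl s)).
  { unfold V; destruct (Rlt_dec (clamp (1 / 2) 1 r) 1); [lra|reflexivity]. }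
  rewrite EV.
  pose proof (h_neumann j (cl s) (clamp_in _ _ s hl2)) as Hn.
  unfold has_normal_derivative in Hn; rewrite side_pointE in Hn.
  destruct (within_eps _ _ _ _ Hn eps) as [d Hd]; cbn [fst snd Re Im] in Hd.
  destruct (P1_cont j r s d) as [d1 H1]; destruct (P2_cont j r s d) as [d2 H2].
  assert (Hc : continuity_2d_pt (fun _ s => f j (cl s)) r s).
  { apply (continuity_1d_2d_pt_comp (fun s => f j (cl s))); [|apply continuity_2d_pt_id2].
    apply (continuity_pt_comp cl (f j)); [apply clamp_cont, hl2|].
    apply continuity_pt_filterlim, hf_cont. }
  destruct (Hc eps) as [d3 H3].
  assert (Hm : 0 < Rmin (Rmin d1 d2) d3) by (repeat apply Rmin_pos; apply cond_pos).
  exists (mkposreal _ Hm); cbn [pos]; intros u v Hu Hv.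
  assert (Hu1 : Rabs (u - r) < Rmin d1 d2) by (eapply Rlt_le_trans; [exact Hu|apply Rmin_l]).
  assert (Hv1 : Rabs (v - s) < Rmin d1 d2) by (eapply Rlt_le_trans; [exact Hv|apply Rmin_l]).
  unfold V; destruct (Rlt_dec (clamp (1 / 2) 1 u) 1) as [h|h].
  + assert (EP1 : fst (P r s j) = side_x l j (cl s))
      by (unfold P; cbn [fst]; rewrite Er, Rmult_1_l; reflexivity).
    assert (EP2 : snd (P r s j) = side_y l j (cl s))
      by (unfold P; cbn [snd]; rewrite Er, Rmult_1_l; reflexivity).
    apply (Hd (fst (P u v j)) (snd (P u v j))).
    * rewrite <- EP1; apply H1; (eapply Rlt_le_trans; [first [exact Hu1|exact Hv1]|apply Rmin_l]).
    * rewrite <- EP2; apply H2; (eapply Rlt_le_trans; [first [exact Hu1|exact Hv1]|apply Rmin_r]).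
    * apply P_open, h.
  + apply (H3 u v); (eapply Rlt_le_trans; [first [exact Hu|exact Hv]|apply Rmin_r]).
Qed.

Local Lemma H_cont j r s : continuity_2d_pt (H j) r s.
Proof.
assert (K : forall a b, continuity_2d_pt
  (fun r s => wave p1 p2 w1 w2 a b (fst (P r s j)) (snd (P r s j))) r s).
{ intros a' b'; apply (continuity_2d_pt_comp (wave p1 p2 w1 w2 a' b'));
    [apply wave_continuity_2d|apply P1_cont|apply P2_cont]. }
unfold H; apply continuity_2d_pt_minus; apply continuity_2d_pt_mult.
- apply q_cont_P.
- apply continuity_2d_pt_plus; apply continuity_2d_pt_mult;
    try apply continuity_2d_pt_const; apply K.
- apply V_cont.
- apply K.
Qed.

Lemma green :
  let flux j := RInt (fun s =>
      q (side_x l j s) (side_y l j s) *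
        (nx j * phix (side_x l j s) (side_y l j s) + ny j * phiy (side_x l j s) (side_y l j s))
      - f j s * phi (side_x l j s) (side_y l j s)) (- (l / 2)) (l / 2) in
  flux side1 + flux side2 + flux side3 = 0.
Proof.
intros flux.
assert (HI : forall j r, ex_RInt (H j r) (- (l / 2)) (l / 2)).
{ intros j r; apply (ex_RInt_continuous (V := R_CompleteNormedModule)).
  intros s _; apply continuity_2d_snd, H_cont. }
assert (E1 : forall j, flux j = RInt (H j 1) (- (l / 2)) (l / 2)).
{ intros j; apply RInt_ext_real; [lra|]; intros s Hs; unfold H, V, P.
  rewrite (clamp_id (1 / 2) 1 1), (clamp_id (- (l / 2)) (l / 2) s) by lra; cbn [fst snd].
  destruct (Rlt_dec 1 1); [lra|]; rewrite !Rmult_1_l; reflexivity. }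
assert (Er : forall r, 1 / 2 <= r < 1 -> RInt (H side1 r) (- (l / 2)) (l / 2)
  + RInt (H side2 r) (- (l / 2)) (l / 2) + RInt (H side3 r) (- (l / 2)) (l / 2) = 0).
{ intros r Hr; rewrite <- (inner_green r) by lra.
  f_equal; [f_equal|]; apply RInt_ext_real; try lra; intros s Hs; unfold H, V, P;
  rewrite (clamp_id (1 / 2) 1 r), (clamp_id (- (l / 2)) (l / 2) s) by lra; cbn [fst snd];
  destruct (Rlt_dec r 1); try lra; reflexivity. }
assert (Hlim : forall j (eps : posreal), exists d : posreal, forall r, 1 / 2 <= r <= 1 ->
  1 - r < d -> Rabs (RInt (H j 1) (- (l / 2)) (l / 2) - RInt (H j r) (- (l / 2)) (l / 2))
     <= l * eps).
{ intros j eps.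
  destruct (uniform_continuity_2d (H j) (1 / 2) 1 (- (l / 2)) (l / 2)
    (fun x y _ _ => H_cont j x y) eps) as [d Hd].
  exists d; intros r Hr Hrd.
  rewrite <- (RInt_minus (V := R_CompleteNormedModule)) by apply HI.
  replace (l * eps) with ((l / 2 - - (l / 2)) * eps) by field.
  apply abs_RInt_le_const; [lra| |].
  - apply (ex_RInt_minus (V := R_NormedModule)); apply HI.
  - intros s Hs; apply Rlt_le, Hd; try lra.
    + apply Rabs_lt_between; lra.
    + rewrite Rminus_diag, Rabs_R0; apply cond_pos. }
clearbody flux; rewrite (E1 side1), (E1 side2), (E1 side3); clear E1 flux; apply Rabs_eq_0, Rle_antisym; [|apply Rabs_pos].
apply le_epsilon; intros e He.
assert (He' : 0 < e / (3 * l)) by (apply Rdiv_lt_0_compat; lra).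
destruct (Hlim side1 (mkposreal _ He')) as [d1 H1], (Hlim side2 (mkposreal _ He')) as [d2 H2],
  (Hlim side3 (mkposreal _ He')) as [d3 H3]; cbn [pos] in *.
set (m := Rmin (1 / 2) (Rmin d1 (Rmin d2 d3))).
assert (Hm : 0 < m) by (repeat apply Rmin_pos; try apply cond_pos; lra).
assert (m <= 1 / 2) by apply Rmin_l.
assert (Hm3 : m <= Rmin d1 (Rmin d2 d3)) by apply Rmin_r.
pose proof (Rmin_l d1 (Rmin d2 d3)); pose proof (Rmin_r d1 (Rmin d2 d3)).
pose proof (Rmin_l d2 d3); pose proof (Rmin_r d2 d3).
specialize (H1 (1 - m / 2) ltac:(lra) ltac:(lra)).
specialize (H2 (1 - m / 2) ltac:(lra) ltac:(lra)).
specialize (H3 (1 - m / 2) ltac:(lra) ltac:(lra)).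
specialize (Er (1 - m / 2) ltac:(lra)).
replace (l * (e / (3 * l))) with (e / 3) in H1, H2, H3 by (field; lra).
apply Rabs_le_between in H1, H2, H3; apply Rabs_le; lra.
Qed.

End Green.

(** * The global relation *)

Lemma Cexp_add (z w : C) : Cexp (z + w)%C = (Cexp z * Cexp w)%C.
Proof.
destruct z as [a b], w as [c d]; unfold Cexp, Cplus, Cmult; cbn [Re Im fst snd].
rewrite exp_plus, cos_plus, sin_plus; f_equal; ring.
Qed.

Lemma Cexp_0 : Cexp (RtoC 0) = RtoC 1.
Proof. unfold Cexp; cbn; rewrite exp_0, cos_0, sin_0; unfold RtoC; f_equal; ring. Qed.

Lemma Cexp_opp_r (z : C) : (Cexp z * Cexp (- z))%C = RtoC 1.
Proof.
rewrite <- Cexp_add, <- Cexp_0; f_equal; ring.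
Qed.

(** Four terms are what the real or imaginary part of a complex flux requires. Shorter combinations
    are padded with zero coefficients. *)
Lemma is_RInt_lin4 (g1 g2 g3 g4 : R -> R) (a b c1 c2 c3 c4 I1 I2 I3 I4 : R) :
  is_RInt g1 a b I1 -> is_RInt g2 a b I2 -> is_RInt g3 a b I3 -> is_RInt g4 a b I4 ->
  is_RInt (fun s => c1 * g1 s + c2 * g2 s + c3 * g3 s + c4 * g4 s) a b
    (c1 * I1 + c2 * I2 + c3 * I3 + c4 * I4).
Proof.
intros H1 H2 H3 H4.
pose proof (fun g I c H => is_RInt_scal (V := R_NormedModule) g a b c I H) as K.
exact (is_RInt_plus (V := R_NormedModule) _ _ _ _ _ _ (is_RInt_plus (V := R_NormedModule) _ _ _ _ _ _
  (is_RInt_plus (V := R_NormedModule) _ _ _ _ _ _ (K _ _ c1 H1) (K _ _ c2 H2)) (K _ _ c3 H3)) (K _ _ c4 H4)).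
Qed.

Lemma RInt_lin4 (g1 g2 g3 g4 : R -> R) (a b c1 c2 c3 c4 : R) :
  ex_RInt g1 a b -> ex_RInt g2 a b -> ex_RInt g3 a b -> ex_RInt g4 a b ->
  RInt (fun s => c1 * g1 s + c2 * g2 s + c3 * g3 s + c4 * g4 s) a b =
  c1 * RInt g1 a b + c2 * RInt g2 a b + c3 * RInt g3 a b + c4 * RInt g4 a b.
Proof.
intros H1 H2 H3 H4; apply is_RInt_unique, is_RInt_lin4;
  apply (RInt_correct (V := R_CompleteNormedModule)); assumption.
Qed.

(** Twice [Ffun], taken as a function of the exponent kap = [W lam k]: it then depends on k only
    through [W], which is what the involution k -> lam / k exploits. *)
Definition hat (l : R) (g : R -> R) (kap : C) : C :=
  RInt (V := C_R_CompleteNormedModule)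
    (fun s : R => (Cexp (kap * RtoC s) * RtoC (g s))%C) (- (l / 2)) (l / 2).

Lemma Cexp_line_continuous (kap : C) (s : R) :
  continuous (fun s => Re (Cexp (kap * RtoC s))) s /\
  continuous (fun s => Im (Cexp (kap * RtoC s))) s.
Proof.
destruct kap as [a b]; unfold Cexp, Cmult, RtoC; cbn [Re Im fst snd].
split; apply (ex_derive_continuous (V := R_NormedModule)); auto_derive; exact I.
Qed.

Lemma hatE (l : R) (g : R -> R) (kap : C) : (forall s, continuous g s) ->
  is_RInt (V := C_R_CompleteNormedModule)
    (fun s : R => (Cexp (kap * RtoC s) * RtoC (g s))%C) (- (l / 2)) (l / 2) (hat l g kap) /\
  ex_RInt (fun s => Re (Cexp (kap * RtoC s)) * g s) (- (l / 2)) (l / 2) /\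
  ex_RInt (fun s => Im (Cexp (kap * RtoC s)) * g s) (- (l / 2)) (l / 2) /\
  hat l g kap = (RInt (fun s => Re (Cexp (kap * RtoC s)) * g s) (- (l / 2)) (l / 2),
                 RInt (fun s => Im (Cexp (kap * RtoC s)) * g s) (- (l / 2)) (l / 2)).
Proof.
intros Hg.
assert (E1 : ex_RInt (fun s => Re (Cexp (kap * RtoC s)) * g s) (- (l / 2)) (l / 2)).
{ apply (ex_RInt_continuous (V := R_CompleteNormedModule)); intros s _.
  apply (continuous_mult (K := R_AbsRing)); [apply (proj1 (Cexp_line_continuous kap s))|apply Hg]. }
assert (E2 : ex_RInt (fun s => Im (Cexp (kap * RtoC s)) * g s) (- (l / 2)) (l / 2)).
{ apply (ex_RInt_continuous (V := R_CompleteNormedModule)); intros s _.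
  apply (continuous_mult (K := R_AbsRing)); [apply (proj2 (Cexp_line_continuous kap s))|apply Hg]. }
assert (HI : is_RInt (V := C_R_CompleteNormedModule)
    (fun s : R => (Cexp (kap * RtoC s) * RtoC (g s))%C) (- (l / 2)) (l / 2)
  (RInt (fun s => Re (Cexp (kap * RtoC s)) * g s) (- (l / 2)) (l / 2),
   RInt (fun s => Im (Cexp (kap * RtoC s)) * g s) (- (l / 2)) (l / 2))).
{ apply (is_RInt_fct_extend_pair (U := R_NormedModule) (V := R_NormedModule)).
  - eapply is_RInt_ext; [|apply (RInt_correct (V := R_CompleteNormedModule)), E1]; intros s _.
    unfold Re, Im; cbn; ring.
  - eapply is_RInt_ext; [|apply (RInt_correct (V := R_CompleteNormedModule)), E2]; intros s _.
    unfold Re, Im; cbn; ring. }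
assert (E : hat l g kap = (RInt (fun s => Re (Cexp (kap * RtoC s)) * g s) (- (l / 2)) (l / 2),
   RInt (fun s => Im (Cexp (kap * RtoC s)) * g s) (- (l / 2)) (l / 2)))
  by exact (is_RInt_unique (V := C_R_CompleteNormedModule) _ _ _ _ HI).
repeat split; try assumption; rewrite E; exact HI.
Qed.

Lemma hat_ext (l : R) (f g : R -> R) (kap : C) : 0 < l ->
  (forall s, - (l / 2) <= s <= l / 2 -> f s = g s) -> hat l f kap = hat l g kap.
Proof.
intros Hl H; apply (RInt_ext (V := C_R_CompleteNormedModule)); rewrite Rmin_left, Rmax_right by lra.
intros s Hs; rewrite H by lra; reflexivity.
Qed.

Lemma conj_normal (j : side) :
  side_normal j = (RtoC (nx j) + Ci * RtoC (ny j))%C /\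
  (/ side_normal j)%C = (RtoC (nx j) - Ci * RtoC (ny j))%C.
Proof.
assert (E : side_normal j = (RtoC (nx j) + Ci * RtoC (ny j))%C).
{ unfold nx, ny; destruct (side_normal j); unfold Cplus, Cmult, Ci, RtoC; cbn; f_equal; ring. }
split; [exact E|].
assert (E1 : (side_normal j * (RtoC (nx j) - Ci * RtoC (ny j)))%C = RtoC 1).
{ rewrite E; pose proof (normal_unit j) as H.
  unfold Cminus, Cplus, Copp, Cmult, Ci, RtoC; cbn; f_equal; [lra|ring]. }
assert (H0 : side_normal j <> RtoC 0).
{ intros H; rewrite H in E1; rewrite Cmult_0_l in E1; injection E1; lra. }
transitivity (/ side_normal j * (side_normal j * (RtoC (nx j) - Ci * RtoC (ny j))))%C.
- rewrite E1; ring.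
- field; exact H0.
Qed.

Lemma Ci_sq : (Ci * Ci)%C = RtoC (-1).
Proof. unfold Ci, Cmult, RtoC; cbn; f_equal; ring. Qed.

Lemma side_normal_neq0 (j : side) : side_normal j <> RtoC 0.
Proof.
intros H; pose proof (normal_unit j) as E; unfold nx, ny in E; rewrite H in E; cbn in E; lra.
Qed.

(* The exponents of [exp (P x + Q y)], with [P = - i (k - lam / k)] and [Q = k + lam / k],
   along side [j] and along its normal. *)
Lemma side_exponents (lam : R) (k : C) (j : side) : k <> RtoC 0 ->
  W lam (side_normal j * k)%C =
    (RtoC (nx j) * W lam k - RtoC (ny j) * - T_N_coef lam k)%C /\
  (- T_N_coef lam (side_normal j * k))%C =
    (RtoC (nx j) * - T_N_coef lam k + RtoC (ny j) * W lam k)%C.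
Proof.
intros Hk; destruct (conj_normal j) as [E1 E2]; pose proof (side_normal_neq0 j) as H0.
assert (Hi : Ci <> RtoC 0) by (intros H; injection H; lra).
assert (EI : (/ Ci)%C = (- Ci)%C).
{ unfold Cinv, Ci, Copp; cbn; f_equal; field. }
assert (Ei : (/ (side_normal j * k))%C = ((RtoC (nx j) - Ci * RtoC (ny j)) * / k)%C).
{ rewrite <- E2; field; split; assumption. }
unfold W, T_N_coef, Cdiv.
assert (Ei2 : forall z, z <> RtoC 0 -> (/ (Ci * z))%C = (- Ci * / z)%C).
{ intros z Hz; rewrite <- EI; field; split; assumption. }
rewrite !Ei2 by (try apply Cmult_neq_0; assumption).
rewrite Ei, E1.
set (ki := (/ k)%C); set (a := RtoC (nx j)); set (b := RtoC (ny j)).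
clearbody ki; destruct k as [k1 k2], ki as [i1 i2].
unfold a, b, Cminus, Cplus, Copp, Cmult, Ci, RtoC; cbn [fst snd].
split; f_equal; ring.
Qed.

(** [T_N_coef lam k] is [W] at i k, so E(- i k) is the exponential of the normal exponent times the
    apothem. *)
Lemma W_opp_i (lam : R) (k : C) : W lam (- (Ci * k))%C = (- T_N_coef lam k)%C.
Proof.
unfold W, T_N_coef, Cdiv; replace (/ - (Ci * k))%C with (- / (Ci * k))%C; [ring|].
unfold Cinv, Copp; cbn [fst snd].
f_equal.
- rewrite !Rdiv_opp_l; do 2 f_equal; ring.
- unfold Rdiv; rewrite Ropp_mult_distr_l; do 2 f_equal; ring.
Qed.

(** This is P^2 + Q^2 = 4 lam for P = [- T_N_coef lam k] and Q = [W lam k], so that exp (P x + Q y)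
    solves the equation of q. *)
Lemma spectral_square (lam : R) (k : C) : k <> RtoC 0 ->
  (T_N_coef lam k * T_N_coef lam k + W lam k * W lam k)%C = RtoC (4 * lam).
Proof.
intros Hk.
assert (EI : (/ Ci)%C = (- Ci)%C) by (unfold Cinv, Ci, Copp; cbn; f_equal; field).
assert (Ei : (/ (Ci * k))%C = (- Ci * / k)%C).
{ rewrite <- EI; field; split; [exact Hk|intros H; injection H; lra]. }
assert (Ek : (k * / k)%C = RtoC 1) by (apply Cinv_r, Hk).
unfold T_N_coef, W, Cdiv; rewrite Ei.
transitivity (RtoC (4 * lam) * (k * / k))%C; [|rewrite Ek; ring].
clear Hk EI Ei Ek; set (ki := (/ k)%C); clearbody ki.
destruct k as [k1 k2], ki as [i1 i2].
unfold Cplus, Cmult, Copp, Ci, RtoC; cbn [fst snd]; f_equal; ring.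
Qed.

Section GlobalRelation.

Variables (l lam : R) (q : R -> R -> R) (f u : side -> R -> R).
Hypothesis hl : 0 < l.
Hypothesis hq_C2 : C2_in (open_triangle l) q.
Hypothesis hq_pde : forall x y : R, open_triangle l (x, y) ->
     dx (dx q) x y + dy (dy q) x y - 4 * lam * q x y = 0.
Hypothesis hq_cont : continuous_on_closed_triangle l q.
Hypothesis hf_cont : forall j s, continuous (f j) s.
Hypothesis h_neumann : forall (j : side) (s : R), - (l / 2) <= s <= l / 2 ->
     has_normal_derivative l q j s (f j s).
Hypothesis hu_cont : forall j s, continuous (u j) s.
Hypothesis hu : forall (j : side) (s : R), - (l / 2) <= s <= l / 2 ->
  u j s = side_value l q j s.

(** The choices (a, b) = (1, 0) and (0, 1) give the real and imaginary parts of one complex flux. On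
    side j the exponent P x + Q y equals nrm * apothem + tau * s, so a constant factor leaves the
    integral and transforms at tau remain. *)
Local Lemma green_side (P Q : C) (j : side) :
  let tau := (RtoC (nx j) * Q - RtoC (ny j) * P)%C in
  let nrm := (RtoC (nx j) * P + RtoC (ny j) * Q)%C in
  let flux a b := RInt (fun s =>
      q (side_x l j s) (side_y l j s) *
        (nx j * wave (Re P) (Im P) (Re Q) (Im Q) (a * Re P + b * Im P) (b * Re P - a * Im P)
           (side_x l j s) (side_y l j s)
         + ny j * wave (Re P) (Im P) (Re Q) (Im Q) (a * Re Q + b * Im Q) (b * Re Q - a * Im Q)
           (side_x l j s) (side_y l j s))
      - f j s * wave (Re P) (Im P) (Re Q) (Im Q) a b (side_x l j s) (side_y l j s))
      (- (l / 2)) (l / 2) in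
  (flux 1 0, flux 0 1) =
  (Cexp (nrm * RtoC (apothem l)) * (nrm * hat l (u j) tau - hat l (f j) tau))%C.
Proof.
intros tau nrm flux.
destruct (hatE l (u j) tau (hu_cont j)) as (_ & Eu1 & Eu2 & ->).
destruct (hatE l (f j) tau (hf_cont j)) as (_ & Ef1 & Ef2 & ->).
set (X := Cexp (nrm * RtoC (apothem l))%C).
assert (K : forall s, - (l / 2) <= s <= l / 2 ->
  q (side_x l j s) (side_y l j s) = u j s).
{ intros s Hs; rewrite hu by exact Hs; unfold side_value; rewrite side_pointE; reflexivity. }
assert (EX : forall s,
  (wave (Re P) (Im P) (Re Q) (Im Q) 1 0 (side_x l j s) (side_y l j s),
   wave (Re P) (Im P) (Re Q) (Im Q) 0 1 (side_x l j s) (side_y l j s))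
  = (X * Cexp (tau * RtoC s))%C).
{ intros s; unfold X; rewrite <- Cexp_add; unfold wave, Cexp, tau, nrm, side_x, side_y.
  destruct P as [p1 p2], Q as [w1 w2].
  unfold Cminus, Cplus, Copp, Cmult, RtoC; cbn [fst snd Re Im].
  set (e1 := exp _); set (t1 := (p2 * _ + _)).
  match goal with |- _ = (exp ?e * cos ?t, _) => replace e with
    (p1 * (apothem l * nx j - s * ny j) + w1 * (apothem l * ny j + s * nx j)) by ring;
    replace t with t1 by (unfold t1; ring) end.
  fold e1; f_equal; ring. }
set (X1 := Re X); set (X2 := Im X).
set (m1 := Re nrm); set (m2 := Im nrm).
assert (EX1 : forall s, wave (Re P) (Im P) (Re Q) (Im Q) 1 0 (side_x l j s) (side_y l j s) =
  X1 * Re (Cexp (tau * RtoC s)) - X2 * Im (Cexp (tau * RtoC s)))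
  by (intros s; exact (f_equal fst (EX s))).
assert (EX2 : forall s, wave (Re P) (Im P) (Re Q) (Im Q) 0 1 (side_x l j s) (side_y l j s) =
  X1 * Im (Cexp (tau * RtoC s)) + X2 * Re (Cexp (tau * RtoC s)))
  by (intros s; exact (f_equal snd (EX s))).
assert (Elin : forall a b x y, wave (Re P) (Im P) (Re Q) (Im Q) a b x y =
  a * wave (Re P) (Im P) (Re Q) (Im Q) 1 0 x y + b * wave (Re P) (Im P) (Re Q) (Im Q) 0 1 x y)
  by (intros; unfold wave; ring).
assert (Em1 : m1 = nx j * Re P + ny j * Re Q).
{ unfold m1, nrm, Cplus, Cmult, RtoC, Re; cbn [fst snd]; ring. }
assert (Em2 : m2 = nx j * Im P + ny j * Im Q).
{ unfold m2, nrm, Cplus, Cmult, RtoC, Im; cbn [fst snd]; ring. }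
assert (F1 : flux 1 0 = (m1 * X1 - m2 * X2) * RInt (fun s => Re (Cexp (tau * RtoC s)) * u j s) (- (l / 2)) (l / 2)
  + - (m1 * X2 + m2 * X1) * RInt (fun s => Im (Cexp (tau * RtoC s)) * u j s) (- (l / 2)) (l / 2)
  + - X1 * RInt (fun s => Re (Cexp (tau * RtoC s)) * f j s) (- (l / 2)) (l / 2)
  + X2 * RInt (fun s => Im (Cexp (tau * RtoC s)) * f j s) (- (l / 2)) (l / 2)).
{ rewrite <- RInt_lin4 by assumption.
  apply RInt_ext_real; [lra|]; intros s Hs; rewrite K by exact Hs.
  rewrite (Elin (_ + _)), (Elin (1 * Re Q + _)), EX1, EX2, Em1, Em2; ring. }
assert (F2 : flux 0 1 = (m1 * X2 + m2 * X1) * RInt (fun s => Re (Cexp (tau * RtoC s)) * u j s) (- (l / 2)) (l / 2)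
  + (m1 * X1 - m2 * X2) * RInt (fun s => Im (Cexp (tau * RtoC s)) * u j s) (- (l / 2)) (l / 2)
  + - X2 * RInt (fun s => Re (Cexp (tau * RtoC s)) * f j s) (- (l / 2)) (l / 2)
  + - X1 * RInt (fun s => Im (Cexp (tau * RtoC s)) * f j s) (- (l / 2)) (l / 2)).
{ rewrite <- RInt_lin4 by assumption.
  apply RInt_ext_real; [lra|]; intros s Hs; rewrite K by exact Hs.
  rewrite (Elin (_ + _)), (Elin (0 * Re Q + _)), EX1, EX2, Em1, Em2; ring. }
rewrite F1, F2; unfold Cminus, Cplus, Copp, Cmult; cbn [fst snd].
change (fst X) with X1; change (snd X) with X2; change (fst nrm) with m1; change (snd nrm) with m2.
f_equal; ring.
Qed.

(** By [side_exponents], replacing k by [side_normal j * k] turns [W] and [- T_N_coef] into the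
    tangential and normal exponents on side j, so all three sides contribute the same expression at
    rotated arguments. *)
Lemma global_relation (k : C) : k <> RtoC 0 ->
  let term j := (Efun l lam (- (Ci * (side_normal j * k)))
    * (T_N_coef lam (side_normal j * k) * hat l (u j) (W lam (side_normal j * k))
       + hat l (f j) (W lam (side_normal j * k))))%C in
  (term side1 + term side2 + term side3)%C = RtoC 0.
Proof.
intros Hk term.
set (P := (- T_N_coef lam k)%C); set (Q := W lam k).
assert (HPQ : (P * P + Q * Q)%C = RtoC (4 * lam)).
{ unfold P, Q; rewrite <- (spectral_square lam k Hk); ring. }
assert (Hre : Re P * Re P - Im P * Im P + (Re Q * Re Q - Im Q * Im Q) = 4 * lam).
{ apply (f_equal fst) in HPQ; unfold Cplus, Cmult, RtoC in HPQ; cbn [fst snd] in HPQ.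
  unfold Re, Im; lra. }
assert (Him : Re P * Im P + Re Q * Im Q = 0).
{ apply (f_equal snd) in HPQ; unfold Cplus, Cmult, RtoC in HPQ; cbn [fst snd] in HPQ.
  unfold Re, Im; lra. }
pose proof (green l lam q f hl hq_C2 hq_pde hq_cont hf_cont h_neumann
  (Re P) (Im P) (Re Q) (Im Q) 1 0 Hre Him) as G1.
pose proof (green l lam q f hl hq_C2 hq_pde hq_cont hf_cont h_neumann
  (Re P) (Im P) (Re Q) (Im Q) 0 1 Hre Him) as G2.
assert (E : forall j, term j = (- (Cexp ((RtoC (nx j) * P + RtoC (ny j) * Q) * RtoC (apothem l)) *
  ((RtoC (nx j) * P + RtoC (ny j) * Q) * hat l (u j) (RtoC (nx j) * Q - RtoC (ny j) * P)
   - hat l (f j) (RtoC (nx j) * Q - RtoC (ny j) * P))))%C).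
{ intros j; unfold term, Efun; rewrite W_opp_i.
  destruct (side_exponents lam k j Hk) as [e1 e2].
  rewrite e1, e2; fold P Q (apothem l).
  replace (T_N_coef lam (side_normal j * k))%C with (- (RtoC (nx j) * P + RtoC (ny j) * Q))%C
    by (unfold P, Q; rewrite <- e2; ring).
  ring. }
rewrite (E side1), (E side2), (E side3), <- !(green_side P Q).
unfold Cplus, Copp, RtoC; cbn [fst snd]; f_equal; lra.
Qed.

End GlobalRelation.

(** * Elimination of the unknown boundary values *)

(* [Qj0], [Qj1], [Qj2] stand for the transforms on side [j] at [k], [alpha k],
   [alphabar k], and likewise [Fji].  With [h^12 = 1] the combination of the six global
   relations used here cancels every [Qj1] and [Qj2]. *)
Lemma eliminate (g gi h T0 t1 t2 Q10 Q11 Q12 Q20 Q21 Q22 Q30 Q31 Q32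
    F10 F11 F12 F20 F21 F22 F30 F31 F32 : C) :
  let hi := (h ^ 11)%C in
  (g * gi)%C = RtoC 1 -> (h ^ 12)%C = RtoC 1 ->
  (g ^ 2 * (T0 * Q10 + F10) + gi * hi * (t2 * Q22 + F22) + gi * h * (t1 * Q31 + F31))%C = RtoC 0 ->
  (gi * h * (t1 * Q11 + F11) + g ^ 2 * (T0 * Q20 + F20) + gi * hi * (t2 * Q32 + F32))%C = RtoC 0 ->
  (gi * hi * (t2 * Q12 + F12) + gi * h * (t1 * Q21 + F21) + g ^ 2 * (T0 * Q30 + F30))%C = RtoC 0 ->
  (gi ^ 2 * (- T0 * Q10 + F10) + g * hi * (- t1 * Q21 + F21) + g * h * (- t2 * Q32 + F32))%C = RtoC 0 ->
  (g * h * (- t2 * Q12 + F12) + gi ^ 2 * (- T0 * Q20 + F20) + g * hi * (- t1 * Q31 + F31))%C = RtoC 0 ->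
  (g * hi * (- t1 * Q11 + F11) + g * h * (- t2 * Q22 + F22) + gi ^ 2 * (- T0 * Q30 + F30))%C = RtoC 0 ->
  (hi ^ 2 * ((gi * h) ^ 3 + (g * hi) ^ 3) * F10
    + ((gi * hi) ^ 3 + (g * h) ^ 3) * F20
    + h ^ 2 * ((gi * h) ^ 3 + (g * hi) ^ 3) * F30
    + RtoC 2 * (h ^ 2) ^ 2 * F11
    + RtoC 2 * F21
    + RtoC 2 * (hi ^ 2) ^ 2 * F31
    + RtoC 2 * hi ^ 2 * F12
    + ((h ^ 2) ^ 3 + (hi ^ 2) ^ 3) * F22
    + RtoC 2 * h ^ 2 * F32)%C
  = (- T0 * (hi ^ 4 * (hi * g ^ 3) - h * gi ^ 3) * (Q10 + h ^ 4 * Q30 + hi ^ 4 * Q20))%C.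
Proof.
intros hi Hg Hh R1 R2 R3 R4 R5 R6.
(* In each triple the weights 1, h^8, h^4 are 1, alphabar^m, alpha^m when h = exp (i m PI / 6); they
   put the unknowns of both triples in the same proportions. The unknowns at the rotated arguments
   have opposite signs in the two triples, and the prefactors [h ^ 7 * g] and [h * gi] make their
   coefficients equal in size. *)
match type of R1 with ?L1 = _ => match type of R2 with ?L2 = _ =>
match type of R3 with ?L3 = _ => match type of R4 with ?L4 = _ =>
match type of R5 with ?L5 = _ => match type of R6 with ?L6 = _ =>
match goal with |- ?X = ?Y => transitivity
  (Y + (h ^ 7 * g * (L1 + h ^ 8 * L2 + h ^ 4 * L3) + h * gi * (L4 + h ^ 8 * L5 + h ^ 4 * L6)))%C
end end end end end end end.
- clear R1 R2 R3 R4 R5 R6; unfold hi; ring [Hg Hh].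
- rewrite R1, R2, R3, R4, R5, R6; ring.
Qed.

Lemma Cexp_pow (z : C) (n : nat) : (Cexp z ^ n)%C = Cexp (RtoC (INR n) * z)%C.
Proof.
induction n as [|n IH].
- cbn [INR]; rewrite Cmult_0_l, Cexp_0; reflexivity.
- rewrite S_INR, RtoC_plus; cbn [Cpow]; rewrite IH, <- Cexp_add; f_equal; ring.
Qed.

Lemma Cexp_opp (z : C) : Cexp (- z)%C = (/ Cexp z)%C.
Proof.
assert (H : Cexp z <> RtoC 0).
{ intros H; pose proof (Cexp_opp_r z) as E; rewrite H, Cmult_0_l in E; injection E; lra. }
transitivity (/ Cexp z * (Cexp z * Cexp (- z)))%C; [field; exact H|].
rewrite Cexp_opp_r; ring.
Qed.

Lemma CpowZ_Cexp (z : C) (m : Z) : CpowZ (Cexp z) m = Cexp (RtoC (IZR m) * z)%C.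
Proof.
destruct m as [|p|p]; cbn [CpowZ].
- rewrite Cmult_0_l, Cexp_0; reflexivity.
- rewrite Cexp_pow, INR_IZR_INZ, positive_nat_Z; reflexivity.
- rewrite Cexp_pow, <- Cexp_opp, INR_IZR_INZ, positive_nat_Z.
  change (Z.neg p) with (- Z.pos p)%Z; rewrite opp_IZR, RtoC_opp; f_equal; ring.
Qed.

Lemma Cexp_2PI (m : Z) : Cexp (0, 2 * PI * IZR m) = RtoC 1.
Proof.
assert (K : forall n : nat, Cexp (0, 2 * PI * INR n) = RtoC 1).
{ intros n; unfold Cexp, RtoC; cbn [Re Im fst snd].
  replace (2 * PI * INR n) with (0 + 2 * INR n * PI) by ring.
  rewrite cos_period, sin_period, exp_0, cos_0, sin_0; f_equal; ring. }
destruct (Z.le_gt_cases 0 m) as [H|H].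
- rewrite <- (Z2Nat.id m H), <- INR_IZR_INZ; apply K.
- assert (E := K (Z.to_nat (- m))); rewrite INR_IZR_INZ, Z2Nat.id, opp_IZR in E by lia.
  replace (0, 2 * PI * IZR m) with (Copp (0, 2 * PI * - IZR m))
    by (unfold Copp; cbn; f_equal; ring).
  rewrite Cexp_opp, E; field.
Qed.

Lemma W_opp (lam : R) (k : C) : W lam (- k)%C = (- W lam k)%C.
Proof.
unfold W, Cdiv; replace (/ - k)%C with (- / k)%C; [ring|].
destruct k as [a b]; unfold Cinv, Copp; cbn [fst snd].
replace ((- a) ^ 2 + (- b) ^ 2) with (a ^ 2 + b ^ 2) by ring.
unfold Rdiv; f_equal; ring.
Qed.

Lemma alpha_mul : (alpha * alpha)%C = alphabar /\ (alphabar * alphabar)%C = alpha /\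
  (alpha * alphabar)%C = RtoC 1 /\ (alphabar * alpha)%C = RtoC 1.
Proof.
rewrite alphaE, alphabarE; pose proof sqrt3_sq as H.
unfold Cmult, RtoC; cbn [fst snd]; repeat split; f_equal; field [H].
Qed.

(** The involution keeps the tangential exponent, hence every transform, and reverses the normal
    one. The relations at k, [alpha k], [alphabar k] thereby double to six in the same unknowns. *)
Lemma reciprocal_spectral (lam : R) (k : C) : lam <> 0 -> k <> RtoC 0 ->
  W lam (RtoC lam / k)%C = W lam k /\ T_N_coef lam (RtoC lam / k)%C = (- T_N_coef lam k)%C.
Proof.
intros Hlam Hk.
assert (HL : RtoC lam <> RtoC 0) by (intros H; apply Hlam; injection H; auto).
assert (HI : Ci <> RtoC 0) by (intros H; injection H; lra).
unfold W, T_N_coef; split; [field; split; assumption|].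
assert (EI : forall z, z <> RtoC 0 -> (RtoC lam / (Ci * z))%C = (- (Ci * (RtoC lam / z)))%C).
{ intros z Hz; transitivity (- (RtoC (-1)) * (RtoC lam / (Ci * z)))%C.
  - rewrite <- RtoC_opp; replace (- -1) with 1 by ring; ring.
  - rewrite <- Ci_sq; field; split; assumption. }
rewrite !EI; try assumption.
- field; split; assumption.
- intros H; apply HL; transitivity (RtoC lam / k * k)%C; [field; exact Hk|rewrite H; ring].
Qed.

Section Elimination.

Variables (l lam : R) (f u : side -> R -> R).
Hypothesis hl : 0 < l.
Hypothesis GR : forall k : C, k <> RtoC 0 ->
  let term j := (Efun l lam (- (Ci * (side_normal j * k)))
    * (T_N_coef lam (side_normal j * k) * hat l (u j) (W lam (side_normal j * k))
       + hat l (f j) (W lam (side_normal j * k))))%C in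
  (term side1 + term side2 + term side3)%C = RtoC 0.

(** At k = k_m every exponential in the six relations is a monomial in g, its inverse and a twelfth
    root of unity h, so [eliminate] applies. The bracket it leaves in front of the unknowns is
    [N_den], and the weights alpha^m and alphabar^m are those of a Fourier coefficient on the
    perimeter. *)
Lemma N_fun_eq (m : Z) (k : C) : lam <> 0 -> k <> RtoC 0 ->
  W lam k = (0, 2 * IZR m * PI / (3 * l)) ->
  T_N_coef lam k <> RtoC 0 -> N_den l lam m k <> RtoC 0 ->
  N_fun l lam f m k =
  (hat l (u side1) (W lam k) + CpowZ alpha m * hat l (u side3) (W lam k)
   + CpowZ alphabar m * hat l (u side2) (W lam k))%C.
Proof.
intros Hlam Hk Hw HT HD.
destruct alpha_mul as (aa & bb & ab & ba).
pose proof (apothem_side l) as Hl; pose proof sqrt3_sq as H33.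
set (c := apothem l) in *.
set (nu := (- T_N_coef lam k)%C).
(* Half an apothem is the common unit of the normal exponents, because the normals have components 1
   and -1/2. Likewise h below is exp (W l / 4); its inverse is written h^11, which keeps the
   identities polynomial. *)
set (g := Cexp (nu * RtoC (c / 2))%C).
set (gi := Cexp (- nu * RtoC (c / 2))%C).
set (h := Cexp (0, IZR m * PI / 6)).
assert (Hg : (g * gi)%C = RtoC 1).
{ unfold g, gi; rewrite <- Cexp_add, <- Cexp_0; f_equal; ring. }
assert (Hh : (h ^ 12)%C = RtoC 1).
{ unfold h; rewrite Cexp_pow, <- (Cexp_2PI m); f_equal.
  cbn [INR]; unfold Cmult, RtoC; cbn [fst snd]; f_equal; field. }
assert (Hhi : (h ^ 11)%C = Cexp (0, - (IZR m * PI / 6))).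
{ set (hn := Cexp (0, - (IZR m * PI / 6))).
  transitivity (h ^ 11 * (h * hn))%C.
  - unfold h at 3, hn; rewrite <- Cexp_add.
    replace (Cplus _ _) with (RtoC 0); [rewrite Cexp_0; ring|].
    unfold Cplus, RtoC; cbn; f_equal; ring.
  - rewrite Cmult_assoc; replace (h ^ 11 * h)%C with (h ^ 12)%C by ring.
    rewrite Hh; ring. }
destruct (side_exponents lam k side2 Hk) as [Wb Tb].
destruct (side_exponents lam k side3 Hk) as [Wa Ta].
cbn [side_normal] in Wa, Ta, Wb, Tb; fold nu in Wa, Ta, Wb, Tb.
rewrite nxE, nyE in Wa, Ta, Wb, Tb.
(* These two relations between apothem and side make all exponents at the rotated arguments whole
   multiples of W l / 4 and nu c / 2. *)
assert (Hc4 : sqrt 3 / 2 * c = l / 4) by (rewrite Hl; field).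
assert (Hc32 : sqrt 3 / 2 * (l / 2) = 3 * (c / 2)).
{ rewrite Hl; transitivity (sqrt 3 * sqrt 3 * c / 2); [field|rewrite H33; field]. }
assert (split_exp : forall (z w : C) (a b r x y : R), a * r = x -> b * r = y ->
  Cexp ((RtoC a * z + RtoC b * w) * RtoC r)%C = (Cexp (z * RtoC x) * Cexp (w * RtoC y))%C).
{ intros z w a b r x y <- <-; rewrite <- Cexp_add; f_equal; rewrite !RtoC_mult; ring. }
assert (Eg : forall (n : nat) r, r = INR n * (c / 2) ->
  Cexp (nu * RtoC r)%C = (g ^ n)%C /\ Cexp (nu * RtoC (- r))%C = (gi ^ n)%C).
{ intros n r ->; unfold g, gi; rewrite !Cexp_pow, RtoC_opp, !RtoC_mult; split; f_equal; ring. }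
assert (Eh : Cexp (W lam k * RtoC (l / 4))%C = h /\
  Cexp (W lam k * RtoC (- (l / 4)))%C = (h ^ 11)%C /\
  Cexp (W lam k * RtoC (l / 2))%C = (h ^ 2)%C /\
  Cexp (- W lam k * RtoC (l / 2))%C = ((h ^ 11) ^ 2)%C).
{ rewrite Hhi, Cexp_pow; unfold h; rewrite Cexp_pow, Hw.
  unfold Copp, Cmult, RtoC; cbn [fst snd INR].
  repeat split; do 2 f_equal; field; lra. }
destruct Eh as (Eh1 & Eh2 & Eh3 & Eh4).
assert (Ea : Cexp (- T_N_coef lam (alpha * k) * RtoC c)%C = (gi * h)%C).
{ rewrite Ta, (split_exp nu _ _ _ _ (- (INR 1 * (c / 2))) (l / 4)), Eh1;
    [|cbn [INR]; field|exact Hc4].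
  rewrite (proj2 (Eg 1%nat _ eq_refl)); ring. }
assert (Eb : Cexp (- T_N_coef lam (alphabar * k) * RtoC c)%C = (gi * h ^ 11)%C).
{ rewrite Tb, (split_exp nu _ _ _ _ (- (INR 1 * (c / 2))) (- (l / 4))), Eh2;
    [|cbn [INR]; field|lra].
  rewrite (proj2 (Eg 1%nat _ eq_refl)); ring. }
assert (Ea' : Cexp (T_N_coef lam (alpha * k) * RtoC c)%C = (g * h ^ 11)%C).
{ replace (T_N_coef lam (alpha * k))%C with
    (RtoC (1 / 2) * nu + RtoC (- (sqrt 3 / 2)) * W lam k)%C.
  - rewrite (split_exp nu _ _ _ _ (INR 1 * (c / 2)) (- (l / 4))), Eh2;
      [|cbn [INR]; field|lra].
    rewrite (proj1 (Eg 1%nat _ eq_refl)); ring.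
  - transitivity (- (- T_N_coef lam (alpha * k)))%C; [|ring].
    rewrite Ta, !RtoC_opp; ring. }
assert (Eb' : Cexp (T_N_coef lam (alphabar * k) * RtoC c)%C = (g * h)%C).
{ replace (T_N_coef lam (alphabar * k))%C with
    (RtoC (1 / 2) * nu + RtoC (sqrt 3 / 2) * W lam k)%C.
  - rewrite (split_exp nu _ _ _ _ (INR 1 * (c / 2)) (l / 4)), Eh1;
      [|cbn [INR]; field|lra].
    rewrite (proj1 (Eg 1%nat _ eq_refl)); ring.
  - transitivity (- (- T_N_coef lam (alphabar * k)))%C; [|ring].
    rewrite Tb, !RtoC_opp; ring. }
assert (E0 : Cexp (- T_N_coef lam k * RtoC c)%C = (g ^ 2)%C).
{ fold nu; apply (Eg 2%nat); cbn [INR]; field. }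
assert (E0' : Cexp (T_N_coef lam k * RtoC c)%C = (gi ^ 2)%C).
{ rewrite <- (proj2 (Eg 2%nat c ltac:(cbn [INR]; field))); f_equal; unfold nu.
  rewrite RtoC_opp; ring. }
assert (ED : N_den l lam m k = ((h ^ 11) ^ 4 * (h ^ 11 * g ^ 3) - h * gi ^ 3)%C).
{ unfold N_den, efun; f_equal; [f_equal|f_equal].
  - unfold alphabar; rewrite CpowZ_Cexp, Hhi, Cexp_pow; f_equal.
    unfold Cmult, RtoC; cbn [fst snd INR]; f_equal; field.
  - rewrite Wb.
    replace (RtoC (- (1 / 2)) * W lam k - RtoC (- (sqrt 3 / 2)) * nu)%C with
      (RtoC (- (1 / 2)) * W lam k + RtoC (sqrt 3 / 2) * nu)%C by (rewrite !RtoC_opp; ring).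
    rewrite (split_exp _ nu _ _ _ (- (l / 4)) (INR 3 * (c / 2))), Eh2;
      [|field|cbn [INR]; lra].
    rewrite (proj1 (Eg 3%nat _ eq_refl)); reflexivity.
  - rewrite W_opp, Wb.
    replace (- (RtoC (- (1 / 2)) * W lam k - RtoC (- (sqrt 3 / 2)) * nu))%C with
      (RtoC (1 / 2) * W lam k + RtoC (- (sqrt 3 / 2)) * nu)%C by (rewrite !RtoC_opp; ring).
    rewrite (split_exp _ nu _ _ _ (l / 4) (- (INR 3 * (c / 2)))), Eh1;
      [|field|cbn [INR]; lra].
    rewrite (proj2 (Eg 3%nat _ eq_refl)); reflexivity. }
assert (Hkt : (RtoC lam / k)%C <> RtoC 0).
{ intros H; apply Hlam; assert (E : RtoC lam = RtoC 0); [|injection E; auto].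
  transitivity (RtoC lam / k * k)%C; [field; exact Hk|rewrite H; ring]. }
assert (Ha0 : alpha <> RtoC 0) by exact (side_normal_neq0 side3).
assert (Hb0 : alphabar <> RtoC 0) by exact (side_normal_neq0 side2).
destruct (reciprocal_spectral lam k Hlam Hk) as [Wt Tt].
destruct (reciprocal_spectral lam (alpha * k) Hlam) as [Wat Tat]; [apply Cmult_neq_0; assumption|].
destruct (reciprocal_spectral lam (alphabar * k) Hlam) as [Wbt Tbt]; [apply Cmult_neq_0; assumption|].
(* The involution exchanges the two rotations, which is why the roles of [alpha] and [alphabar] are
   swapped in R4, R5 and R6. *)
replace (RtoC lam / (alpha * k))%C with (alphabar * (RtoC lam / k))%C in Wat, Tat
  by (transitivity (alpha * alphabar * (RtoC lam / (alpha * k)))%C;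
      [field; split; assumption|rewrite ab; ring]).
replace (RtoC lam / (alphabar * k))%C with (alpha * (RtoC lam / k))%C in Wbt, Tbt
  by (transitivity (alphabar * alpha * (RtoC lam / (alphabar * k)))%C;
      [field; split; assumption|rewrite ba; ring]).
set (kt := (RtoC lam / k)%C) in *.
assert (m1 : forall z, (RtoC 1 * z)%C = z) by (intros; ring).
assert (r1 : forall z, (alpha * (alpha * z))%C = (alphabar * z)%C)
  by (intros; rewrite Cmult_assoc, aa; ring).
assert (r2 : forall z, (alphabar * (alphabar * z))%C = (alpha * z)%C)
  by (intros; rewrite Cmult_assoc, bb; ring).
assert (r3 : forall z, (alpha * (alphabar * z))%C = z)
  by (intros; rewrite Cmult_assoc, ab; ring).
assert (r4 : forall z, (alphabar * (alpha * z))%C = z)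
  by (intros; rewrite Cmult_assoc, ba; ring).
assert (GE : forall z, z <> RtoC 0 ->
  let t j := (Cexp (- T_N_coef lam (side_normal j * z) * RtoC c)
    * (T_N_coef lam (side_normal j * z) * hat l (u j) (W lam (side_normal j * z))
       + hat l (f j) (W lam (side_normal j * z))))%C in
  (t side1 + t side2 + t side3)%C = RtoC 0).
{ intros z Hz t; rewrite <- (GR z Hz); unfold t, Efun; fold (apothem l); fold c.
  rewrite !W_opp_i; reflexivity. }
pose proof (GE k Hk) as R1.
pose proof (GE (alpha * k)%C ltac:(apply Cmult_neq_0; assumption)) as R2.
pose proof (GE (alphabar * k)%C ltac:(apply Cmult_neq_0; assumption)) as R3.
pose proof (GE kt Hkt) as R4.
pose proof (GE (alpha * kt)%C ltac:(apply Cmult_neq_0; assumption)) as R5.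
pose proof (GE (alphabar * kt)%C ltac:(apply Cmult_neq_0; assumption)) as R6.
cbn [side_normal] in R1, R2, R3, R4, R5, R6; clear GE.
rewrite !m1 in R1; rewrite !m1, !r1, !r4 in R2; rewrite !m1, !r2, !r3 in R3.
rewrite !m1 in R4; rewrite !m1, !r1, !r4 in R5; rewrite !m1, !r2, !r3 in R6.
assert (dbl : forall z : C, (- - z)%C = z) by (intros; ring).
rewrite Ea, Eb, E0 in R1; rewrite Ea, Eb, E0 in R2; rewrite Ea, Eb, E0 in R3.
rewrite Tt, Tat, Tbt, Wt, Wat, Wbt, !dbl, Ea', Eb', E0' in R4.
rewrite Tt, Tat, Tbt, Wt, Wat, Wbt, !dbl, Ea', Eb', E0' in R5.
rewrite Tt, Tat, Tbt, Wt, Wat, Wbt, !dbl, Ea', Eb', E0' in R6.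
pose proof (eliminate g gi h _ _ _ _ _ _ _ _ _ _ _ _ _ _ _ _ _ _ _ _ _ Hg Hh R1 R2 R3 R4 R5 R6) as M.
cbv zeta in M.
assert (Epm : CpowZ alpha m = (h ^ 4)%C /\ CpowZ alphabar m = ((h ^ 11) ^ 4)%C).
{ unfold alpha, alphabar; rewrite !CpowZ_Cexp, Hhi, Cexp_pow; unfold h; rewrite Cexp_pow.
  unfold Cmult, RtoC; cbn [fst snd INR]; split; do 2 f_equal; field. }
destruct Epm as [-> ->]; rewrite <- ED in M.
unfold N_fun, T_N; cbv zeta.
assert (Een : efun l lam (- k) = ((h ^ 11) ^ 2)%C) by (unfold efun; rewrite W_opp; exact Eh4).
assert (Eep : efun l lam k = (h ^ 2)%C) by exact Eh3.
assert (EE1 : Efun l lam (- (Ci * alpha * k)) = (gi * h)%C)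
  by (unfold Efun; fold (apothem l); rewrite <- Cmult_assoc, W_opp_i; exact Ea).
assert (EE2 : Efun l lam (Ci * alpha * k) = (g * h ^ 11)%C)
  by (unfold Efun; fold (apothem l); rewrite <- Cmult_assoc; exact Ea').
assert (EE3 : Efun l lam (- (Ci * alphabar * k)) = (gi * h ^ 11)%C)
  by (unfold Efun; fold (apothem l); rewrite <- Cmult_assoc, W_opp_i; exact Eb).
assert (EE4 : Efun l lam (Ci * alphabar * k) = (g * h)%C)
  by (unfold Efun; fold (apothem l); rewrite <- Cmult_assoc; exact Eb').
rewrite Een, Eep, EE1, EE2, EE3, EE4.
assert (EF : forall j z, Ffun l lam f j z = (RtoC (1 / 2) * hat l (f j) (W lam z))%C) by reflexivity.
rewrite !EF.
(* The 2 in front of T_N absorbs the 1/2 in each F_j. *)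
match type of M with ?L = ?X => match goal with |- (?two * (?S / ?D) / ?N)%C = ?Y =>
  assert (ES : (two * S)%C = L) end end.
{ rewrite RtoC_div by lra; field; intros H; injection H; lra. }
assert (HT' : (- T_N_coef lam k)%C <> RtoC 0).
{ intros H; apply HT; transitivity (- - T_N_coef lam k)%C; [ring|rewrite H; ring]. }
match goal with |- (?two * (?S / ?D) / ?N)%C = ?Y =>
  transitivity (two * S / D / N)%C; [field; repeat split; assumption|] end.
rewrite ES, M; field; repeat split; assumption.
Qed.

End Elimination.

(** * Decay of the coefficients *)

Lemma clamp_segment_continuous (a b : R) (f : R -> R) : a <= b ->
  continuous_on_segment a b f -> forall s, continuous (fun s => f (clamp a b s)) s.
Proof.
intros Hab Hf s.
apply (filterlim_comp _ _ _ (clamp a b) f _ (within (fun t => a <= t <= b) (locally (clamp a b s)))).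
- intros P HP.
  pose proof (proj1 (continuity_pt_filterlim _ _) (clamp_cont a b s Hab) _ HP) as H.
  unfold filtermap in *; revert H; apply filter_imp; intros t Ht; apply Ht, clamp_in, Hab.
- apply Hf, clamp_in, Hab.
Qed.

(** Integrate the derivative, frozen at its end values outside the segment. The difference with f is
    continuous, has zero derivative inside and vanishes at a. *)
Lemma C1_extension (a b : R) (f : R -> R) : a < b -> C1_on_segment a b f ->
  exists F F' : R -> R, (forall s, is_derive F s (F' s)) /\ (forall s, continuous F' s) /\
    forall s, a <= s <= b -> F s = f s.
Proof.
intros Hab [Hf (g & Hg & Hd)].
pose proof (clamp_segment_continuous a b f ltac:(lra) Hf) as cf.
pose proof (clamp_segment_continuous a b g ltac:(lra) Hg) as cg.
set (gc := fun s => g (clamp a b s)) in *.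
set (F := fun s => f a + RInt gc a s).
assert (HF : forall s, is_derive F s (gc s)).
{ intros s; unfold F; evar_last.
  - apply (is_derive_plus (V := R_NormedModule) (fun _ => f a) (fun s => RInt gc a s));
      [apply is_derive_const|].
    apply (is_derive_RInt gc (RInt gc a) a s); [|apply cg].
    apply filter_forall; intros t.
    apply (RInt_correct (V := R_CompleteNormedModule)).
    apply (ex_RInt_continuous (V := R_CompleteNormedModule)); intros; apply cg.
  - unfold plus, zero; cbn; ring. }
exists F, gc; split; [exact HF|split; [exact cg|]].
intros s Hs.
set (D := fun s => F s - f (clamp a b s)).
destruct (MVT_gen D a s (fun _ => 0)) as [x [_ Hx]].
- rewrite Rmin_left, Rmax_right by lra; intros x Hx; unfold D; evar_last.
  + apply (is_derive_minus (V := R_NormedModule)); [apply HF|].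
    apply (is_derive_ext_loc f); [|apply Hd; lra].
    assert (Hloc : locally x (fun t => a < t < b)).
    { apply filter_and; [apply (open_gt a)|apply (open_lt b)]; lra. }
    revert Hloc; apply filter_imp; intros t Ht; rewrite clamp_id by lra; reflexivity.
  + unfold gc; rewrite clamp_id by lra; unfold minus, plus, opp; cbn; ring.
- intros x _; unfold D; apply continuity_pt_minus; apply continuity_pt_filterlim.
  + apply (ex_derive_continuous (V := R_NormedModule)); eexists; apply HF.
  + apply cf.
- unfold D in Hx; rewrite !clamp_id in Hx by lra.
  unfold F in Hx at 2; rewrite RInt_point in Hx; unfold zero in Hx; cbn in Hx; lra.
Qed.

Lemma Cmod_Cexp (z : C) : Cmod (Cexp z) = exp (Re z).
Proof.
unfold Cmod, Cexp; cbn [fst snd].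
replace ((exp (Re z) * cos (Im z)) ^ 2 + (exp (Re z) * sin (Im z)) ^ 2)
  with (exp (Re z) ^ 2 * (Rsqr (sin (Im z)) + Rsqr (cos (Im z)))) by (unfold Rsqr; ring).
rewrite sin2_cos2, Rmult_1_r; apply sqrt_pow2, Rlt_le, exp_pos.
Qed.

Lemma continuous_bounded (a b : R) (f : R -> R) : a <= b -> (forall s, continuous f s) ->
  exists M, 0 <= M /\ forall s, a <= s <= b -> Rabs (f s) <= M.
Proof.
intros Hab Hf.
destruct (continuity_ab_maj (fun s => Rabs (f s)) a b Hab) as [x [Hx _]].
- intros s _; apply (continuity_pt_comp f Rabs); [apply continuity_pt_filterlim, Hf|].
  apply Rcontinuity_abs.
- exists (Rabs (f x)); split; [apply Rabs_pos|exact Hx].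
Qed.

Lemma exp_Re_bound (l s : R) (kap : C) : 0 < l -> - (l / 2) <= s <= l / 2 ->
  Cmod (Cexp (kap * RtoC s)) <= exp (Rabs (Re kap) * (l / 2)).
Proof.
intros Hl Hs; rewrite Cmod_Cexp; rewrite re_scal_r.
assert (H : Re kap * s <= Rabs (Re kap) * (l / 2)).
{ eapply Rle_trans; [apply Rle_abs|]; rewrite Rabs_mult.
  apply Rmult_le_compat_l; [apply Rabs_pos|apply Rabs_le; lra]. }
destruct H as [H|H]; [left; apply exp_increasing, H|right; rewrite H; reflexivity].
Qed.

Lemma hat_le (l M : R) (g : R -> R) (kap : C) : 0 < l -> (forall s, continuous g s) ->
  (forall s, - (l / 2) <= s <= l / 2 -> Rabs (g s) <= M) ->
  Cmod (hat l g kap) <= l * (exp (Rabs (Re kap) * (l / 2)) * M).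
Proof.
intros Hl Hg HM.
destruct (hatE l g kap Hg) as (HI & _).
replace l with (l / 2 - - (l / 2)) at 2 by field.
rewrite Cmod_norm.
refine (norm_RInt_le_const (V := C_R_NormedModule) _ _ _ _ _ _ _ HI); [lra|].
intros s Hs; rewrite <- Cmod_norm, Cmod_mult, Cmod_R.
apply Rmult_le_compat; [apply Cmod_ge_0|apply Rabs_pos|apply exp_Re_bound; assumption|].
apply HM, Hs.
Qed.

Lemma hat_by_parts (l : R) (F F' : R -> R) (kap : C) :
  (forall s, is_derive F s (F' s)) -> (forall s, continuous F' s) ->
  (kap * hat l F kap)%C =
  (Cexp (kap * RtoC (l / 2)) * RtoC (F (l / 2)%R)
   - Cexp (kap * RtoC (- (l / 2))) * RtoC (F (- (l / 2))%R) - hat l F' kap)%C.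
Proof.
intros HF cF'.
assert (cF : forall s, continuous F s)
  by (intros s; apply (ex_derive_continuous (V := R_NormedModule)); eexists; apply HF).
destruct (hatE l F kap cF) as (_ & E1 & E2 & ->).
destruct (hatE l F' kap cF') as (_ & E3 & E4 & ->).
destruct kap as [a b].
assert (EC : forall s, Cexp ((a, b) * RtoC s)%C =
  (exp (a * s) * cos (b * s), exp (a * s) * sin (b * s))).
{ intros s; unfold Cexp, Cmult, RtoC; cbn [fst snd Re Im].
  replace (a * s - b * 0) with (a * s) by ring; replace (a * 0 + b * s) with (b * s) by ring.
  reflexivity. }
set (c := fun s => exp (a * s) * cos (b * s)); set (d := fun s => exp (a * s) * sin (b * s)).
assert (cl : forall s, continuous c s /\ continuous d s).
{ intros s; split; apply (ex_derive_continuous (V := R_NormedModule)); unfold c, d;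
    auto_derive; exact I. }
(* One real integration by parts serves both components: (x, y) is (c, d) with (p, r) = (a, - b) for
   the real part, and (d, c) with (a, b) for the imaginary part. *)
assert (K : forall (x y : R -> R) (p r : R), (forall s, continuous x s) -> (forall s, continuous y s) ->
  (forall s, is_derive x s (p * x s + r * y s)) ->
  ex_RInt (fun s => x s * F s) (- (l / 2)) (l / 2) ->
  ex_RInt (fun s => y s * F s) (- (l / 2)) (l / 2) ->
  ex_RInt (fun s => x s * F' s) (- (l / 2)) (l / 2) ->
  p * RInt (fun s => x s * F s) (- (l / 2)) (l / 2) + r * RInt (fun s => y s * F s) (- (l / 2)) (l / 2)
  + RInt (fun s => x s * F' s) (- (l / 2)) (l / 2)
  = x (l / 2) * F (l / 2) - x (- (l / 2)) * F (- (l / 2))).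
{ intros x y p r cx cy dx' I1 I2 I3.
  transitivity (RInt (fun s => p * (x s * F s) + r * (y s * F s) + 1 * (x s * F' s) + 0 * (x s * F' s))
    (- (l / 2)) (l / 2)).
  { rewrite RInt_lin4 by assumption; ring. }
  apply is_RInt_unique.
  apply (is_RInt_derive (V := R_CompleteNormedModule) (fun s => x s * F s)); intros s _.
  - pose proof (dx' s) as h1; pose proof (HF s) as h2.
    auto_derive; [repeat split; eexists; eassumption|].
    change (fun x1 : R => x x1) with x; change (fun x1 : R => F x1) with F.
    rewrite (is_derive_unique _ _ _ h1), (is_derive_unique _ _ _ h2); ring.
  - pose proof (continuous_mult (K := R_AbsRing) x F s (cx s) (cF s)) as c1.
    pose proof (continuous_mult (K := R_AbsRing) y F s (cy s) (cF s)) as c2.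
    pose proof (continuous_mult (K := R_AbsRing) x F' s (cx s) (cF' s)) as c3.
    pose proof (fun z g => continuous_scal_r (V := R_NormedModule) z g s) as sc.
    exact (continuous_plus (V := R_NormedModule) _ _ s (continuous_plus (V := R_NormedModule) _ _ s
      (continuous_plus (V := R_NormedModule) _ _ s (sc p _ c1) (sc r _ c2)) (sc 1 _ c3)) (sc 0 _ c3)). }
assert (R1 : forall G : R -> R, RInt (fun s => Re (Cexp ((a, b) * RtoC s)) * G s) (- (l / 2)) (l / 2)
  = RInt (fun s => c s * G s) (- (l / 2)) (l / 2))
  by (intros G; apply RInt_ext; intros s _; rewrite EC; reflexivity).
assert (R2 : forall G : R -> R, RInt (fun s => Im (Cexp ((a, b) * RtoC s)) * G s) (- (l / 2)) (l / 2)
  = RInt (fun s => d s * G s) (- (l / 2)) (l / 2))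
  by (intros G; apply RInt_ext; intros s _; rewrite EC; reflexivity).
assert (X : forall x G, (forall s, continuous x s) -> (forall s, continuous G s) ->
  ex_RInt (fun s => x s * G s) (- (l / 2)) (l / 2)).
{ intros x G cx cG; apply (ex_RInt_continuous (V := R_CompleteNormedModule)); intros s _.
  apply (continuous_mult (K := R_AbsRing)); [apply cx|apply cG]. }
assert (cc : forall s, continuous c s) by (intros; apply cl).
assert (cd : forall s, continuous d s) by (intros; apply cl).
assert (K1 := K c d a (- b) cc cd ltac:(intros s; unfold c, d; auto_derive; [exact I|ring])
  (X _ _ cc cF) (X _ _ cd cF) (X _ _ cc cF')).
assert (K2 := K d c a b cd cc ltac:(intros s; unfold c, d; auto_derive; [exact I|ring])
  (X _ _ cd cF) (X _ _ cc cF) (X _ _ cd cF')).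
rewrite !R1, !R2, !EC.
unfold Cminus, Cplus, Copp, Cmult, RtoC; cbn [fst snd]; unfold c, d in K1, K2 |- *.
f_equal; lra.
Qed.

Lemma hat_decay (l : R) (F F' : R -> R) : 0 < l ->
  (forall s, is_derive F s (F' s)) -> (forall s, continuous F' s) ->
  exists M, 0 <= M /\ forall kap,
    Cmod kap * Cmod (hat l F kap) <= M * exp (Rabs (Re kap) * (l / 2)).
Proof.
intros Hl HF cF'.
assert (cF : forall s, continuous F s)
  by (intros s; apply (ex_derive_continuous (V := R_NormedModule)); eexists; apply HF).
destruct (continuous_bounded (- (l / 2)) (l / 2) F ltac:(lra) cF) as [M0 [h0 H0]].
destruct (continuous_bounded (- (l / 2)) (l / 2) F' ltac:(lra) cF') as [M1 [h1 H1]].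
exists (2 * M0 + l * M1); split; [nra|]; intros kap.
rewrite <- Cmod_mult, (hat_by_parts l F F') by assumption.
pose proof (hat_le l M1 F' kap Hl cF' H1) as K1.
set (e := exp (Rabs (Re kap) * (l / 2))) in *.
assert (Kb : forall s, - (l / 2) <= s <= l / 2 ->
  Cmod (Cexp (kap * RtoC s) * RtoC (F s))%C <= e * M0).
{ intros s Hs; rewrite Cmod_mult, Cmod_R.
  apply Rmult_le_compat; [apply Cmod_ge_0|apply Rabs_pos|apply exp_Re_bound; assumption|].
  apply H0, Hs. }
unfold Cminus.
eapply Rle_trans; [apply Cmod_triangle|]; rewrite Cmod_opp.
eapply Rle_trans; [apply Rplus_le_compat_r, Cmod_triangle|]; rewrite Cmod_opp.
pose proof (Kb (l / 2) ltac:(lra)); pose proof (Kb (- (l / 2)) ltac:(lra)); lra.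
Qed.

Lemma Cmod_mult_le (z w : C) (x y : R) : Cmod z <= x -> Cmod w <= y -> Cmod (z * w) <= x * y.
Proof.
intros Hz Hw; rewrite Cmod_mult.
apply Rmult_le_compat; auto using Cmod_ge_0.
Qed.

Lemma Cmod_plus_le (z w : C) (x y : R) : Cmod z <= x -> Cmod w <= y -> Cmod (z + w) <= x + y.
Proof.
intros Hz Hw; eapply Rle_trans; [apply Cmod_triangle|]; lra.
Qed.

Lemma Cmod_pow_le1 (z : C) (n : nat) : Cmod z <= 1 -> Cmod (z ^ n) <= 1.
Proof.
intros Hz; induction n as [|n IH]; cbn [Cpow]; [rewrite Cmod_1; lra|].
replace 1 with (1 * 1) by ring; apply Cmod_mult_le; assumption.
Qed.

(** When W = i mu the square of [T_N_coef] is mu^2 + 4 lam; if this is positive, [T_N_coef] is real.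
    The sign of t depends on which root k of the quadratic was chosen. *)
Lemma spectral_moduli (l lam mu : R) (k : C) : 0 < l -> k <> RtoC 0 -> W lam k = (0, mu) ->
  0 < mu * mu + 4 * lam ->
  exists t, t * t = mu * mu + 4 * lam /\ T_N_coef lam k = RtoC t /\
    W lam (alpha * k)%C = (sqrt 3 / 2 * t, - (mu / 2)) /\
    W lam (alphabar * k)%C = (- (sqrt 3 / 2 * t), - (mu / 2)) /\
    Re (T_N_coef lam (alpha * k)%C) = - (t / 2) /\
    Re (T_N_coef lam (alphabar * k)%C) = - (t / 2).
Proof.
intros Hl Hk Hw Hpos.
pose proof (spectral_square lam k Hk) as H; rewrite Hw in H.
destruct (T_N_coef lam k) as [t t'] eqn:ET.
pose proof (f_equal fst H) as H1; pose proof (f_equal snd H) as H2.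
unfold Cplus, Cmult, RtoC in H1, H2; cbn [fst snd] in H1, H2.
assert (Htt : t' = 0).
{ assert (t * t' = 0) by lra.
  destruct (Rmult_integral _ _ H0) as [E|E]; [rewrite E in H1; nra|exact E]. }
subst t'; exists t.
destruct (side_exponents lam k side2 Hk) as [Wb Tb].
destruct (side_exponents lam k side3 Hk) as [Wa Ta].
cbn [side_normal] in Wa, Ta, Wb, Tb; rewrite ET, Hw in Wa, Ta, Wb, Tb.
rewrite nxE, nyE in Wa, Ta, Wb, Tb.
split; [lra|]; split; [reflexivity|].
unfold Cminus, Cplus, Copp, Cmult, RtoC in *; cbn [fst snd] in *.
split; [rewrite Wa; f_equal; field|]; split; [rewrite Wb; f_equal; field|].
apply (f_equal fst) in Ta, Tb; unfold Re; cbn [fst] in *; lra.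
Qed.

(** One factor 1/m comes from integrating the data by parts, the other from dividing by [T_N_coef].
    Numerator and [N_den] grow exponentially at the same rate, so the growth cancels. *)
Lemma N_fun_decay (l lam : R) (F F' : side -> R -> R) : 0 < l ->
  (forall j s, is_derive (F j) s (F' j s)) -> (forall j s, continuous (F' j) s) ->
  exists K B, 0 <= K /\ 0 < B /\ forall (m : Z) (k : C), k <> RtoC 0 ->
    W lam k = (0, 2 * IZR m * PI / (3 * l)) -> B <= Rabs (IZR m) ->
    N_den l lam m k <> RtoC 0 ->
    Cmod (N_fun l lam F m k) <= K / (IZR m * IZR m).
Proof.
intros Hl HF cF'.
pose proof (apothem_pos l Hl) as Hc; pose proof (apothem_side l) as Hla.
pose proof sqrt3_pos as Hs3; pose proof sqrt3_sq as H33.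
set (c := apothem l) in *.
assert (exists M, 0 <= M /\ forall j kap,
  Cmod kap * Cmod (hat l (F j) kap) <= M * exp (Rabs (Re kap) * (l / 2))) as [M [HM0 HM]].
{ destruct (hat_decay l _ _ Hl (HF side1) (cF' side1)) as [M1 [h1 H1]].
  destruct (hat_decay l _ _ Hl (HF side2) (cF' side2)) as [M2 [h2 H2]].
  destruct (hat_decay l _ _ Hl (HF side3) (cF' side3)) as [M3 [h3 H3]].
  exists (M1 + M2 + M3); split; [lra|]; intros j kap.
  pose proof (exp_pos (Rabs (Re kap) * (l / 2))).
  destruct j; [eapply Rle_trans; [apply H1|]|eapply Rle_trans; [apply H2|]
    |eapply Rle_trans; [apply H3|]]; nra. }
pose proof PI_RGT_0 as Hpi.
(* The first summand gives mu^2 >= 36 |lam|, hence |t| >= |mu| / 2. The second then gives X >= 1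
   below, so that e >= 2 and e - 1/e >= e/2. *)
set (B' := 6 * (Rabs lam + 1) + 4 / (3 * c)).
assert (HB' : 0 < B').
{ unfold B'; pose proof (Rabs_pos lam).
  assert (0 < 4 / (3 * c)) by (apply Rdiv_lt_0_compat; lra); lra. }
(* The final bound is 144 M / mu^2, with mu = 2 m PI / (3 l); the threshold on m expresses |mu| >=
   B'. *)
exists (144 * M * (9 * l * l) / (4 * PI * PI)), (B' * (3 * l) / (2 * PI)).
split; [apply Rdiv_le_0_compat; nra|].
split; [apply Rdiv_lt_0_compat; nra|].
intros m k Hk Hw HB HD.
set (mu := 2 * IZR m * PI / (3 * l)) in *.
assert (Emu : mu = IZR m * (2 * PI / (3 * l))) by (unfold mu; field; lra).
assert (Hf : 0 < 2 * PI / (3 * l)) by (apply Rdiv_lt_0_compat; lra).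
assert (Hmu : B' <= Rabs mu).
{ rewrite Emu, Rabs_mult, (Rabs_right (2 * PI / (3 * l))) by lra.
  replace B' with (B' * (3 * l) / (2 * PI) * (2 * PI / (3 * l))) by (field; lra).
  apply Rmult_le_compat_r; lra. }
set (am := Rabs mu) in *.
assert (Eam : am * am = mu * mu) by (unfold am; rewrite <- Rabs_mult; apply Rabs_right; nra).
assert (Hlam : - lam <= Rabs lam) by (rewrite <- Rabs_Ropp; apply Rle_abs).
pose proof (Rabs_pos lam) as Hlp.
assert (H4c : 0 < 4 / (3 * c)) by (apply Rdiv_lt_0_compat; lra).
assert (Hbig : 36 * Rabs lam <= am * am).
{ assert (6 * (Rabs lam + 1) <= am) by (unfold B' in Hmu; lra). nra. }
destruct (spectral_moduli l lam mu k Hl Hk Hw) as (t & Ht & ET & Wa & Wb & Ta & Tb); [nra|].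
set (at_ := Rabs t).
assert (Eat : at_ * at_ = t * t) by (unfold at_; rewrite <- Rabs_mult; apply Rabs_right; nra).
assert (Hat0 : 0 <= at_) by apply Rabs_pos.
assert (Hat : am / 2 <= at_).
{ apply Rnot_lt_le; intros H. nra. }
(* Both sources of growth share this exponent: the cubes of E, with 3 (|t| / 2) c, and the
   transforms at the rotated arguments, with (sqrt 3 / 2) |t| over a half side l / 2. *)
set (X := 3 * c / 2 * at_).
assert (HX : 1 <= X).
{ unfold X. assert (4 / (3 * c) <= am) by (unfold B' in Hmu; lra).
  apply Rle_trans with (3 * c / 2 * (4 / (3 * c) / 2)); [right; field; lra|].
  apply Rmult_le_compat_l; lra. }
set (e := exp X).
assert (He : 2 <= e) by (unfold e; pose proof (exp_ineq1_le X); lra).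
assert (HXs : sqrt 3 / 2 * at_ * (l / 2) = X).
{ unfold X; rewrite Hla; transitivity (sqrt 3 * sqrt 3 * c * at_ / 2); [field|rewrite H33; field]. }
assert (Hexp : forall x, Rabs x <= X -> exp x <= e).
{ intros x Hx; unfold e; pose proof (Rle_abs x).
  destruct (Rle_lt_or_eq_dec x X) as [h|h]; [lra|left; apply exp_increasing, h|rewrite h; lra]. }
set (beta := M / am).
assert (Hbeta : 0 <= beta) by (apply Rdiv_le_0_compat; lra).
assert (Hhat : forall j kap, am / 2 <= Rabs (Im kap) ->
  Cmod (hat l (F j) kap) <= 2 * beta * exp (Rabs (Re kap) * (l / 2))).
{ intros j kap Him; pose proof (HM j kap) as H.
  assert (Hge : am / 2 <= Cmod kap).
  { eapply Rle_trans; [exact Him|].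
    eapply Rle_trans; [apply Rmax_r|apply (Rmax_Cmod kap)]. }
  pose proof (Cmod_ge_0 (hat l (F j) kap)) as h0.
  apply (Rmult_le_reg_l (am / 2)); [lra|].
  eapply Rle_trans; [apply Rmult_le_compat_r; [exact h0|exact Hge]|].
  eapply Rle_trans; [exact H|right; unfold beta; field; lra]. }
assert (HF0 : forall j, Cmod (Ffun l lam F j k) <= beta).
{ intros j; unfold Ffun; change (Cmod (RtoC (1 / 2) * hat l (F j) (W lam k)) <= beta).
  rewrite Cmod_mult, Cmod_R, Rabs_right by lra.
  pose proof (Hhat j (W lam k)) as H; rewrite Hw in H |- *; cbn [Re Im fst snd] in H.
  rewrite Rabs_R0, Rmult_0_l, exp_0 in H; fold am in H.
  assert (am / 2 <= am) by lra; specialize (H H0); lra. }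
assert (Hhm : Rabs (- (mu / 2)) = am / 2).
{ unfold am; rewrite Rabs_Ropp; unfold Rdiv; rewrite Rabs_mult, (Rabs_right (/ 2)); lra. }
assert (Hre : Rabs (sqrt 3 / 2 * t) * (l / 2) = X).
{ rewrite <- HXs; rewrite Rabs_mult, (Rabs_right (sqrt 3 / 2)) by lra; reflexivity. }
assert (HFa : forall j, Cmod (Ffun l lam F j (alpha * k)) <= e * beta).
{ intros j; unfold Ffun; change (Cmod (RtoC (1 / 2) * hat l (F j) (W lam (alpha * k))) <= e * beta).
  rewrite Cmod_mult, Cmod_R, Rabs_right by lra.
  pose proof (Hhat j (W lam (alpha * k))) as H; rewrite Wa in H |- *; cbn [Re Im fst snd] in H.
  rewrite Hhm, Hre in H; fold e in H; specialize (H ltac:(lra)); lra. }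
assert (HFb : forall j, Cmod (Ffun l lam F j (alphabar * k)) <= e * beta).
{ intros j; unfold Ffun; change (Cmod (RtoC (1 / 2) * hat l (F j) (W lam (alphabar * k))) <= e * beta).
  rewrite Cmod_mult, Cmod_R, Rabs_right by lra.
  pose proof (Hhat j (W lam (alphabar * k))) as H; rewrite Wb in H |- *; cbn [Re Im fst snd] in H.
  rewrite Hhm, Rabs_Ropp, Hre in H; fold e in H; specialize (H ltac:(lra)); lra. }
assert (He0 : Cmod (efun l lam k) <= 1).
{ unfold efun; rewrite Cmod_Cexp, re_scal_r, Hw; cbn [Re fst]; rewrite Rmult_0_l, exp_0; lra. }
assert (He1 : Cmod (efun l lam (- k)) <= 1).
{ unfold efun; rewrite Cmod_Cexp, re_scal_r, W_opp, Hw; cbn [Re fst Copp].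
  rewrite Ropp_0, Rmult_0_l, exp_0; lra. }
assert (HE : forall z, Rabs (Re (W lam z)) <= at_ / 2 -> Cmod (Efun l lam z ^ 3) <= e).
{ intros z Hz; unfold Efun; fold (apothem l); fold c; rewrite Cexp_pow, Cmod_Cexp, re_scal_l, re_scal_r.
  apply Hexp; rewrite !Rabs_mult, (Rabs_right (INR 3)), (Rabs_right c); cbn [INR]; try lra.
  unfold X; nra. }
assert (HTa : Rabs (- (t / 2)) <= at_ / 2).
{ rewrite Rabs_Ropp; unfold Rdiv; rewrite Rabs_mult, (Rabs_right (/ 2)); unfold at_; lra. }
assert (HTa' : Rabs (- - (t / 2)) <= at_ / 2) by (rewrite Rabs_Ropp; exact HTa).
assert (HE1 : Cmod (Efun l lam (- (Ci * alpha * k)) ^ 3) <= e).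
{ apply HE; rewrite <- Cmult_assoc, W_opp_i.
  change (Re (- T_N_coef lam (alpha * k))%C) with (- Re (T_N_coef lam (alpha * k)%C)); rewrite Ta; exact HTa'. }
assert (HE2 : Cmod (Efun l lam (Ci * alpha * k) ^ 3) <= e).
{ apply HE; rewrite <- Cmult_assoc.
  change (W lam (Ci * (alpha * k))) with (T_N_coef lam (alpha * k)%C); rewrite Ta; exact HTa. }
assert (HE3 : Cmod (Efun l lam (- (Ci * alphabar * k)) ^ 3) <= e).
{ apply HE; rewrite <- Cmult_assoc, W_opp_i.
  change (Re (- T_N_coef lam (alphabar * k))%C) with (- Re (T_N_coef lam (alphabar * k)%C)); rewrite Tb; exact HTa'. }
assert (HE4 : Cmod (Efun l lam (Ci * alphabar * k) ^ 3) <= e).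
{ apply HE; rewrite <- Cmult_assoc.
  change (W lam (Ci * (alphabar * k))) with (T_N_coef lam (alphabar * k)%C); rewrite Tb; exact HTa. }
assert (H2 : Cmod (RtoC 2) <= 2) by (rewrite Cmod_R, Rabs_right; lra).
assert (Hden : e / 2 <= Cmod (N_den l lam m k)).
{ assert (Hp : Cmod (CpowZ alphabar m) = 1).
  { unfold alphabar; rewrite CpowZ_Cexp, Cmod_Cexp, re_scal_l; cbn [Re fst].
    rewrite Rmult_0_r; apply exp_0. }
  assert (Hb1 : Cmod (efun l lam (alphabar * k)) = exp (- (sqrt 3 / 2 * t * (l / 2)))).
  { unfold efun; rewrite Cmod_Cexp, re_scal_r, Wb; cbn [Re fst]; f_equal; ring. }
  assert (Hb2 : Cmod (efun l lam (- (alphabar * k))) = exp (sqrt 3 / 2 * t * (l / 2))).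
  { unfold efun; rewrite Cmod_Cexp, re_scal_r, W_opp, Wb; cbn [Re fst Copp]; f_equal; ring. }
  assert (Hei : exp (- X) <= 1 / 2).
  { rewrite exp_Ropp; fold e; replace (1 / 2) with (/ 2) by field; apply Rinv_le_contravar; lra. }
  unfold N_den; set (z := (CpowZ alphabar m * efun l lam (alphabar * k))%C).
  set (w := efun l lam (- (alphabar * k))) in *.
  assert (Hz : Cmod z = exp (- (sqrt 3 / 2 * t * (l / 2)))) by (unfold z; rewrite Cmod_mult, Hp, Hb1; ring).
  pose proof (Cmod_triangle (z - w) w) as h1; replace (z - w + w)%C with z in h1 by ring.
  pose proof (Cmod_triangle (w - z) z) as h2; replace (w - z + z)%C with w in h2 by ring.
  replace (Cmod (w - z)) with (Cmod (z - w)) in h2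
    by (rewrite <- (Cmod_opp (w - z)); f_equal; ring).
  rewrite Hz, Hb2 in h1, h2.
  (* The sign of t decides which of the two exponentials dominates; the lower bound is the same. *)
  destruct (Rle_dec 0 t) as [h|h].
  - assert (E : sqrt 3 / 2 * t * (l / 2) = X) by (rewrite <- HXs; unfold at_; rewrite Rabs_right; lra).
    rewrite E in h1, h2; fold e in h1, h2; lra.
  - assert (E : sqrt 3 / 2 * t * (l / 2) = - X)
      by (rewrite <- HXs; unfold at_; rewrite Rabs_left by lra; ring).
    rewrite E, ?Ropp_involutive in h1, h2; fold e in h1, h2; lra. }
unfold N_fun, T_N; cbv zeta; rewrite ET.
(* Each of the nine terms is at most 2 e beta: at k two cubes of size e multiply a transform of size
   beta, elsewhere a factor of size 2 multiplies a transform of size e beta. *)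
match goal with |- Cmod (_ * (?S / _) / _) <= _ => assert (HS : Cmod S <= 18 * (e * beta)); [|set (S' := S) in *] end.
{ replace (18 * (e * beta)) with (1 * (e + e) * beta + (e + e) * beta + 1 * (e + e) * beta
    + 2 * 1 * (e * beta) + 2 * (e * beta) + 2 * 1 * (e * beta) + 2 * 1 * (e * beta)
    + (1 + 1) * (e * beta) + 2 * 1 * (e * beta)) by ring.
  repeat match goal with
  | H : ?P |- ?P => exact H
  | |- Cmod (Ffun _ _ _ ?j k) <= _ => exact (HF0 j)
  | |- Cmod (Ffun _ _ _ ?j (alpha * _)%C) <= _ => exact (HFa j)
  | |- Cmod (Ffun _ _ _ ?j (alphabar * _)%C) <= _ => exact (HFb j)
  | |- Cmod (Cpow _ _) <= 1 => apply Cmod_pow_le1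
  | |- Cmod (Cplus _ _) <= _ => apply Cmod_plus_le
  | |- Cmod (Cmult _ _) <= _ => apply Cmod_mult_le
  end. }
assert (Hdp : 0 < Cmod (N_den l lam m k)) by lra.
assert (Htp : 0 < at_) by lra.
assert (Ht0 : (- RtoC t)%C <> RtoC 0).
{ intros H; apply (f_equal fst) in H; cbn in H; unfold at_ in Htp; replace t with 0 in Htp by lra.
  rewrite Rabs_R0 in Htp; lra. }
rewrite Cmod_div by exact HD; rewrite Cmod_mult, Cmod_div by exact Ht0.
rewrite Cmod_opp, !Cmod_R, (Rabs_right 2) by lra; fold at_.
apply Rle_trans with (2 * (18 * (e * beta) / at_) / (e / 2)).
- unfold Rdiv; apply Rmult_le_compat.
  + pose proof (Cmod_ge_0 S'); assert (0 < / at_) by (apply Rinv_0_lt_compat, Htp); nra.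
  + apply Rlt_le, Rinv_0_lt_compat, Hdp.
  + apply Rmult_le_compat_l; [lra|]; apply Rmult_le_compat_r; [|exact HS].
    apply Rlt_le, Rinv_0_lt_compat, Htp.
  + apply Rinv_le_contravar; lra.
- replace (2 * (18 * (e * beta) / at_) / (e / 2)) with (72 * M / (am * at_))
    by (unfold beta; field; lra).
  apply Rle_trans with (72 * M / (am * (am / 2))).
  + unfold Rdiv at 1 2; apply Rmult_le_compat_l; [lra|]; apply Rinv_le_contravar; [nra|].
    apply Rmult_le_compat_l; lra.
  + replace (am * (am / 2)) with (mu * mu / 2) by (rewrite <- Eam; field).
    assert (Hm0 : IZR m <> 0).
    { intros H; rewrite Emu, H, Rmult_0_l in Eam; nra. }
    right; rewrite Emu; field; repeat split; try lra; exact Hm0.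
Qed.

(** * Fejer summation on the perimeter *)

Fixpoint dirichlet (n : nat) (u : R) : R :=
  match n with
  | O => 1
  | S n => dirichlet n u + 2 * cos (INR (S n) * u)
  end.

(** Unnormalised: the usual Fejer kernel is this divided by N + 1. *)
Definition fejer (N : nat) (u : R) : R := sum_f_R0 (fun n => dirichlet n u) N.

(** Multiplying by 1 - cos u makes the sums telescope with no division, so the formula also holds at
    multiples of 2 PI. *)
Lemma dirichlet_closed (n : nat) (u : R) :
  (1 - cos u) * dirichlet n u = cos (INR n * u) - cos (INR (S n) * u).
Proof.
induction n as [|n IH].
- cbn [dirichlet INR]; rewrite Rmult_0_l, Rmult_1_l, cos_0; ring.
- cbn [dirichlet]; rewrite Rmult_plus_distr_l, IH.
  replace (INR n * u) with (INR (S n) * u - u) by (rewrite S_INR; ring).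
  replace (INR (S (S n)) * u) with (INR (S n) * u + u) by (rewrite (S_INR (S n)); ring).
  rewrite cos_minus, cos_plus; ring.
Qed.

Lemma fejer_closed (N : nat) (u : R) : (1 - cos u) * fejer N u = 1 - cos (INR (S N) * u).
Proof.
unfold fejer; induction N as [|N IH].
- cbn [sum_f_R0]; rewrite dirichlet_closed; cbn [INR]; rewrite Rmult_0_l, cos_0; ring.
- cbn [sum_f_R0]; rewrite Rmult_plus_distr_l, IH, dirichlet_closed; ring.
Qed.

Lemma cos_mult_of_cos1 (n : nat) (u : R) : cos u = 1 -> cos (INR n * u) = 1 /\ sin (INR n * u) = 0.
Proof.
intros H.
assert (Hs : sin u = 0).
{ pose proof (sin2_cos2 u) as E; rewrite H in E; unfold Rsqr in E.
  apply Rsqr_0_uniq; unfold Rsqr; lra. }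
induction n as [|n [IH1 IH2]].
- cbn [INR]; rewrite Rmult_0_l, cos_0, sin_0; auto.
- rewrite S_INR, Rmult_plus_distr_r, Rmult_1_l, cos_plus, sin_plus, IH1, IH2, H, Hs; lra.
Qed.

Lemma fejer_nonneg (N : nat) (u : R) : 0 <= fejer N u.
Proof.
pose proof (COS_bound u) as [_ Hu].
destruct (Req_dec (cos u) 1) as [E|E].
(* Here the closed form reads 0 = 0; instead all cosines equal 1. *)
- unfold fejer; apply cond_pos_sum; intros n.
  induction n as [|n IH]; cbn [dirichlet]; [lra|].
  rewrite (proj1 (cos_mult_of_cos1 (S n) u E)); lra.
- pose proof (fejer_closed N u) as H; pose proof (COS_bound (INR (S N) * u)) as [_ HN].
  apply (Rmult_le_reg_l (1 - cos u)); [lra|]; rewrite H, Rmult_0_r; lra.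
Qed.

Lemma cos_scal_continuous (c u : R) : continuous (fun u => cos (c * u)) u.
Proof. apply (ex_derive_continuous (V := R_NormedModule)); auto_derive; exact I. Qed.

Lemma dirichlet_continuous (n : nat) (u : R) : continuous (dirichlet n) u.
Proof.
induction n as [|n IH]; cbn [dirichlet].
- apply continuous_const.
- apply (continuous_plus (V := R_NormedModule) (dirichlet n)); [exact IH|].
  apply (continuous_scal_r (V := R_NormedModule)), cos_scal_continuous.
Qed.

Lemma fejer_continuous (N : nat) (u : R) : continuous (fejer N) u.
Proof.
unfold fejer; induction N as [|N IH]; cbn [sum_f_R0]; [apply dirichlet_continuous|].
apply (continuous_plus (V := R_NormedModule) (fun u => sum_f_R0 (fun n => dirichlet n u) N));
  [exact IH|apply dirichlet_continuous].
Qed.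

Section Fejer.

Variables (l s0 : R).
Hypothesis hl : 0 < l.

(** Angle per unit of arclength: the perimeter 3 l is one full turn. *)
Let theta := 2 * PI / (3 * l).

(* Integration over the perimeter, with [a] on the central side, [b] on the next one
   and [d] on the previous one, against [phi] of the angle measured from [s0]. *)
Definition perimeter_integral (a b d phi : R -> R) : R :=
  RInt (fun s => a s * phi (theta * (s - s0)) + b s * phi (theta * (s + l - s0))
               + d s * phi (theta * (s - l - s0))) (- (l / 2)) (l / 2).

Let J := perimeter_integral.

Local Lemma J_ex a b d phi : (forall s, continuous a s) -> (forall s, continuous b s) ->
  (forall s, continuous d s) -> (forall u, continuous phi u) ->
  ex_RInt (fun s => a s * phi (theta * (s - s0)) + b s * phi (theta * (s + l - s0))
               + d s * phi (theta * (s - l - s0))) (- (l / 2)) (l / 2).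
Proof.
intros ca cb cd cp; apply (ex_RInt_continuous (V := R_CompleteNormedModule)); intros s _.
assert (K : forall (g : R -> R) x, (forall s, continuous g s) ->
  continuous (fun s => g s * phi (theta * (s + x))) s).
{ intros g x cg; apply (continuous_mult (K := R_AbsRing)); [apply cg|].
  apply (continuous_comp (fun s => theta * (s + x)) phi); [|apply cp].
  apply (ex_derive_continuous (V := R_NormedModule)); auto_derive; exact I. }
apply (continuous_ext (fun s => a s * phi (theta * (s + - s0)) + b s * phi (theta * (s + (l - s0)))
               + d s * phi (theta * (s + (- l - s0))))).
{ intros t; replace (t + - s0) with (t - s0) by ring.
  replace (t + (l - s0)) with (t + l - s0) by ring.
  replace (t + (- l - s0)) with (t - l - s0) by ring; reflexivity. }
exact (continuous_plus (V := R_NormedModule) _ _ s (continuous_plus (V := R_NormedModule) _ _ s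
  (K a _ ca) (K b _ cb)) (K d _ cd)).
Qed.

Section Data.

Variables a b d : R -> R.
Hypothesis ca : forall s, continuous a s.
Hypothesis cb : forall s, continuous b s.
Hypothesis cd : forall s, continuous d s.

Lemma perimeter_integral_plus phi psi c : (forall u, continuous phi u) -> (forall u, continuous psi u) ->
  J a b d (fun u => phi u + c * psi u) = J a b d phi + c * J a b d psi.
Proof.
intros cp cq; unfold J, perimeter_integral.
pose proof (J_ex a b d phi ca cb cd cp) as E1; pose proof (J_ex a b d psi ca cb cd cq) as E2.
transitivity (1 * RInt (fun s => a s * phi (theta * (s - s0)) + b s * phi (theta * (s + l - s0))
               + d s * phi (theta * (s - l - s0))) (- (l / 2)) (l / 2)
  + c * RInt (fun s => a s * psi (theta * (s - s0)) + b s * psi (theta * (s + l - s0))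
               + d s * psi (theta * (s - l - s0))) (- (l / 2)) (l / 2)
  + 0 * RInt (fun s => a s * phi (theta * (s - s0)) + b s * phi (theta * (s + l - s0))
               + d s * phi (theta * (s - l - s0))) (- (l / 2)) (l / 2)
  + 0 * RInt (fun s => a s * phi (theta * (s - s0)) + b s * phi (theta * (s + l - s0))
               + d s * phi (theta * (s - l - s0))) (- (l / 2)) (l / 2)); [|ring].
rewrite <- RInt_lin4 by assumption.
apply RInt_ext_real; [lra|]; intros s _; ring.
Qed.

Variable A : nat -> R.
Hypothesis A0 : A 0 = J a b d (fun _ => 1).
Hypothesis AS : forall m, A (S m) = 2 * J a b d (fun u => cos (INR (S m) * u)).

(** [A] groups the Fourier terms of index m and - m at s0, so its partial sums are symmetric and
    bring in the Dirichlet kernel. *)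
Local Lemma partial_dirichlet n : sum_f_R0 A n = J a b d (dirichlet n).
Proof.
induction n as [|n IH]; cbn [sum_f_R0]; [exact A0|].
rewrite IH, AS; symmetry; apply (perimeter_integral_plus (dirichlet n) (fun u => cos (INR (S n) * u)) 2).
- apply dirichlet_continuous.
- intros u; apply cos_scal_continuous.
Qed.

Local Lemma partial_fejer N : sum_f_R0 (sum_f_R0 A) N = J a b d (fejer N).
Proof.
induction N as [|N IH]; cbn [sum_f_R0].
- exact (partial_dirichlet 0).
- rewrite IH; change (sum_f_R0 A N + A (S N)) with (sum_f_R0 A (S N)).
  rewrite partial_dirichlet.
  transitivity (J a b d (fun u => fejer N u + 1 * dirichlet (S N) u)).
  + rewrite perimeter_integral_plus; [ring|apply fejer_continuous|apply dirichlet_continuous].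
  + unfold J, perimeter_integral, fejer; apply RInt_ext_real; [lra|]; intros s _.
    cbn [sum_f_R0]; ring.
Qed.

End Data.

(** The primitives on the three sides agree at the shared corners, and the two outer ends are a full
    period 3 l apart. *)
Local Lemma J1_cos m : J (fun _ => 1) (fun _ => 1) (fun _ => 1) (fun u => cos (INR (S m) * u)) = 0.
Proof.
pose proof PI_RGT_0 as Hpi.
assert (Ht : 0 < theta) by (apply Rdiv_lt_0_compat; lra).
assert (Hm : 0 < INR (S m)) by apply lt_0_INR, Nat.lt_0_succ.
set (w := INR (S m) * theta).
assert (Hw : 0 < w) by (apply Rmult_lt_0_compat; assumption).
unfold J, perimeter_integral; apply is_RInt_unique.
set (P := fun s => (sin (w * (s - s0)) + sin (w * (s + l - s0)) + sin (w * (s - l - s0))) / w).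
replace 0 with (P (l / 2) - P (- (l / 2))).
- apply (is_RInt_derive (V := R_CompleteNormedModule) P).
  + intros s _.
    assert (Ew : forall x, INR (S m) * (theta * x) = w * x) by (intros; unfold w; ring).
    rewrite !Ew; unfold P; auto_derive; [exact I|unfold Rminus; field; lra].
  + intros s _; apply (ex_derive_continuous (V := R_NormedModule)); auto_derive; exact I.
- unfold P.
  replace (w * (- (l / 2) + l - s0)) with (w * (l / 2 - s0)) by field.
  replace (w * (l / 2 - l - s0)) with (w * (- (l / 2) - s0)) by field.
  replace (w * (l / 2 + l - s0)) with (w * (- (l / 2) - l - s0) + 2 * INR (S m) * PI).
  + rewrite sin_period; field; lra.
  + unfold w, theta; field; lra.
Qed.

(** Mass of the unnormalised kernel: the constant 1 has only a zeroth coefficient, counted N + 1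
    times. *)
Local Lemma J1_fejer N : J (fun _ => 1) (fun _ => 1) (fun _ => 1) (fejer N) = 3 * l * INR (S N).
Proof.
set (A := fun m : nat => match m with O => 3 * l | S _ => 0 end).
assert (C1 : forall s : R, continuous (fun _ : R => 1) s) by (intros; apply continuous_const).
rewrite <- (partial_fejer (fun _ => 1) (fun _ => 1) (fun _ => 1) C1 C1 C1 A).
- assert (HA : forall n, sum_f_R0 A n = 3 * l).
  { intros n; induction n as [|n IH]; cbn [sum_f_R0]; [reflexivity|rewrite IH; cbn; ring]. }
  induction N as [|N IH]; [cbn; ring|].
  cbn [sum_f_R0] in *; rewrite IH; change (sum_f_R0 A N + A (S N)) with (sum_f_R0 A (S N)).
  rewrite HA, (S_INR (S N)); ring.
- cbn [A]; unfold J, perimeter_integral.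
  rewrite (RInt_ext_real _ (fun _ => 3)) by (try lra; intros; ring).
  rewrite RInt_const; transitivity ((l / 2 - - (l / 2)) * 3); [field|reflexivity].
- intros m; rewrite J1_cos; cbn; ring.
Qed.

(** The oscillation bound is shaped for the kernel: since (1 - cos u) times [fejer N u] is at most
    2, the K part integrates to a quantity independent of N, negligible against N + 1. The perimeter
    need not be split into near and far parts. *)
Lemma fejer_limit (a b d : R -> R) (a0 sigma : R) (A : nat -> R) :
  (forall s, continuous a s) -> (forall s, continuous b s) -> (forall s, continuous d s) ->
  (forall eps, 0 < eps -> exists K, 0 <= K /\ forall s, - (l / 2) <= s <= l / 2 ->
    Rabs (a s - a0) <= eps + K * (1 - cos (theta * (s - s0))) /\
    Rabs (b s - a0) <= eps + K * (1 - cos (theta * (s + l - s0))) /\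
    Rabs (d s - a0) <= eps + K * (1 - cos (theta * (s - l - s0)))) ->
  A 0%nat = perimeter_integral a b d (fun _ => 1) ->
  (forall m, A (S m) = 2 * perimeter_integral a b d (fun u => cos (INR (S m) * u))) ->
  Un_cv (sum_f_R0 A) sigma -> sigma = 3 * l * a0.
Proof.
intros ca cb cd Hosc A0 AS Hcv.
assert (C1 : forall s : R, continuous (fun _ : R => 1) s) by (intros; apply continuous_const).
assert (Hb : forall eps, 0 < eps -> exists K, 0 <= K /\ forall N,
  Rabs (sum_f_R0 (sum_f_R0 A) N / INR (S N) - 3 * l * a0) <= 3 * l * eps + K / INR (S N)).
{ intros eps Heps; destruct (Hosc eps Heps) as [K [HK H]].
  (* 2 K from each of the three sides, integrated over a length l. *)
  exists (6 * K * l); split; [nra|]; intros N.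
  assert (HN : 0 < INR (S N)) by apply lt_0_INR, Nat.lt_0_succ.
  rewrite (partial_fejer a b d ca cb cd A A0 AS N).
  pose proof (J_ex a b d _ ca cb cd (fejer_continuous N)) as E1.
  pose proof (J_ex _ _ _ _ C1 C1 C1 (fejer_continuous N)) as E2.
  pose proof (J1_fejer N) as E3; unfold J, perimeter_integral in E3 |- *.
  set (g := fun s => a s * fejer N (theta * (s - s0)) + b s * fejer N (theta * (s + l - s0))
               + d s * fejer N (theta * (s - l - s0))) in *.
  set (o := fun s => 1 * fejer N (theta * (s - s0)) + 1 * fejer N (theta * (s + l - s0))
               + 1 * fejer N (theta * (s - l - s0))) in *.
  assert (E4 : ex_RInt (fun _ : R => 1) (- (l / 2)) (l / 2)) by apply ex_RInt_const.
  assert (B1 : Rabs (RInt (fun s => 1 * g s + - a0 * o s + 0 * o s + 0 * o s) (- (l / 2)) (l / 2))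
    <= RInt (fun s => eps * o s + 6 * K * 1 + 0 * 1 + 0 * 1) (- (l / 2)) (l / 2)).
  { assert (Eg : ex_RInt (fun s => 1 * g s + - a0 * o s + 0 * o s + 0 * o s) (- (l / 2)) (l / 2)).
    { eexists; apply (is_RInt_lin4 g o o o); apply (RInt_correct (V := R_CompleteNormedModule)); assumption. }
    assert (Eo : ex_RInt (fun s => eps * o s + 6 * K * 1 + 0 * 1 + 0 * 1) (- (l / 2)) (l / 2)).
    { eexists; apply (is_RInt_lin4 o (fun _ => 1) (fun _ => 1) (fun _ => 1));
        apply (RInt_correct (V := R_CompleteNormedModule)); assumption. }
    eapply Rle_trans; [apply abs_RInt_le; [lra|exact Eg]|].
    apply RInt_le; [lra| |exact Eo|].
    - exact (ex_RInt_norm _ _ _ Eg).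
    - intros s Hs; destruct (H s ltac:(lra)) as (h1 & h2 & h3).
      assert (Kb : forall x u, Rabs (x - a0) <= eps + K * (1 - cos u) ->
        Rabs ((x - a0) * fejer N u) <= eps * fejer N u + 2 * K).
      { intros x u Hx; pose proof (fejer_nonneg N u) as Hf.
        rewrite Rabs_mult, (Rabs_right (fejer N u)) by lra.
        pose proof (fejer_closed N u) as Hc; pose proof (COS_bound (INR (S N) * u)).
        eapply Rle_trans; [apply Rmult_le_compat_r; [exact Hf|exact Hx]|].
        replace ((eps + K * (1 - cos u)) * fejer N u) with
          (eps * fejer N u + K * ((1 - cos u) * fejer N u)) by ring.
        rewrite Hc; nra. }
      apply Kb in h1, h2, h3; unfold g, o.
      match goal with |- Rabs ?x <= _ => replace x with
        ((a s - a0) * fejer N (theta * (s - s0)) + (b s - a0) * fejer N (theta * (s + l - s0))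
         + (d s - a0) * fejer N (theta * (s - l - s0))) by ring end.
      eapply Rle_trans; [apply Rabs_triang|].
      eapply Rle_trans; [apply Rplus_le_compat_r, Rabs_triang|]; lra. }
  rewrite !RInt_lin4 in B1 by assumption.
  assert (E5 : RInt (fun _ : R => 1) (- (l / 2)) (l / 2) = l).
  { rewrite RInt_const; change ((l / 2 - - (l / 2)) * 1 = l :> R); field. }
  rewrite E3, E5 in B1.
  set (G := RInt g _ _) in *.
  apply (Rmult_le_reg_r (INR (S N))); [exact HN|].
  rewrite <- (Rabs_right (INR (S N))) at 2 by lra; rewrite <- Rabs_mult.
  replace ((G / INR (S N) - 3 * l * a0) * INR (S N)) with (G - 3 * l * a0 * INR (S N)) by (field; lra).
  replace ((3 * l * eps + 6 * K * l / INR (S N)) * INR (S N)) with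
    (3 * l * eps * INR (S N) + 6 * K * l) by (field; lra).
  match type of B1 with Rabs ?x <= ?y => replace x with (G - 3 * l * a0 * INR (S N)) in B1 by ring;
    replace y with (3 * l * eps * INR (S N) + 6 * K * l) in B1 by field end.
  exact B1. }
(* A convergent series has Cesaro means tending to its sum, so the limit just estimated must be
   sigma. *)
pose proof (Cesaro_1 _ _ Hcv) as Hces.
apply Rminus_diag_uniq, Rabs_eq_0, Rle_antisym; [|apply Rabs_pos].
apply le_epsilon; intros e He; rewrite Rplus_0_l.
assert (He1 : 0 < e / (9 * l)) by (apply Rdiv_lt_0_compat; lra).
destruct (Hb _ He1) as [K [HK HKN]].
destruct (Hces (e / 3) ltac:(lra)) as [N1 HN1].
destruct (INR_unbounded (3 * (K + 1) / e)) as [N2 HN2].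
set (N := max N1 N2).
specialize (HN1 (S N) ltac:(unfold N; lia)); specialize (HKN N).
cbn [Nat.pred] in HN1; unfold Rdist in HN1.
assert (HN : INR N2 <= INR (S N)) by (apply le_INR; unfold N; lia).
assert (HNp : 0 < INR (S N)) by apply lt_0_INR, Nat.lt_0_succ.
assert (Hsm : K / INR (S N) <= e / 3).
{ apply (Rmult_le_reg_r (INR (S N))); [exact HNp|].
  replace (K / INR (S N) * INR (S N)) with K by (field; lra).
  assert (h : 3 * (K + 1) / e < INR (S N)) by lra.
  apply (Rmult_lt_compat_r e) in h; [|exact He].
  replace (3 * (K + 1) / e * e) with (3 * (K + 1)) in h by (field; lra).
  lra. }
replace (3 * l * (e / (9 * l))) with (e / 3) in HKN by (field; lra).
apply Rabs_lt_between in HN1; apply Rabs_le_between in HKN.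
apply Rabs_le; lra.
Qed.

End Fejer.

(** * Bilateral series *)

(** The conventional value at n = 0 is dropped first; the rest is compared with the telescoping
    series of 2 / ((n + 1) (n + 2)). *)
Lemma ex_series_inv_sq : ex_series (fun n => / (INR n * INR n)).
Proof.
apply (ex_series_incr_1 (fun n => / (INR n * INR n))).
apply (ex_series_le (V := R_CompleteNormedModule) _
  (fun n => 2 * (/ (INR n + 1) - / (INR n + 2)))).
- intros n; pose proof (pos_INR n) as Hn; rewrite S_INR.
  change (norm (/ ((INR n + 1) * (INR n + 1)))) with (Rabs (/ ((INR n + 1) * (INR n + 1)))).
  rewrite Rabs_right by (apply Rle_ge, Rlt_le, Rinv_0_lt_compat; nra).
  replace (2 * (/ (INR n + 1) - / (INR n + 2))) with (/ ((INR n + 1) * (INR n + 2) / 2))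
    by (field; lra).
  apply Rinv_le_contravar; nra.
- apply (ex_series_scal (V := R_NormedModule) 2); exists 1.
  apply is_series_Reals; apply is_lim_seq_Reals.
  apply is_lim_seq_ext with (fun n => 1 - / INR (n + 2)).
  + intros n; induction n as [|n IH]; cbn [sum_f_R0].
    * cbn; field.
    * rewrite <- IH, !plus_INR, S_INR; pose proof (pos_INR n); cbn [INR]; field; lra.
  + replace 1 with (1 - 0) at 1 by ring; apply is_lim_seq_minus'; [apply is_lim_seq_const|].
    apply (is_lim_seq_incr_n (fun n => / INR n) 2).
    apply (is_lim_seq_inv INR p_infty); [apply is_lim_seq_INR|discriminate].
Qed.

Lemma ex_series_sq_bound (v : nat -> R) (K B : R) :
  (forall n, B <= INR n -> Rabs (v n) <= K * / (INR n * INR n)) -> ex_series v.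
Proof.
intros H; destruct (INR_unbounded B) as [N HN].
apply (ex_series_incr_n v N).
apply (ex_series_le (V := R_CompleteNormedModule) _ (fun n => K * / (INR (N + n) * INR (N + n)))).
- intros n; apply H; rewrite plus_INR; pose proof (pos_INR n); lra.
- apply (ex_series_scal (V := R_NormedModule) K).
  apply (ex_series_incr_n (fun n => / (INR n * INR n)) N), ex_series_inv_sq.
Qed.

(** Reconciles two groupings of one summable family: the theorem groups by residues modulo 3 with
    independent limits, while Fejer summation needs the symmetric partial sums. *)
Lemma bilateral_real (r : Z -> R) (K B : R) : 0 <= K ->
  (forall m, B <= Rabs (IZR m) -> Rabs (r m) <= K / (IZR m * IZR m)) ->
  let g n := r (3 * n)%Z + r (3 * n - 1)%Z + r (3 * n - 2)%Z in
  exists x y z,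
    is_series (fun n => g (Z.of_nat n)) x /\
    is_series (fun n => g (- Z.of_nat (S n))%Z) y /\
    Un_cv (sum_f_R0 (fun m => match m with
      | O => r 0%Z | S _ => r (Z.of_nat m) + r (- Z.of_nat m)%Z end)) z /\
    x + y = z.
Proof.
intros HK H g.
assert (Hr : forall (m : Z) (n : nat), (0 < n)%nat -> B <= INR n -> (Z.of_nat n <= Z.abs m)%Z ->
  Rabs (r m) <= K * / (INR n * INR n)).
{ intros m n Hn HB Hm.
  assert (h0 : 0 < INR n) by (apply lt_0_INR; lia).
  assert (h : INR n <= Rabs (IZR m)) by (rewrite INR_IZR_INZ, <- abs_IZR; apply IZR_le, Hm).
  eapply Rle_trans; [apply H; lra|]; unfold Rdiv; apply Rmult_le_compat_l; [exact HK|].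
  replace (IZR m * IZR m) with (Rabs (IZR m) * Rabs (IZR m))
    by (rewrite <- Rabs_mult; apply Rabs_right; nra).
  apply Rinv_le_contravar; nra. }
set (B' := Rmax B 1).
assert (HB' : forall n, B' <= INR n -> (0 < n)%nat /\ B <= INR n).
{ intros n Hn; pose proof (Rmax_l B 1); pose proof (Rmax_r B 1); unfold B' in Hn; split; [|lra].
  apply INR_lt; cbn; lra. }
assert (E1 : ex_series (fun n => g (Z.of_nat n))).
{ apply (ex_series_sq_bound _ (3 * K) B'); intros n Hn; destruct (HB' n Hn) as [h1 h2]; unfold g.
  pose proof (Hr (3 * Z.of_nat n)%Z n h1 h2 ltac:(lia)).
  pose proof (Hr (3 * Z.of_nat n - 1)%Z n h1 h2 ltac:(lia)).
  pose proof (Hr (3 * Z.of_nat n - 2)%Z n h1 h2 ltac:(lia)).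
  eapply Rle_trans; [apply Rabs_triang|].
  eapply Rle_trans; [apply Rplus_le_compat_r, Rabs_triang|]; lra. }
assert (E2 : ex_series (fun n => g (- Z.of_nat (S n))%Z)).
{ apply (ex_series_sq_bound _ (3 * K) B'); intros n Hn; destruct (HB' n Hn) as [h1 h2]; unfold g.
  pose proof (Hr (3 * - Z.of_nat (S n))%Z n h1 h2 ltac:(lia)).
  pose proof (Hr (3 * - Z.of_nat (S n) - 1)%Z n h1 h2 ltac:(lia)).
  pose proof (Hr (3 * - Z.of_nat (S n) - 2)%Z n h1 h2 ltac:(lia)).
  eapply Rle_trans; [apply Rabs_triang|].
  eapply Rle_trans; [apply Rplus_le_compat_r, Rabs_triang|]; lra. }
set (A := fun m : nat => match m with
      | O => r 0%Z | S _ => r (Z.of_nat m) + r (- Z.of_nat m)%Z end).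
assert (E3 : ex_series A).
{ apply (ex_series_sq_bound _ (2 * K) B'); intros n Hn; destruct (HB' n Hn) as [h1 h2].
  destruct n as [|n]; [lia|]; unfold A.
  pose proof (Hr (Z.of_nat (S n))%Z (S n) h1 h2 ltac:(lia)).
  pose proof (Hr (- Z.of_nat (S n))%Z (S n) h1 h2 ltac:(lia)).
  eapply Rle_trans; [apply Rabs_triang|]; lra. }
assert (E4 : is_lim_seq (fun n => r (- Z.of_nat n)%Z) 0).
{ apply ex_series_lim_0, (ex_series_sq_bound _ K B'); intros n Hn; destruct (HB' n Hn) as [h1 h2].
  apply Hr; [exact h1|exact h2|lia]. }
destruct E1 as [x Hx], E2 as [y Hy], E3 as [z Hz].
exists x, y, z; split; [exact Hx|split; [exact Hy|]].
apply is_series_Reals in Hx, Hy, Hz; apply is_lim_seq_Reals in Hx, Hy, Hz.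
split; [apply is_lim_seq_Reals, Hz|].
assert (Hsub : forall i : nat, filterlim (fun M => (3 * M + i)%nat) eventually eventually).
{ intros i P [N HN]; exists N; intros n Hn; apply HN; lia. }
assert (Htail : forall i : nat, is_lim_seq (fun M => r (- Z.of_nat (3 * M + i))%Z) 0).
{ intros i; apply (is_lim_seq_subseq (fun n => r (- Z.of_nat n)%Z) 0 _ (Hsub i) E4). }
assert (HzM : is_lim_seq (fun M => sum_f_R0 A (3 * M + 0)) z)
  by exact (is_lim_seq_subseq (sum_f_R0 A) z _ (Hsub 0%nat) Hz).
(* The left side runs over the indices from -3 M - 5 to 3 M, the symmetric sum from -3 M to 3 M:
   five vanishing terms make the difference. *)
assert (E : forall M : nat, sum_f_R0 (fun n => g (Z.of_nat n)) M
    + sum_f_R0 (fun n => g (- Z.of_nat (S n))%Z) M =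
  sum_f_R0 A (3 * M + 0) + r (- Z.of_nat (3 * M + 1))%Z + r (- Z.of_nat (3 * M + 2))%Z
    + r (- Z.of_nat (3 * M + 3))%Z + r (- Z.of_nat (3 * M + 4))%Z + r (- Z.of_nat (3 * M + 5))%Z).
{ intros M; induction M as [|M IH].
  - cbn; unfold g; cbn; ring.
  - replace (3 * S M + 0)%nat with (S (S (S (3 * M + 0)))) by lia.
    cbn [sum_f_R0]; unfold A at 2 3 4.
    replace (Z.of_nat (S (S (S (3 * M + 0))))) with (3 * Z.of_nat (S M))%Z by lia.
    replace (Z.of_nat (S (S (3 * M + 0)))) with (3 * Z.of_nat (S M) - 1)%Z by lia.
    replace (Z.of_nat (S (3 * M + 0))) with (3 * Z.of_nat (S M) - 2)%Z by lia.
    replace (3 * S M + 1)%nat with (3 * M + 4)%nat by lia.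
    replace (3 * S M + 2)%nat with (3 * M + 5)%nat by lia.
    replace (- Z.of_nat (3 * S M + 3))%Z with (3 * - Z.of_nat (S (S M)))%Z by lia.
    replace (- Z.of_nat (3 * S M + 4))%Z with (3 * - Z.of_nat (S (S M)) - 1)%Z by lia.
    replace (- Z.of_nat (3 * S M + 5))%Z with (3 * - Z.of_nat (S (S M)) - 2)%Z by lia.
    replace (- (3 * Z.of_nat (S M)))%Z with (- Z.of_nat (3 * M + 3))%Z by lia.
    replace (- (3 * Z.of_nat (S M) - 1))%Z with (- Z.of_nat (3 * M + 2))%Z by lia.
    replace (- (3 * Z.of_nat (S M) - 2))%Z with (- Z.of_nat (3 * M + 1))%Z by lia.
    unfold g at 2 4; lra. }
pose proof (is_lim_seq_plus' _ _ _ _ Hx Hy) as L1.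
apply (is_lim_seq_ext _ _ _ E) in L1.
pose proof (is_lim_seq_plus' _ _ _ _ (is_lim_seq_plus' _ _ _ _ (is_lim_seq_plus' _ _ _ _
  (is_lim_seq_plus' _ _ _ _ (is_lim_seq_plus' _ _ _ _ HzM (Htail 1%nat)) (Htail 2%nat))
  (Htail 3%nat)) (Htail 4%nat)) (Htail 5%nat)) as L2.
apply is_lim_seq_unique in L1, L2; rewrite L1 in L2; injection L2; lra.
Qed.

Lemma is_series_pair (a : nat -> C) (x y : R) :
  is_series (fun n => Re (a n)) x -> is_series (fun n => Im (a n)) y ->
  is_series (V := C_R_NormedModule) a (x, y).
Proof.
intros Hx Hy; unfold is_series in *.
apply (filterlim_ext (fun n => (sum_n (fun n => Re (a n)) n, sum_n (fun n => Im (a n)) n))).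
- intros n; induction n as [|n IH].
  + rewrite !sum_O; symmetry; apply surjective_pairing.
  + rewrite !sum_Sn, <- IH; reflexivity.
- intros P [e He].
  pose proof (Hx _ (locally_ball x e)) as h1; pose proof (Hy _ (locally_ball y e)) as h2.
  destruct h1 as [N1 H1], h2 as [N2 H2]; exists (max N1 N2); intros n Hn.
  apply He; split; [apply H1|apply H2]; lia.
Qed.

(** * Oscillation along the perimeter *)

(** 4 PI / 3 is the angle of the largest offset 2 l between two parameters on the unrolled
    perimeter. It lies 2 PI / 3 short of a full turn, whence the bound on d. *)
Lemma cos_away (d u : R) : 0 < d <= 2 * PI / 3 -> d <= Rabs u <= 4 * PI / 3 ->
  cos u <= cos d < 1.
Proof.
intros Hd Hu; pose proof PI_RGT_0 as Hpi; split.
- assert (E : cos u = cos (Rabs u)).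
  { unfold Rabs; destruct Rcase_abs; [symmetry; apply cos_neg|reflexivity]. }
  rewrite E; destruct (Rle_dec (Rabs u) PI) as [h|h].
  + apply cos_decr_1; lra.
  + replace (cos (Rabs u)) with (cos (2 * PI - Rabs u)).
    * apply cos_decr_1; lra.
    * rewrite cos_minus, cos_2PI, sin_2PI; ring.
- rewrite <- cos_0; apply cos_decreasing_1; lra.
Qed.

Lemma side_step (l : R) (i : side) (s t : R) :
  Rabs (side_x l i s - side_x l i t) <= Rabs (s - t) /\ Rabs (side_y l i s - side_y l i t) <= Rabs (s - t).
Proof.
pose proof (normal_unit i) as H; unfold side_x, side_y.
assert (Hx : Rabs (nx i) <= 1) by (apply Rabs_le; nra).
assert (Hy : Rabs (ny i) <= 1) by (apply Rabs_le; nra).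
replace (apothem l * nx i - s * ny i - (apothem l * nx i - t * ny i)) with (- ((s - t) * ny i)) by ring.
replace (apothem l * ny i + s * nx i - (apothem l * ny i + t * nx i)) with ((s - t) * nx i) by ring.
rewrite Rabs_Ropp, !Rabs_mult; pose proof (Rabs_pos (s - t)); split; nra.
Qed.

(** Go through the common corner: the displacement is at most the arclength of the path. *)
Lemma perimeter_step (l : R) (j : side) (s t : R) :
  - (l / 2) <= s <= l / 2 -> - (l / 2) <= t <= l / 2 ->
  Rabs (side_x l (next j) s - side_x l j t) <= s + l - t /\
  Rabs (side_y l (next j) s - side_y l j t) <= s + l - t.
Proof.
intros Hs Ht; destruct (corner l j) as [ex ey].
destruct (side_step l (next j) s (- (l / 2))) as [h1 h2].
destruct (side_step l j (l / 2) t) as [h3 h4].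
rewrite (Rabs_right (s - - (l / 2))) in h1, h2 by lra.
rewrite (Rabs_right (l / 2 - t)) in h3, h4 by lra.
rewrite ex in h1; rewrite ey in h2.
apply Rabs_le_between in h1, h2, h3, h4; split; apply Rabs_le; lra.
Qed.

Section Oscillation.

Variables (l : R) (q : R -> R -> R).
Hypothesis hl : 0 < l.
Hypothesis hq_cont : continuous_on_closed_triangle l q.

Definition boundary_value (j : side) (s : R) : R :=
  side_value l q j (clamp (- (l / 2)) (l / 2) s).

Lemma boundary_modulus (j : side) (s0 eps : R) : - (l / 2) <= s0 <= l / 2 -> 0 < eps ->
  exists d, 0 < d /\ forall i s, - (l / 2) <= s <= l / 2 ->
    Rabs (side_x l i s - side_x l j s0) < d -> Rabs (side_y l i s - side_y l j s0) < d ->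
    Rabs (side_value l q i s - side_value l q j s0) < eps.
Proof.
intros Hs0 He.
destruct (within_eps _ _ _ _ (hq_cont _ (side_in_closed l j s0 hl Hs0)) (mkposreal eps He))
  as [d Hd]; cbn [pos] in Hd.
exists d; split; [apply cond_pos|]; intros i s Hs hx hy.
unfold side_value; rewrite !side_pointE.
apply (Hd (side_x l i s) (side_y l i s) hx hy), side_in_closed; assumption.
Qed.

Lemma boundary_value_continuous (j : side) (s : R) : continuous (boundary_value j) s.
Proof.
assert (Hh : - (l / 2) <= l / 2) by lra.
apply continuity_pt_filterlim; intros eps He.
destruct (boundary_modulus j _ eps (clamp_in _ _ s Hh) He) as [d [Hd H]].
destruct (clamp_cont _ _ s Hh d Hd) as [e [He' H']].
exists e; split; [exact He'|]; intros t Ht; specialize (H' t Ht).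
cbn in H' |- *; unfold Rdist in *.
destruct (side_step l j (clamp (- (l / 2)) (l / 2) t) (clamp (- (l / 2)) (l / 2) s)) as [h1 h2].
apply H; [apply clamp_in, Hh|lra|lra].
Qed.

(** Near s0 continuity in the closed triangle, corners included, gives eps. Far from it 1 - cos is
    at least some eta > 0, and K = 2 M / eta absorbs the crude bound 2 M. *)
Lemma perimeter_oscillation (j : side) (s0 eps : R) : - (l / 2) <= s0 <= l / 2 -> 0 < eps ->
  exists K, 0 <= K /\ forall s, - (l / 2) <= s <= l / 2 ->
    let theta := 2 * PI / (3 * l) in
    let a0 := side_value l q j s0 in
    Rabs (boundary_value j s - a0) <= eps + K * (1 - cos (theta * (s - s0))) /\
    Rabs (boundary_value (next j) s - a0) <= eps + K * (1 - cos (theta * (s + l - s0))) /\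
    Rabs (boundary_value (next (next j)) s - a0) <= eps + K * (1 - cos (theta * (s - l - s0))).
Proof.
intros Hs0 He; pose proof PI_RGT_0 as Hpi.
assert (Hh : - (l / 2) <= l / 2) by lra.
destruct (boundary_modulus j s0 eps Hs0 He) as [d [Hd H]].
assert (exists M, 0 <= M /\ forall i s, - (l / 2) <= s <= l / 2 -> Rabs (boundary_value i s) <= M)
  as [M [HM0 HM]].
{ destruct (continuous_bounded _ _ _ Hh (boundary_value_continuous side1)) as [M1 [h1 H1]].
  destruct (continuous_bounded _ _ _ Hh (boundary_value_continuous side2)) as [M2 [h2 H2]].
  destruct (continuous_bounded _ _ _ Hh (boundary_value_continuous side3)) as [M3 [h3 H3]].
  exists (M1 + M2 + M3); split; [lra|]; intros i s Hs.
  specialize (H1 s Hs); specialize (H2 s Hs); specialize (H3 s Hs); destruct i; lra. }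
set (theta := 2 * PI / (3 * l)).
assert (Ht : 0 < theta) by (apply Rdiv_lt_0_compat; lra).
(* The radius d as an angle, capped as [cos_away] requires. *)
set (d' := Rmin (theta * d) (2 * PI / 3)).
assert (Hd' : 0 < d' <= 2 * PI / 3).
{ split; [apply Rmin_pos; [apply Rmult_lt_0_compat; assumption|lra]|apply Rmin_r]. }
set (eta := 1 - cos d').
assert (Heta : 0 < eta).
{ destruct (cos_away d' d' Hd') as [_ h]; [rewrite Rabs_right; lra|unfold eta; lra]. }
exists (2 * M / eta); split; [apply Rdiv_le_0_compat; lra|].
intros s Hs th a0; change th with theta; clear th.
assert (Ea0 : a0 = boundary_value j s0) by (unfold boundary_value; rewrite clamp_id by exact Hs0; reflexivity).
assert (Key : forall i tau, Rabs tau <= 2 * l ->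
  Rabs (side_x l i s - side_x l j s0) <= Rabs tau -> Rabs (side_y l i s - side_y l j s0) <= Rabs tau ->
  Rabs (boundary_value i s - a0) <= eps + 2 * M / eta * (1 - cos (theta * tau))).
{ intros i tau Ht2 hx hy.
  assert (Hnn : 0 <= 2 * M / eta) by (apply Rdiv_le_0_compat; lra).
  destruct (Rlt_dec (Rabs tau) d) as [Hlt|Hge].
  - assert (h : Rabs (boundary_value i s - a0) < eps).
    { unfold boundary_value; rewrite clamp_id by exact Hs; apply H; [exact Hs|lra|lra]. }
    pose proof (COS_bound (theta * tau)); nra.
  - assert (Hc : cos (theta * tau) <= cos d').
    { apply cos_away; [exact Hd'|]; rewrite Rabs_mult, (Rabs_right theta) by lra; split.
      - eapply Rle_trans; [apply Rmin_l|]; apply Rmult_le_compat_l; lra.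
      - replace (4 * PI / 3) with (theta * (2 * l)) by (unfold theta; field; lra).
        apply Rmult_le_compat_l; lra. }
    assert (h : Rabs (boundary_value i s - a0) <= 2 * M).
    { unfold Rminus; eapply Rle_trans; [apply Rabs_triang|]; rewrite Rabs_Ropp, Ea0.
      pose proof (HM i s Hs); pose proof (HM j s0 Hs0); lra. }
    assert (h2 : 2 * M / eta * eta = 2 * M) by (field; lra).
    assert (h3 : eta <= 1 - cos (theta * tau)) by (unfold eta; lra).
    nra. }
split; [|split].
- apply Key; [apply Rabs_le; lra|apply side_step|apply side_step].
- destruct (perimeter_step l j s s0 Hs Hs0) as [h1 h2].
  apply Key; rewrite (Rabs_right (s + l - s0)) by lra; lra.
(* [next] has order three, so [next (next j)] is the previous side; the step is taken from it to
   side j, with s and s0 exchanged. *)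
- destruct (perimeter_step l (next (next j)) s0 s Hs0 Hs) as [h1 h2].
  replace (next (next (next j))) with j in h1, h2 by (destruct j; reflexivity).
  rewrite Rabs_minus_sym in h1, h2.
  apply Key; rewrite (Rabs_left1 (s - l - s0)) by lra; lra.
Qed.

End Oscillation.

(** * The Fourier series of the boundary values *)

Lemma Cexp_line (mu s : R) :
  Re (Cexp ((0, mu) * RtoC s)%C) = cos (mu * s) /\ Im (Cexp ((0, mu) * RtoC s)%C) = sin (mu * s).
Proof.
unfold Cexp, Cmult, RtoC; cbn [fst snd Re Im].
replace (0 * s - mu * 0) with 0 by ring; replace (0 * 0 + mu * s) with (mu * s) by ring.
rewrite exp_0; split; ring.
Qed.

Lemma Cexp_unit (x : R) : Cexp (0, x) = (cos x, sin x).
Proof. unfold Cexp; cbn [fst snd Re Im]; rewrite exp_0; f_equal; ring. Qed.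

Lemma hat_phase (l mu x : R) (g : R -> R) : 0 < l -> (forall s, continuous g s) ->
  (Cexp (0%R, x) * hat l g (0%R, mu))%C =
  (RInt (fun s => g s * cos (mu * s + x)) (- (l / 2)) (l / 2),
   RInt (fun s => g s * sin (mu * s + x)) (- (l / 2)) (l / 2)).
Proof.
intros Hl Hg; destruct (hatE l g (0, mu) Hg) as (_ & E1 & E2 & ->).
rewrite Cexp_unit.
set (R1 := RInt (fun s => Re (Cexp ((0%R, mu) * RtoC s)%C) * g s) (- (l / 2)) (l / 2)).
set (R2 := RInt (fun s => Im (Cexp ((0%R, mu) * RtoC s)%C) * g s) (- (l / 2)) (l / 2)).
unfold Cmult; cbn [fst snd]; apply (f_equal2 (@pair R R)).
- transitivity (cos x * R1 + - sin x * R2 + 0 * R2 + 0 * R2); [ring|].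
  unfold R1, R2; rewrite <- RInt_lin4 by assumption.
  apply RInt_ext_real; [lra|]; intros s _; destruct (Cexp_line mu s) as [-> ->].
  rewrite cos_plus; ring.
- transitivity (cos x * R2 + sin x * R1 + 0 * R2 + 0 * R2); [ring|].
  unfold R1, R2; rewrite <- RInt_lin4 by assumption.
  apply RInt_ext_real; [lra|]; intros s _; destruct (Cexp_line mu s) as [-> ->].
  rewrite sin_plus; ring.
Qed.

(** The phase that moves the origin of arclength from the centre of side 1 to that of side j. Its
    values at m = 0, -1, -2 modulo 3 are 1, c_1 and c_2. *)
Definition side_phase (j : side) (m : Z) : C :=
  match j with
  | side1 => RtoC 1
  | side2 => CpowZ alpha m
  | side3 => CpowZ alphabar m
  end.

Lemma CpowZ_alpha (m : Z) :
  CpowZ alpha m = Cexp (0, 2 * PI / 3 * IZR m) /\ CpowZ alphabar m = Cexp (0, - (2 * PI / 3 * IZR m)).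
Proof.
unfold alpha, alphabar; rewrite !CpowZ_Cexp; unfold Cmult, RtoC; cbn [fst snd].
split; do 2 f_equal; ring.
Qed.

Lemma Cexp_period (x : R) (n : Z) : Cexp (0, x + 2 * PI * IZR n) = Cexp (0, x).
Proof.
replace (0, x + 2 * PI * IZR n) with ((0, x)%R + (0, 2 * PI * IZR n)%R)%C
  by (unfold Cplus; cbn; f_equal; ring).
rewrite Cexp_add, Cexp_2PI; ring.
Qed.

Lemma side_phase_residues (j : side) (n : Z) :
  side_phase j (3 * n) = RtoC 1 /\ side_phase j (3 * n - 1) = coef_c1 j /\
  side_phase j (3 * n - 2) = coef_c2 j.
Proof.
assert (E0 : Cexp (0, 0) = RtoC 1) by exact Cexp_0.
destruct j; cbn [side_phase coef_c1 coef_c2]; [auto| |].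
- rewrite !(fun m => proj1 (CpowZ_alpha m)), !minus_IZR, !mult_IZR; unfold alpha, alphabar.
  rewrite <- E0; repeat split.
  + replace (2 * PI / 3 * (3 * IZR n)) with (0 + 2 * PI * IZR n) by field; apply Cexp_period.
  + replace (2 * PI / 3 * (3 * IZR n - 1)) with (- (2 * PI / 3) + 2 * PI * IZR n) by field.
    apply Cexp_period.
  + replace (2 * PI / 3 * (3 * IZR n - 2)) with (2 * PI / 3 + 2 * PI * IZR (n - 1))
      by (rewrite minus_IZR; field).
    apply Cexp_period.
- rewrite !(fun m => proj2 (CpowZ_alpha m)), !minus_IZR, !mult_IZR; unfold alpha, alphabar.
  rewrite <- E0; repeat split.
  + replace (- (2 * PI / 3 * (3 * IZR n))) with (0 + 2 * PI * IZR (- n)) by (rewrite opp_IZR; field).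
    apply Cexp_period.
  + replace (- (2 * PI / 3 * (3 * IZR n - 1))) with (2 * PI / 3 + 2 * PI * IZR (- n))
      by (rewrite opp_IZR; field).
    apply Cexp_period.
  + replace (- (2 * PI / 3 * (3 * IZR n - 2))) with (- (2 * PI / 3) + 2 * PI * IZR (1 - n))
      by (rewrite minus_IZR; field).
    apply Cexp_period.
Qed.

(** Since alpha^(3 m) = 1, the phase permutes the three weights cyclically, and the sum now starts
    from side j. *)
Lemma side_phase_shift (j : side) (m : Z) (U : side -> C) :
  (side_phase j m * (U side1 + CpowZ alpha m * U side3 + CpowZ alphabar m * U side2))%C =
  (U j + CpowZ alpha m * U (next j) + CpowZ alphabar m * U (next (next j)))%C.
Proof.
destruct (CpowZ_alpha m) as [Ea Eb].
assert (ab : (CpowZ alpha m * CpowZ alphabar m)%C = RtoC 1).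
{ rewrite Ea, Eb, <- Cexp_add, <- Cexp_0; f_equal; unfold Cplus, RtoC; cbn; f_equal; ring. }
assert (aa : (CpowZ alpha m * CpowZ alpha m)%C = CpowZ alphabar m).
{ rewrite Ea, Eb, <- Cexp_add, <- (Cexp_period _ m); f_equal; unfold Cplus; cbn; f_equal; field. }
assert (bb : (CpowZ alphabar m * CpowZ alphabar m)%C = CpowZ alpha m).
{ rewrite Ea, Eb, <- Cexp_add, <- (Cexp_period _ (- m)), opp_IZR; f_equal; unfold Cplus; cbn; f_equal; field. }
destruct j; cbn [side_phase next].
- ring.
- ring [ab aa].
- ring [ab bb].
Qed.

Lemma N_fun_ext (l lam : R) (f g : side -> R -> R) (m : Z) (k : C) : 0 < l ->
  (forall j s, - (l / 2) <= s <= l / 2 -> f j s = g j s) ->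
  N_fun l lam f m k = N_fun l lam g m k.
Proof.
intros Hl H.
assert (E : forall j z, Ffun l lam f j z = Ffun l lam g j z).
{ intros j z; change (RtoC (1 / 2) * hat l (f j) (W lam z) = RtoC (1 / 2) * hat l (g j) (W lam z))%C.
  f_equal; apply hat_ext; [exact Hl|apply H]. }
unfold N_fun, T_N; cbv zeta; rewrite !E; reflexivity.
Qed.

(** Here mu l = 2 PI m / 3, so the weights alpha^m and alphabar^m are the shifts of exp (i mu s) by
    one side length forwards and backwards. *)
Lemma fourier_coefficient (l s0 : R) (u : side -> R -> R) (j : side) (m : Z) : 0 < l ->
  (forall j s, continuous (u j) s) ->
  let mu := 2 * IZR m * PI / (3 * l) in
  let P phi := perimeter_integral l s0 (u j) (u (next j)) (u (next (next j))) phi in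
  (side_phase j m * (hat l (u side1) (0%R, mu) + CpowZ alpha m * hat l (u side3) (0%R, mu)
     + CpowZ alphabar m * hat l (u side2) (0%R, mu)) * Cexp (0%R, (- (mu * s0))%R))%C
  = (P (fun x => cos (IZR m * x)), P (fun x => sin (IZR m * x))).
Proof.
intros Hl cu mu P.
rewrite (side_phase_shift j m (fun i => hat l (u i) (0, mu))).
destruct (CpowZ_alpha m) as [-> ->].
set (ph := fun x => Cexp (0, x - mu * s0)).
transitivity (ph 0%R * hat l (u j) (0%R, mu) + ph (mu * l)%R * hat l (u (next j)) (0%R, mu)
  + ph (- (mu * l))%R * hat l (u (next (next j))) (0%R, mu))%C.
{ assert (Eph : forall x, ph x = (Cexp (0%R, x) * Cexp (0%R, (- (mu * s0))%R))%C).
  { intros x; unfold ph; rewrite <- Cexp_add; f_equal; unfold Cplus; cbn; f_equal; ring. }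
  rewrite !Eph; change (Cexp (0, 0)) with (Cexp (RtoC 0)); rewrite Cexp_0.
  replace (2 * PI / 3 * IZR m) with (mu * l) by (unfold mu; field; lra); ring. }
unfold ph; rewrite !hat_phase by auto.
unfold Cplus; cbn [fst snd]; unfold P, perimeter_integral.
assert (Hex : forall g (c : R -> R) x, (forall s, continuous g s) -> (forall s, continuous c s) ->
  ex_RInt (fun s => g s * c (mu * s + x)) (- (l / 2)) (l / 2)).
{ intros g c x cg cc; apply (ex_RInt_continuous (V := R_CompleteNormedModule)); intros s _.
  apply (continuous_mult (K := R_AbsRing)); [apply cg|].
  apply (continuous_comp (fun s => mu * s + x) c); [|apply cc].
  apply (ex_derive_continuous (V := R_NormedModule)); auto_derive; exact I. }
assert (K : forall c : R -> R, (forall s, continuous c s) ->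
  RInt (fun s => u j s * c (mu * s + (0 - mu * s0))) (- (l / 2)) (l / 2)
  + RInt (fun s => u (next j) s * c (mu * s + (mu * l - mu * s0))) (- (l / 2)) (l / 2)
  + RInt (fun s => u (next (next j)) s * c (mu * s + (- (mu * l) - mu * s0))) (- (l / 2)) (l / 2)
  = RInt (fun s => u j s * c (IZR m * (2 * PI / (3 * l) * (s - s0)))
     + u (next j) s * c (IZR m * (2 * PI / (3 * l) * (s + l - s0)))
     + u (next (next j)) s * c (IZR m * (2 * PI / (3 * l) * (s - l - s0)))) (- (l / 2)) (l / 2)).
{ intros c cc.
  set (g1 := fun s => u j s * c (mu * s + (0 - mu * s0))).
  set (g2 := fun s => u (next j) s * c (mu * s + (mu * l - mu * s0))).
  set (g3 := fun s => u (next (next j)) s * c (mu * s + (- (mu * l) - mu * s0))).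
  transitivity (1 * RInt g1 (- (l / 2)) (l / 2) + 1 * RInt g2 (- (l / 2)) (l / 2)
    + 1 * RInt g3 (- (l / 2)) (l / 2) + 0 * RInt g3 (- (l / 2)) (l / 2)); [ring|].
  rewrite <- RInt_lin4 by (apply Hex; auto).
  apply RInt_ext_real; [lra|]; intros s _; unfold g1, g2, g3.
  replace (IZR m * (2 * PI / (3 * l) * (s - s0))) with (mu * s + (0 - mu * s0))
    by (unfold mu; field; lra).
  replace (IZR m * (2 * PI / (3 * l) * (s + l - s0))) with (mu * s + (mu * l - mu * s0))
    by (unfold mu; field; lra).
  replace (IZR m * (2 * PI / (3 * l) * (s - l - s0))) with (mu * s + (- (mu * l) - mu * s0))
    by (unfold mu; field; lra).
  ring. }
apply (f_equal2 (@pair R R)); apply K; intros s; [apply continuous_cos|apply continuous_sin].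
Qed.

Theorem proposition3p3 (l lam : R) (q : R -> R -> R) (f : side -> R -> R)
  (k : Z -> C)
  (hl : 0 < l)
  (hq_C2 : C2_in (open_triangle l) q)
  (hq_pde : forall x y : R, open_triangle l (x, y) ->
     dx (dx q) x y + dy (dy q) x y - 4 * lam * q x y = 0)
  (hq_cont : continuous_on_closed_triangle l q)
  (hf_smooth : forall j : side, C1_on_segment (- (l / 2)) (l / 2) (f j))
  (hf_z2 : f side1 (- (l / 2)) = f side2 (l / 2))
  (hf_z3 : f side2 (- (l / 2)) = f side3 (l / 2))
  (hf_z1 : f side3 (- (l / 2)) = f side1 (l / 2))
  (h_neumann : forall (j : side) (s : R), - (l / 2) <= s <= l / 2 ->
     has_normal_derivative l q j s (f j s))
  (hk_neq0 : forall m : Z, k m <> RtoC 0)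
  (hk : forall m : Z,
     (k m + RtoC lam / k m)%C = (0, 2 * IZR m * PI / (3 * l)))
  (hT_defined : forall m : Z, T_N_coef lam (k m) <> RtoC 0)
  (hN_defined : forall m : Z, N_den l lam m (k m) <> RtoC 0) :
  forall (j : side) (s : R), - (l / 2) <= s <= l / 2 ->
    exists sigma : C,
      is_bilateral_series
        (fun n : Z =>
           ((N_fun l lam f (3 * n) (k (3 * n)%Z)
             + coef_c1 j * Cexp (0, 2 * PI * s / (3 * l))%R
                 * N_fun l lam f (3 * n - 1) (k (3 * n - 1)%Z)
             + coef_c2 j * Cexp (0, 4 * PI * s / (3 * l))%R
                 * N_fun l lam f (3 * n - 2) (k (3 * n - 2)%Z))
            * Cexp (0, - (2 * PI * IZR n * s / l))%R)%C) sigma /\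
      RtoC (side_value l q j s) = (RtoC (1 / (3 * l)) * sigma)%C.
Proof.
intros j s Hs.
(* For m = 0 the equation reads k_0 + lam / k_0 = 0; with lam = 0 it would force k_0 = 0. *)
assert (Hlam : lam <> 0).
{ intros ->; apply (hk_neq0 0%Z).
  transitivity (k 0%Z + RtoC 0 / k 0%Z)%C; [field; apply hk_neq0|].
  rewrite hk; unfold RtoC; f_equal; field; lra. }
assert (exists F F' : side -> R -> R, (forall j s, is_derive (F j) s (F' j s)) /\
  (forall j s, continuous (F' j) s) /\
  forall j s, - (l / 2) <= s <= l / 2 -> F j s = f j s) as (F & F' & HF & cF' & EF).
{ destruct (C1_extension (- (l / 2)) (l / 2) _ ltac:(lra) (hf_smooth side1)) as (F1 & G1 & a1 & b1 & c1).
  destruct (C1_extension (- (l / 2)) (l / 2) _ ltac:(lra) (hf_smooth side2)) as (F2 & G2 & a2 & b2 & c2).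
  destruct (C1_extension (- (l / 2)) (l / 2) _ ltac:(lra) (hf_smooth side3)) as (F3 & G3 & a3 & b3 & c3).
  exists (fun j => match j with side1 => F1 | side2 => F2 | side3 => F3 end).
  exists (fun j => match j with side1 => G1 | side2 => G2 | side3 => G3 end).
  split; [|split]; intros [| |]; assumption. }
assert (cF : forall j s, continuous (F j) s)
  by (intros i t; apply (ex_derive_continuous (V := R_NormedModule)); eexists; apply HF).
assert (hFN : forall j s, - (l / 2) <= s <= l / 2 -> has_normal_derivative l q j s (F j s))
  by (intros i t Ht; rewrite EF by exact Ht; apply h_neumann, Ht).
set (u := boundary_value l q).
assert (cu : forall j s, continuous (u j) s) by (intros; apply boundary_value_continuous; assumption).
assert (Eu : forall j s, - (l / 2) <= s <= l / 2 -> u j s = side_value l q j s)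
  by (intros i t Ht; unfold u, boundary_value; rewrite clamp_id by exact Ht; reflexivity).
pose proof (global_relation l lam q F u hl hq_C2 hq_pde hq_cont cF hFN cu Eu) as GR.
set (N := fun m => N_fun l lam F m (k m)).
assert (EN : forall m, N_fun l lam f m (k m) = N m)
  by (intros m; exact (N_fun_ext l lam f F m (k m) hl (fun i t Ht => eq_sym (EF i t Ht)))).
(* The m-th term, at s on side j, of the Fourier series on the perimeter. The series of the theorem
   takes three consecutive indices per term. *)
set (b := fun m => (side_phase j m * N m * Cexp (0%R, (- (2 * IZR m * PI / (3 * l) * s))%R))%C).
set (P := fun phi => perimeter_integral l s (u j) (u (next j)) (u (next (next j))) phi).
assert (Eb : forall m, b m = (P (fun x => cos (IZR m * x)), P (fun x => sin (IZR m * x)))).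
{ intros m; unfold P; rewrite <- fourier_coefficient by assumption.
  unfold b, N; rewrite (N_fun_eq l lam F u hl GR m (k m) Hlam (hk_neq0 m) (hk m)
    (hT_defined m) (hN_defined m)).
  unfold W; rewrite hk; reflexivity. }
destruct (N_fun_decay l lam F F' hl HF cF') as (K & B & HK & HB & Hdecay).
assert (Hbm : forall m, B <= Rabs (IZR m) -> Cmod (b m) <= K / (IZR m * IZR m)).
{ intros m Hm; unfold b; rewrite !Cmod_mult, Cmod_Cexp; cbn [Re fst].
  replace (Cmod (side_phase j m)) with 1.
  - rewrite exp_0, Rmult_1_l, Rmult_1_r.
    apply Hdecay; [apply hk_neq0|apply hk|exact Hm|apply hN_defined].
  - destruct (CpowZ_alpha m) as [Ea Eab]; destruct j; cbn [side_phase];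
      rewrite ?Cmod_1, ?Ea, ?Eab, ?Cmod_Cexp; cbn [Re fst]; rewrite ?exp_0; reflexivity. }
assert (Hre : forall m, B <= Rabs (IZR m) -> Rabs (Re (b m)) <= K / (IZR m * IZR m)).
{ intros m Hm; eapply Rle_trans; [|apply Hbm, Hm].
  eapply Rle_trans; [apply Rmax_l|apply (Rmax_Cmod (b m))]. }
assert (Him : forall m, B <= Rabs (IZR m) -> Rabs (Im (b m)) <= K / (IZR m * IZR m)).
{ intros m Hm; eapply Rle_trans; [|apply Hbm, Hm].
  eapply Rle_trans; [apply Rmax_r|apply (Rmax_Cmod (b m))]. }
destruct (bilateral_real (fun m => Re (b m)) K B HK Hre) as (x & y & z & Hx & Hy & Hz & Exy).
destruct (bilateral_real (fun m => Im (b m)) K B HK Him) as (x' & y' & z' & Hx' & Hy' & Hz' & Exy').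
assert (Pext : forall phi psi, (forall x, phi x = psi x) -> P phi = P psi).
{ intros phi psi H; unfold P, perimeter_integral; apply RInt_ext_real; [lra|]; intros t _.
  rewrite !H; reflexivity. }
assert (Zr : z = 3 * l * side_value l q j s).
{ apply (fejer_limit l s hl (u j) (u (next j)) (u (next (next j))) (side_value l q j s) z
    (fun m => match m with
      | O => Re (b 0%Z) | S _ => Re (b (Z.of_nat m)) + Re (b (- Z.of_nat m)%Z) end)); auto.
  - intros eps Heps; apply perimeter_oscillation; assumption.
  - rewrite Eb; cbn [Re fst]; apply Pext; intros t; rewrite Rmult_0_l; apply cos_0.
  - intros m; rewrite !Eb; cbn [Re fst]; rewrite opp_IZR, <- INR_IZR_INZ.
    rewrite (Pext (fun x => cos (- INR (S m) * x)) (fun x => cos (INR (S m) * x))).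
    + unfold P; ring.
    + intros t; rewrite <- cos_neg; f_equal; ring. }
(* Sine is odd, so the imaginary parts of the terms m and - m cancel in every symmetric partial
   sum. *)
assert (Zi : z' = 0).
{ apply (UL_sequence _ _ _ Hz').
  apply Un_cv_ext with (fun _ => 0).
  - intros n; induction n as [|n IH]; cbn [sum_f_R0].
    + rewrite Eb; cbn [Im snd]; unfold P, perimeter_integral.
      rewrite (RInt_ext_real _ (fun _ => 0)), RInt_const; [symmetry; apply Rmult_0_r|lra|].
      intros t _; rewrite !Rmult_0_l, sin_0; ring.
    + rewrite <- IH, !Eb; cbn [Im snd]; rewrite opp_IZR.
      set (w := IZR (Z.of_nat (S n))).
      (* - sin written as sin - 2 sin, the shape handled by [perimeter_integral_plus]. *)
      rewrite (Pext (fun x => sin (- w * x)) (fun x => sin (w * x) + -2 * sin (w * x))).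
      * assert (cs : forall t, continuous (fun x => sin (w * x)) t).
        { intros t; apply (ex_derive_continuous (V := R_NormedModule)); auto_derive; exact I. }
        unfold P; rewrite (perimeter_integral_plus l s hl _ _ _ (cu _) (cu _) (cu _)
          (fun x : R => sin (w * x)) (fun x : R => sin (w * x)) (-2) cs cs); ring.
      * intros t; rewrite Ropp_mult_distr_l_reverse, sin_neg; ring.
  - intros e He; exists 0%nat; intros; unfold Rdist; rewrite Rminus_diag, Rabs_R0; exact He. }
exists (RtoC z); split.
- exists (x, x'), (y, y').
  assert (Et : forall n : Z, ((N_fun l lam f (3 * n) (k (3 * n)%Z)
             + coef_c1 j * Cexp (0, 2 * PI * s / (3 * l))%R
                 * N_fun l lam f (3 * n - 1) (k (3 * n - 1)%Z)
             + coef_c2 j * Cexp (0, 4 * PI * s / (3 * l))%R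
                 * N_fun l lam f (3 * n - 2) (k (3 * n - 2)%Z))
            * Cexp (0, - (2 * PI * IZR n * s / l))%R)%C
    = (b (3 * n)%Z + b (3 * n - 1)%Z + b (3 * n - 2)%Z)%C).
  { intros n; rewrite !EN; unfold b.
    destruct (side_phase_residues j n) as (-> & -> & ->).
    rewrite !minus_IZR, !mult_IZR.
    set (en := Cexp (0, - (2 * PI * IZR n * s / l))).
    replace (Cexp (0, - (2 * (3 * IZR n) * PI / (3 * l) * s))) with en
      by (unfold en; do 2 f_equal; field; lra).
    replace (Cexp (0, - (2 * (3 * IZR n - 1) * PI / (3 * l) * s)))
      with (Cexp (0%R, (2 * PI * s / (3 * l))%R) * en)%C
      by (unfold en; rewrite <- Cexp_add; f_equal; unfold Cplus; cbn; f_equal; field; lra).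
    replace (Cexp (0, - (2 * (3 * IZR n - 2) * PI / (3 * l) * s)))
      with (Cexp (0%R, (4 * PI * s / (3 * l))%R) * en)%C
      by (unfold en; rewrite <- Cexp_add; f_equal; unfold Cplus; cbn; f_equal; field; lra).
    ring. }
  split; [|split].
  + apply (is_series_ext (fun n : nat => let n := Z.of_nat n in
      (b (3 * n)%Z + b (3 * n - 1)%Z + b (3 * n - 2)%Z)%C)); [intros n; symmetry; apply Et|].
    apply is_series_pair; [exact Hx|exact Hx'].
  + apply (is_series_ext (fun n : nat => let n := (- Z.of_nat (S n))%Z in
      (b (3 * n)%Z + b (3 * n - 1)%Z + b (3 * n - 2)%Z)%C)); [intros n; symmetry; apply Et|].
    apply is_series_pair; [exact Hy|exact Hy'].
  + unfold Cplus, RtoC; cbn [fst snd]; rewrite Exy, Exy', Zi; reflexivity.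
- rewrite Zr, <- RtoC_mult; f_equal; field; lra.
Qed.
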